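(* Let $\mathfrak g$ be a finite-dimensional simple complex Lie algebra not of type $\mathsf G_2$, and regard the twisted Yangian ${}^\imath\mathscr Y$ as a subalgebra of the Yangian $\mathscr Y$ via $\varphi$. For every $i\in\mathbb I$, $$h_i(u)\equiv\xi_i(u)\xi_i(-u)\pmod{\mathscr Y_{Q_+}[\![u^{-1}]\!]},$$ $$b_i(u)\equiv\tfrac12\{x_i^+(u),\xi_i(-u)\}+x_i^-(-u)\pmod{\mathscr Y_{\alpha_i+Q_+}[\![u^{-1}]\!]},$$ $$\Delta(h_i(u))\equiv h_i(u)\otimes\xi_i(u)\xi_i(-u)\pmod{{}^\imath\mathscr Y\otimes\mathscr Y_{Q_+}[\![u^{-1}]\!]},$$ $$\Delta(b_i(u))\equiv b_i(u)\otimes\xi_i(-u)+1\otimes b_i(u)\pmod{{}^\imath\mathscr Y\otimes\mathscr Y_{Q_+}[\![u^{-1}]\!]}.$$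
   Context: All algebras are over $\mathbb C$, $\mathbb N=\{0,1,2,\dots\}$, $\{x,y\}=xy+yx$. Lie algebra. $\mathfrak g$ has Cartan matrix $(c_{ij})_{i,j\in\mathbb I}$, simple roots $\alpha_i$, positive roots $\Phi^+$, root lattice $Q$, a fixed invariant inner product $(\cdot,\cdot)$, $d_i=\frac12(\alpha_i,\alpha_i)$, $d_ic_{ij}=(\alpha_i,\alpha_j)$. Chevalley generators $x_i^\pm,\xi_i$ are normalized by $(x_i^+,x_i^-)=1$, $\xi_i=[x_i^+,x_i^-]$. The Chevalley involution is $\omega:\xi_i\mapsto-\xi_i$, $x_i^\pm\mapsto-x_i^\mp$. For $\alpha\in\Phi^+$ the root vectors $x_\alpha^\pm\in\mathfrak g_{\pm\alpha}$ satisfy $(x_\alpha^+,x_\alpha^-)=1$, $x_{\alpha_i}^\pm=x_i^\pm$, $\omega(x_\alpha^\pm)=-x_\alpha^\mp$. Yangian. $\mathscr Y$ is the unital associative algebra with generators $x_{i,r}^\pm,\xi_{i,r}$ ($i\in\mathbb I,r\in\mathbb N$) and relations $[\xi_{i,r},\xi_{j,s}]=0$; $[\xi_{i,0},x_{j,s}^\pm]=\pm(\alpha_i,\alpha_j)x_{j,s}^\pm$; $[x_{i,r}^+,x_{j,s}^-]=\delta_{ij}\xi_{i,r+s}$; $[\xi_{i,r+1},x_{j,s}^\pm]-[\xi_{i,r},x_{j,s+1}^\pm]=\pm\frac12(\alpha_i,\alpha_j)\{\xi_{i,r},x_{j,s}^\pm\}$; $[x_{i,r+1}^\pm,x_{j,s}^\pm]-[x_{i,r}^\pm,x_{j,s+1}^\pm]=\pm\frac12(\alpha_i,\alpha_j)\{x_{i,r}^\pm,x_{j,s}^\pm\}$;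 and for $i\ne j$, $m=1-c_{ij}$, $\sum_{\sigma\in\mathfrak S_m}[x^\pm_{i,r_{\sigma(1)}},[x^\pm_{i,r_{\sigma(2)}},\cdots,[x^\pm_{i,r_{\sigma(m)}},x^\pm_{j,s}]\cdots]]=0$. $\mathrm U(\mathfrak g)$ is a subalgebra via $\xi_i\mapsto\xi_{i,0}$, $x_i^\pm\mapsto x_{i,0}^\pm$. $\mathscr Y$ is a Hopf algebra whose coproduct is determined by $\Delta(x)=x\otimes1+1\otimes x$ for $x\in\mathfrak g$ and $\Delta(\xi_{i,1})=\xi_{i,1}\otimes1+1\otimes\xi_{i,1}+\xi_i\otimes\xi_i-\sum_{\alpha\in\Phi^+}(\alpha,\alpha_i)x_\alpha^-\otimes x_\alpha^+$. Set $\xi_i(u)=1+\sum_{r\ge0}\xi_{i,r}u^{-r-1}$, $x_i^\pm(u)=\sum_{r\ge0}x_{i,r}^\pm u^{-r-1}$. $\mathscr Y$ is $Q$-graded by $\deg\xi_{i,r}=0$, $\deg x_{i,r}^\pm=\pm\alpha_i$; for $\mathsf S\subset Q$, $\mathscr Y_{\mathsf S}$ is the span of homogeneous elements with degree in $\mathsf S$. $Q_+=\{\sum_ik_i\alpha_i: k_i\in\mathbb N,\sum_ik_i>0\}$. Twisted Yangian. ${}^\imath\mathscr Y$ is the unital associative algebra generated by $h_{i,2r+1},b_{i,r}$ ($i\in\mathbb I,r\in\mathbb N$) with relations ($h_{i,-1}=1$, $h_{i,r}=0$ if $r$ is even or $r<-1$; $r,s\in\mathbb N$): $[h_{i,r},h_{j,s}]=0$;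 $[h_{i,r+1},b_{j,s}]-[h_{i,r-1},b_{j,s+2}]=(\alpha_i,\alpha_j)\{h_{i,r-1},b_{j,s+1}\}+\frac14(\alpha_i,\alpha_j)^2[h_{i,r-1},b_{j,s}]$; $[b_{i,r+1},b_{j,s}]-[b_{i,r},b_{j,s+1}]=\frac12(\alpha_i,\alpha_j)\{b_{i,r},b_{j,s}\}-2\delta_{ij}(-1)^sh_{i,r+s+1}$; $[b_{i,0},b_{j,0}]=0$ if $c_{ij}=0$; $\mathrm{ad}(b_{i,0})^2(b_{j,0})=-d_ib_{j,0}$ if $c_{ij}=-1$; $\mathrm{ad}(b_{i,0})^3(b_{j,0})=-4d_i[b_{i,0},b_{j,0}]$ if $c_{ij}=-2$; $\mathrm{ad}(b_{i,0})^4(b_{j,0})=-10d_i[b_{i,0},[b_{i,0},b_{j,0}]]-9d_i^2b_{j,0}$ if $c_{ij}=-3$. It is generated by the $h_{i,1},b_{i,0}$. Set $h_i(u)=1+\sum_{r\ge0}h_{i,2r+1}u^{-2r-2}$, $b_i(u)=\sum_{r\ge0}b_{i,r}u^{-r-1}$. Embedding. For $\mathfrak g$ not of type $\mathsf G_2$, $\varphi:{}^\imath\mathscr Y\to\mathscr Y$ is the injective algebra homomorphism with $b_{i,0}\mapsto x_i^+-x_i^-$ and $h_{i,1}\mapsto2\xi_{i,1}-\xi_{i}^2+\sum_{\alpha\in\Phi^+}(\alpha,\alpha_i)(x_\alpha^+)^2$; its image is a right coideal subalgebra, $\Delta({}^\imath\mathscr Y)\subset{}^\imath\mathscr Y\otimes\mathscr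 Y$. Congruences of series are coefficientwise. *)

(* Defs.v *)
From HB Require Import structures.
From mathcomp Require Import all_boot all_order all_algebra perm.
From mathcomp Require Import ring_quotient.
From mathcomp Require Import boolp reals complex.
From mathcomp Require Import monalg.
Set Implicit Arguments.
Unset Strict Implicit.
Unset Printing Implicit Defensive.
Import Order.TTheory GRing.Theory Num.Theory.
Local Open Scope ring_scope.
Local Open Scope quotient_scope.


Notation free_alg K G := {malg K[{fmonom G}]}.

Section FreeAlgebra.
Variables (K : fieldType) (G : choiceType).

Definition fgen (g : G) : free_alg K G := << fmu g >>.

Lemma free_scalerAr (c : K) (x y : free_alg K G) : c *: (x * y) = x * (c *: y).
Proof.
have hC (z : free_alg K G) : z * c%:MP = c *: z.
  rewrite [LHS](fgmulgU c mone z).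
  by apply: eq_bigr => k _; rewrite mulm1 mulrC.
by rewrite -!hC mulrA.
Qed.

(* A set of relations r = 0 all of which have zero constant term.  Both families
   used below are of this kind; it guarantees that the quotient is not the zero
   ring, as [algType] requires. *)
Record relations := Relations {
  rel_set :> free_alg K G -> Prop;
  rel_const : forall x, rel_set x -> x@_(mone : {fmonom G}) = 0
}.

Variable rel : relations.

Inductive rel_ideal : free_alg K G -> Prop :=
| rel_ideal_rel x : rel x -> rel_ideal x
| rel_ideal0 : rel_ideal 0
| rel_idealB x y : rel_ideal x -> rel_ideal y -> rel_ideal (x - y)
| rel_idealMl a x : rel_ideal x -> rel_ideal (a * x)
| rel_idealMr a x : rel_ideal x -> rel_ideal (x * a).

Definition rel_ideal_pred : {pred free_alg K G} := fun x => `[< rel_ideal x >].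

Lemma rel_ideal_predP x : reflect (rel_ideal x) (x \in rel_ideal_pred).
Proof. exact: asboolP. Qed.

Lemma rel_ideal_closed : zmod_closed rel_ideal_pred.
Proof.
split=> [|x y]; first exact/rel_ideal_predP/rel_ideal0.
by move=> /rel_ideal_predP hx /rel_ideal_predP hy; apply/rel_ideal_predP/rel_idealB.
Qed.
HB.instance Definition _ :=
  GRing.isZmodClosed.Build (free_alg K G) rel_ideal_pred rel_ideal_closed.

Definition presented := Quotient.quot rel_ideal_pred.
HB.instance Definition _ := Choice.on presented.
HB.instance Definition _ := GRing.Zmodule.on presented.

Definition pres_pi (x : free_alg K G) : presented := \pi_presented x.

Lemma pres_piP x y : pres_pi x = pres_pi y <-> rel_ideal (x - y).
Proof.
split=> [/eqP|h].
  by rewrite /pres_pi -Quotient.idealrBE => /rel_ideal_predP.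
by apply/eqP; rewrite /pres_pi -Quotient.idealrBE; apply/rel_ideal_predP.
Qed.

Lemma pres_pi_repr (u : presented) : pres_pi (repr u) = u.
Proof. exact: reprK. Qed.

Lemma pres_piB : {morph pres_pi : x y / x - y}.
Proof. by move=> x y; rewrite /pres_pi !piE. Qed.
Lemma pres_piD : {morph pres_pi : x y / x + y}.
Proof. by move=> x y; rewrite /pres_pi !piE. Qed.

Definition pres_one : presented := pres_pi 1.
Definition pres_mul (u v : presented) : presented := pres_pi (repr u * repr v).
Definition pres_scale (c : K) (u : presented) : presented := pres_pi (c *: repr u).

Lemma pres_piM x y : pres_mul (pres_pi x) (pres_pi y) = pres_pi (x * y).
Proof.
apply/pres_piP.
set x' := repr _; set y' := repr _.
have hx : rel_ideal (x' - x) by apply/pres_piP; rewrite pres_pi_repr.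
have hy : rel_ideal (y' - y) by apply/pres_piP; rewrite pres_pi_repr.
have -> : x' * y' - x * y = (x' - x) * y' - x * (y - y').
  by rewrite mulrBl mulrBr opprB addrA subrK.
apply: rel_idealB; first exact: rel_idealMr.
apply: rel_idealMl; rewrite -opprB -[- _]add0r.
by apply: rel_idealB => //; exact: rel_ideal0.
Qed.

Lemma pres_piZ c x : pres_scale c (pres_pi x) = pres_pi (c *: x).
Proof.
apply/pres_piP; rewrite -scalerBr -[_ - x]mul1r scalerAl.
by apply: rel_idealMl; apply/pres_piP; rewrite pres_pi_repr.
Qed.

Let pres_ind (P : presented -> Prop) : (forall x, P (pres_pi x)) -> forall u, P u.
Proof. by move=> h u; rewrite -[u]pres_pi_repr. Qed.

Lemma pres_mulA : associative pres_mul.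
Proof.
elim/pres_ind=> x; elim/pres_ind=> y; elim/pres_ind=> z.
by rewrite !pres_piM mulrA.
Qed.
Lemma pres_mul1r : left_id pres_one pres_mul.
Proof. by elim/pres_ind=> x; rewrite pres_piM mul1r. Qed.
Lemma pres_mulr1 : right_id pres_one pres_mul.
Proof. by elim/pres_ind=> x; rewrite pres_piM mulr1. Qed.
Lemma pres_mulDl : left_distributive pres_mul +%R.
Proof.
elim/pres_ind=> x; elim/pres_ind=> y; elim/pres_ind=> z.
by rewrite -pres_piD !pres_piM mulrDl pres_piD.
Qed.
Lemma pres_mulDr : right_distributive pres_mul +%R.
Proof.
elim/pres_ind=> x; elim/pres_ind=> y; elim/pres_ind=> z.
by rewrite -pres_piD !pres_piM mulrDr pres_piD.
Qed.
HB.instance Definition _ := GRing.Zmodule_isPzRing.Build presented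
  pres_mulA pres_mul1r pres_mulr1 pres_mulDl pres_mulDr.

Lemma rel_ideal_const x : rel_ideal x -> x@_(mone : {fmonom G}) = 0.
Proof.
elim=> {x} [x /rel_const||x y _ hx _ hy|a x _ hx|a x _ hx] //.
- by rewrite raddf0.
- by rewrite raddfB /= hx hy subrr.
- by rewrite rmorphM /= hx mulr0.
- by rewrite rmorphM /= hx mul0r.
Qed.

Lemma pres_one_neq0 : (1 : presented) != 0.
Proof.
apply/eqP=> h.
have h0 : pres_pi 0 = 0 by rewrite -[0 in LHS](subrr 0) pres_piB subrr.
have /pres_piP/rel_ideal_const/eqP : pres_pi 1 = pres_pi 0 by rewrite h0.
by rewrite subr0 rmorph1 oner_eq0.
Qed.
HB.instance Definition _ := GRing.PzSemiRing_isNonZero.Build presented pres_one_neq0.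

Lemma pres_scaleA a b u : pres_scale a (pres_scale b u) = pres_scale (a * b) u.
Proof. by elim/pres_ind: u => x; rewrite !pres_piZ scalerA. Qed.
Lemma pres_scale1 : left_id 1 pres_scale.
Proof. by elim/pres_ind=> x; rewrite pres_piZ scale1r. Qed.
Lemma pres_scaleDr : right_distributive pres_scale +%R.
Proof.
move=> a; elim/pres_ind=> x; elim/pres_ind=> y.
by rewrite -pres_piD !pres_piZ scalerDr pres_piD.
Qed.
Lemma pres_scaleDl u : {morph pres_scale^~ u : a b / a + b}.
Proof. by elim/pres_ind: u => x a b; rewrite !pres_piZ scalerDl pres_piD. Qed.
HB.instance Definition _ := GRing.Zmodule_isLmodule.Build K presented
  pres_scaleA pres_scale1 pres_scaleDr pres_scaleDl.

Lemma pres_scalerAl (c : K) (u v : presented) : c *: (u * v) = (c *: u) * v.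
Proof.
elim/pres_ind: u => x; elim/pres_ind: v => y.
change (pres_scale c (pres_mul (pres_pi x) (pres_pi y)) =
        pres_mul (pres_scale c (pres_pi x)) (pres_pi y)).
by rewrite pres_piM !pres_piZ pres_piM scalerAl.
Qed.
HB.instance Definition _ :=
  GRing.LSemiModule_isLSemiAlgebra.Build K presented pres_scalerAl.

Lemma pres_scalerAr (c : K) (u v : presented) : c *: (u * v) = u * (c *: v).
Proof.
elim/pres_ind: u => x; elim/pres_ind: v => y.
change (pres_scale c (pres_mul (pres_pi x) (pres_pi y)) =
        pres_mul (pres_pi x) (pres_scale c (pres_pi y))).
by rewrite pres_piM !pres_piZ pres_piM free_scalerAr.
Qed.
HB.instance Definition _ :=
  GRing.LSemiAlgebra_isSemiAlgebra.Build K presented pres_scalerAr.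

Lemma pres_pi_zmod : zmod_morphism pres_pi. Proof. exact: pres_piB. Qed.
HB.instance Definition _ :=
  GRing.isZmodMorphism.Build (free_alg K G) presented pres_pi pres_pi_zmod.
Lemma pres_pi_monoid : monoid_morphism pres_pi.
Proof. by split=> // x y; rewrite -pres_piM. Qed.
HB.instance Definition _ :=
  GRing.isMonoidMorphism.Build (free_alg K G) presented pres_pi pres_pi_monoid.
Lemma pres_pi_scalable : scalable pres_pi.
Proof. by move=> c x; rewrite -pres_piZ. Qed.
HB.instance Definition _ :=
  GRing.isScalable.Build K (free_alg K G) presented _ pres_pi pres_pi_scalable.

Definition pres_gen (g : G) : presented := pres_pi (fgen g).

Lemma pres_rel x : rel x -> pres_pi x = 0.
Proof.
by move=> hx; rewrite -(raddf0 pres_pi); apply/pres_piP; rewrite subr0; apply: rel_ideal_rel.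
Qed.

End FreeAlgebra.


Section Tensor.
Variables (K : fieldType) (A B : algType K).

(* The list [:: (a1, b1); ...; (an, bn)] stands for the formal sum
   a1 (x) b1 + ... + an (x) bn, and [tens_eq] is the congruence on formal sums
   generated by bilinearity.  The scalar c acts by (a, b) |-> (c a, b). *)
Inductive tens_eq : seq (A * B) -> seq (A * B) -> Prop :=
| tens_eq_refl s : tens_eq s s
| tens_eq_sym s t : tens_eq s t -> tens_eq t s
| tens_eq_trans s t u : tens_eq s t -> tens_eq t u -> tens_eq s u
| tens_eq_cat s s' t t' : tens_eq s s' -> tens_eq t t' -> tens_eq (s ++ t) (s' ++ t')
| tens_eq_catC s t : tens_eq (s ++ t) (t ++ s)
| tens_eq_Dl a a' b : tens_eq [:: (a + a', b)] [:: (a, b); (a', b)]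
| tens_eq_Dr a b b' : tens_eq [:: (a, b + b')] [:: (a, b); (a, b')]
| tens_eq_Z c a b : tens_eq [:: (c *: a, b)] [:: (a, c *: b)]
| tens_eq_0 b : tens_eq [:: (0, b)] [::].

Definition tens_eqb s t := `[< tens_eq s t >].

Lemma tens_eqP s t : reflect (tens_eq s t) (tens_eqb s t).
Proof. exact: asboolP. Qed.

Lemma tens_eq_equiv : equiv_class_of tens_eqb.
Proof.
split=> [s|s t|t s u].
- exact/tens_eqP/tens_eq_refl.
- by apply/tens_eqP/tens_eqP; apply: tens_eq_sym.
- by move=> /tens_eqP h1 /tens_eqP h2; apply/tens_eqP; apply: tens_eq_trans h1 h2.
Qed.
Canonical tens_equiv_rel := EquivRelPack tens_eq_equiv.
Canonical tens_encModRel := defaultEncModRel tens_eqb.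

Definition tensor := {eq_quot tens_eqb}.
HB.instance Definition _ := Choice.on tensor.

Definition tens_pi (s : seq (A * B)) : tensor := \pi_tensor s.
Definition tens (a : A) (b : B) : tensor := tens_pi [:: (a, b)].

Lemma tens_piP s t : tens_pi s = tens_pi t <-> tens_eq s t.
Proof. by split=> [/eqmodP/tens_eqP|/tens_eqP h] //; apply/eqmodP. Qed.

Lemma tens_pi_repr (u : tensor) : tens_pi (repr u) = u.
Proof. exact: reprK. Qed.

Let tens_ind (P : tensor -> Prop) : (forall s, P (tens_pi s)) -> forall u, P u.
Proof. by move=> h u; rewrite -[u]tens_pi_repr. Qed.

Lemma tens_repr_eq s : tens_eq (repr (tens_pi s)) s.
Proof. by apply/tens_piP; rewrite tens_pi_repr. Qed.

Definition fsum_scale (c : K) (s : seq (A * B)) := [seq (c *: p.1, p.2) | p <- s].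
Definition fsum_mul (s t : seq (A * B)) :=
  [seq (p.1 * q.1, p.2 * q.2) | p <- s, q <- t].

Lemma fsum_scale_eq c s t : tens_eq s t -> tens_eq (fsum_scale c s) (fsum_scale c t).
Proof.
elim=> {s t} [s|s t _|s t u _ h1 _|s s' t t' _ h1 _ h2|s t|a a' b|a b b'|d a b|b].
- exact: tens_eq_refl.
- exact: tens_eq_sym.
- exact: tens_eq_trans.
- by rewrite /fsum_scale !map_cat; apply: tens_eq_cat.
- by rewrite /fsum_scale !map_cat; apply: tens_eq_catC.
- by rewrite /= scalerDr; apply: tens_eq_Dl.
- exact: tens_eq_Dr.
- by rewrite /= scalerA mulrC -scalerA; apply: tens_eq_Z.
- by rewrite /= scaler0; apply: tens_eq_0.
Qed.

Lemma fsum_mul_catl s t u : fsum_mul (s ++ t) u = fsum_mul s u ++ fsum_mul t u.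
Proof. exact: allpairs_cat. Qed.

Lemma tens_eq_perm s t : perm_eq s t -> tens_eq s t.
Proof.
elim: s t => [|x s IH] t.
  by move=> h; move: (perm_size h) => /esym/eqP; rewrite size_eq0 => /eqP->; apply: tens_eq_refl.
move=> h; have xt : x \in t by rewrite -(perm_mem h) mem_head.
case/splitPr: xt h => t1 t2 h.
have h' : perm_eq s (t1 ++ t2).
  by move: h; rewrite -[x :: t2]cat1s perm_sym perm_catCA /= perm_cons perm_sym.
apply: tens_eq_trans (_ : tens_eq ([:: x] ++ (t1 ++ t2)) _).
  by apply: (tens_eq_cat (tens_eq_refl [:: x])); apply: IH.
rewrite -[x :: t2]cat1s !catA; apply: tens_eq_cat; last exact: tens_eq_refl.
exact: tens_eq_catC.
Qed.

Lemma fsum_mul_catr s t u : tens_eq (fsum_mul s (t ++ u)) (fsum_mul s t ++ fsum_mul s u).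
Proof. by apply: tens_eq_perm; exact/permPl/perm_allpairs_catr. Qed.

Lemma fsum_mul_nilr s : fsum_mul s [::] = [::].
Proof. by elim: s. Qed.

Lemma fsum_mul_eqr s t u : tens_eq t u -> tens_eq (fsum_mul s t) (fsum_mul s u).
Proof.
move=> htu; elim: s => [|p s IH]; first exact: tens_eq_refl.
apply: (tens_eq_cat _ IH).
elim: htu => {t u IH} [t|t u _|t u v _ h1 _|t t' u u' _ h1 _ h2|t u|a a' b|a b b'|d a b|b].
- exact: tens_eq_refl.
- exact: tens_eq_sym.
- exact: tens_eq_trans.
- by rewrite !map_cat; apply: tens_eq_cat.
- by rewrite !map_cat; apply: tens_eq_catC.
- by rewrite /= mulrDr; apply: tens_eq_Dl.
- by rewrite /= mulrDr; apply: tens_eq_Dr.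
- by rewrite /= -!scalerAr; apply: tens_eq_Z.
- by rewrite /= mulr0; apply: tens_eq_0.
Qed.

Lemma fsum_mul_pairr s q : fsum_mul s [:: q] = [seq (p.1 * q.1, p.2 * q.2) | p <- s].
Proof. by elim: s => //= p s <-. Qed.

Lemma fsum_mul_eql s t u : tens_eq s t -> tens_eq (fsum_mul s u) (fsum_mul t u).
Proof.
move=> hst; elim: u => [|q u IH].
  by rewrite !fsum_mul_nilr; apply: tens_eq_refl.
rewrite -[q :: u]cat1s.
apply: tens_eq_trans (fsum_mul_catr _ _ _) _.
apply: tens_eq_trans _ (tens_eq_sym (fsum_mul_catr _ _ _)).
apply: (tens_eq_cat _ IH); rewrite !fsum_mul_pairr.
elim: hst => {s t IH} [t|s t _|s t v _ h1 _|s t s' t' _ h1 _ h2|s t|a a' b|a b b'|d a b|b].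
- exact: tens_eq_refl.
- exact: tens_eq_sym.
- exact: tens_eq_trans.
- by rewrite !map_cat; apply: tens_eq_cat.
- by rewrite !map_cat; apply: tens_eq_catC.
- by rewrite /= mulrDl; apply: tens_eq_Dl.
- by rewrite /= mulrDl; apply: tens_eq_Dr.
- by rewrite /= -!scalerAl; apply: tens_eq_Z.
- by rewrite /= mul0r; apply: tens_eq_0.
Qed.

Lemma fsum_mul_eq s s' t t' :
  tens_eq s s' -> tens_eq t t' -> tens_eq (fsum_mul s t) (fsum_mul s' t').
Proof. by move=> hs ht; apply: tens_eq_trans (fsum_mul_eql _ hs) (fsum_mul_eqr _ ht). Qed.

Definition tens_zero : tensor := tens_pi [::].
Definition tens_add (u v : tensor) : tensor := tens_pi (repr u ++ repr v).
Definition tens_scale (c : K) (u : tensor) : tensor := tens_pi (fsum_scale c (repr u)).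
Definition tens_opp : tensor -> tensor := tens_scale (-1).
Definition tens_one : tensor := tens 1 1.
Definition tens_mul (u v : tensor) : tensor := tens_pi (fsum_mul (repr u) (repr v)).

Lemma tens_addE s t : tens_add (tens_pi s) (tens_pi t) = tens_pi (s ++ t).
Proof. by apply/tens_piP; apply: tens_eq_cat; apply: tens_repr_eq. Qed.
Lemma tens_scaleE c s : tens_scale c (tens_pi s) = tens_pi (fsum_scale c s).
Proof. by apply/tens_piP; apply: fsum_scale_eq; apply: tens_repr_eq. Qed.
Lemma tens_mulE s t : tens_mul (tens_pi s) (tens_pi t) = tens_pi (fsum_mul s t).
Proof. by apply/tens_piP; apply: fsum_mul_eq; apply: tens_repr_eq. Qed.

Lemma tens_addA : associative tens_add.
Proof.
elim/tens_ind=> s; elim/tens_ind=> t; elim/tens_ind=> u.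
by rewrite !tens_addE catA.
Qed.
Lemma tens_addC : commutative tens_add.
Proof.
elim/tens_ind=> s; elim/tens_ind=> t; rewrite !tens_addE.
exact/tens_piP/tens_eq_catC.
Qed.
Lemma tens_add0 : left_id tens_zero tens_add.
Proof. by elim/tens_ind=> s; rewrite tens_addE. Qed.
Lemma tens_addN : left_inverse tens_zero tens_opp tens_add.
Proof.
elim/tens_ind=> s; rewrite /tens_opp tens_scaleE tens_addE; apply/tens_piP.
elim: s => [|[a b] s IH]; first exact: tens_eq_refl.
have h : tens_eq [:: (-1 *: a, b); (a, b)] [::].
  apply: tens_eq_trans (tens_eq_sym (tens_eq_Dl _ _ _)) _.
  by rewrite scaleN1r addNr; apply: tens_eq_0.
apply: tens_eq_trans (tens_eq_cat h IH).
by apply: tens_eq_perm; rewrite /= perm_cons -cat1s perm_catCA.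
Qed.
HB.instance Definition _ :=
  GRing.isZmodule.Build tensor tens_addA tens_addC tens_add0 tens_addN.

Lemma tens_piD s t : tens_pi (s ++ t) = tens_pi s + tens_pi t.
Proof. by rewrite -tens_addE. Qed.

Lemma fsum_mulA s t u : fsum_mul s (fsum_mul t u) = fsum_mul (fsum_mul s t) u.
Proof.
elim: s => [|p s IH] //=.
rewrite -[fsum_mul (p :: s) t]/(map _ t ++ fsum_mul s t) fsum_mul_catl -IH.
congr (_ ++ _); elim: t {IH} => [|q t IHt] //=.
rewrite -[fsum_mul (q :: t) u]/(map _ u ++ fsum_mul t u) map_cat IHt.
congr (_ ++ _); rewrite -map_comp; apply: eq_map => r /=.
by rewrite !mulrA.
Qed.

Lemma tens_mulA : associative tens_mul.
Proof.
elim/tens_ind=> s; elim/tens_ind=> t; elim/tens_ind=> u.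
by rewrite !tens_mulE fsum_mulA.
Qed.
Lemma tens_mul1r : left_id tens_one tens_mul.
Proof.
elim/tens_ind=> s; rewrite tens_mulE; congr tens_pi.
rewrite /fsum_mul /= cats0 -[RHS]map_id; apply: eq_map => -[a b].
by rewrite !mul1r.
Qed.
Lemma tens_mulr1 : right_id tens_one tens_mul.
Proof.
elim/tens_ind=> s; rewrite tens_mulE fsum_mul_pairr; congr tens_pi.
by rewrite -[RHS]map_id; apply: eq_map => -[a b]; rewrite !mulr1.
Qed.
Lemma tens_mulDl : left_distributive tens_mul +%R.
Proof.
elim/tens_ind=> s; elim/tens_ind=> t; elim/tens_ind=> u.
by rewrite -tens_piD !tens_mulE fsum_mul_catl tens_piD.
Qed.
Lemma tens_mulDr : right_distributive tens_mul +%R.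
Proof.
elim/tens_ind=> s; elim/tens_ind=> t; elim/tens_ind=> u.
rewrite -tens_piD !tens_mulE -tens_piD; exact/tens_piP/fsum_mul_catr.
Qed.
HB.instance Definition _ := GRing.Zmodule_isPzRing.Build tensor
  tens_mulA tens_mul1r tens_mulr1 tens_mulDl tens_mulDr.

Lemma tens_scaleA a b u : tens_scale a (tens_scale b u) = tens_scale (a * b) u.
Proof.
elim/tens_ind: u => s; rewrite !tens_scaleE /fsum_scale -map_comp.
by congr tens_pi; apply: eq_map => p /=; rewrite scalerA.
Qed.
Lemma tens_scale1 : left_id 1 tens_scale.
Proof.
elim/tens_ind=> s; rewrite tens_scaleE -[in RHS](map_id s).
by congr tens_pi; apply: eq_map => -[a b]; rewrite scale1r.
Qed.
Lemma tens_scaleDr : right_distributive tens_scale +%R.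
Proof.
move=> c; elim/tens_ind=> s; elim/tens_ind=> t.
by rewrite -tens_piD !tens_scaleE /fsum_scale map_cat tens_piD.
Qed.
Lemma tens_scaleDl u : {morph tens_scale^~ u : a b / a + b}.
Proof.
elim/tens_ind: u => s c d; rewrite !tens_scaleE -tens_piD; apply/tens_piP.
elim: s => [|[a b] s IH]; first exact: tens_eq_refl.
have h : tens_eq [:: ((c + d) *: a, b)] [:: (c *: a, b); (d *: a, b)].
  by rewrite scalerDl; apply: tens_eq_Dl.
apply: tens_eq_trans (tens_eq_cat h IH) _; apply: tens_eq_perm.
by rewrite /= perm_cons -cat1s perm_catCA.
Qed.
HB.instance Definition _ := GRing.Zmodule_isLmodule.Build K tensor
  tens_scaleA tens_scale1 tens_scaleDr tens_scaleDl.

Lemma tensDl a a' b : tens (a + a') b = tens a b + tens a' b.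
Proof. by rewrite -tens_piD; apply/tens_piP; apply: tens_eq_Dl. Qed.
Lemma tensDr a b b' : tens a (b + b') = tens a b + tens a b'.
Proof. by rewrite -tens_piD; apply/tens_piP; apply: tens_eq_Dr. Qed.
Lemma tensZl c a b : tens (c *: a) b = c *: tens a b.
Proof. exact: esym (tens_scaleE c [:: (a, b)]). Qed.
Lemma tensZr c a b : tens a (c *: b) = c *: tens a b.
Proof. by rewrite -tensZl; apply/tens_piP/tens_eq_sym/tens_eq_Z. Qed.
Lemma tensM a a' b b' : tens a b * tens a' b' = tens (a * a') (b * b').
Proof. exact: (tens_mulE [:: (a, b)] [:: (a', b')]). Qed.
Lemma tens11 : tens 1 1 = 1. Proof. by []. Qed.

End Tensor.


HB.mixin Record Vector_isLie (K : fieldType) V of Vector K V := {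
  lieb : V -> V -> V;
  lieb_linearl : forall c x y z, lieb (c *: x + y) z = c *: lieb x z + lieb y z;
  lieb_linearr : forall c x y z, lieb z (c *: x + y) = c *: lieb z x + lieb z y;
  liebxx : forall x, lieb x x = 0;
  lieb_jacobi : forall x y z,
    lieb x (lieb y z) + lieb y (lieb z x) + lieb z (lieb x y) = 0
}.
#[short(type="lieAlgType")]
HB.structure Definition LieAlgebra (K : fieldType) :=
  {V of Vector_isLie K V & Vector K V}.

Definition simple_lie (K : fieldType) (g : lieAlgType K) : Prop :=
  (exists x y : g, lieb x y != 0) /\
  forall U : {vspace g}, (forall x y, y \in U -> lieb x y \in U) ->
    U = 0%VS \/ U = fullv.

Section Roots.
Variables (K : numFieldType) (g : lieAlgType K) (hh : {vspace g}).

(* An abelian subalgebra that is its own centralizer and acts diagonalizably. *)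
Definition is_cartan : Prop :=
  (forall y, y \in hh <-> (forall t, t \in hh -> lieb t y = 0)) /\
  (exists2 e : seq g, basis_of fullv e &
     forall t y, t \in hh -> y \in e -> exists c : K, lieb t y = c *: y).

Local Notation dual := 'Hom(subvs_of hh, K^o).

Definition root_space (w : dual) (y : g) : Prop :=
  forall t : subvs_of hh, lieb (vsval t) y = (w t : K) *: y.

Definition is_root (w : dual) : Prop :=
  w != 0 /\ exists2 y, y != 0 & root_space w y.

Variable I : finType.

(* The element sum_i k_i alpha_i of the root lattice is represented by k. *)
Definition rlattice := {ffun I -> int}.

Definition rdelta (i : I) : rlattice := [ffun j => (i == j)%:Z].

Definition weight_of (sr : I -> dual) (k : rlattice) : dual :=
  \sum_i (k i)%:~R *: sr i.

Definition is_root_base (sr : I -> dual) : Prop :=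
  [/\ basis_of fullv (codom sr),
      forall i, is_root (sr i) &
      forall w, is_root w -> exists k : rlattice, w = weight_of sr k /\
        ((forall i, 0 <= k i) \/ (forall i, k i <= 0))].

End Roots.

Record inv_form (K : numFieldType) (g : lieAlgType K) (form : g -> g -> K) : Prop :=
  InvForm {
  form_linear : forall c x y z, form (c *: x + y) z = c * form x z + form y z;
  form_sym : forall x y, form x y = form y x;
  form_inv : forall x y z, form (lieb x y) z = form x (lieb y z);
  form_nondeg : forall x, (forall y, form x y = 0) -> x = 0
}.

(* A sign + or - is a boolean, [true] standing for +. *)
Record lie_datum (K : numFieldType) (g : lieAlgType K) (I : finType) := LieDatum {
  cartan : {vspace g};
  cartanP : is_cartan cartan;
  sroot : I -> 'Hom(subvs_of cartan, K^o);
  srootP : is_root_base sroot;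

  form : g -> g -> K;
  formP : inv_form form;
  (* rdual i is the element of the Cartan subalgebra that the form identifies
     with alpha_i; (alpha_i, alpha_j) is by definition (rdual i, rdual j). *)
  rdual : I -> g;
  rdual_cartan : forall i, rdual i \in cartan;
  rdualP : forall i (t : subvs_of cartan), form (rdual i) (vsval t) = sroot i t;
  form_pos : forall k : rlattice I, k != 0 ->
    0 < \sum_i \sum_j (k i)%:~R * (k j)%:~R * form (rdual i) (rdual j);

  cmx : I -> I -> int;
  cmxP : forall i j, form (rdual i) (rdual i) / 2 * (cmx i j)%:~R =
                     form (rdual i) (rdual j);

  chev : bool -> I -> g;
  chevxi : I -> g;
  chev_root : forall i, root_space (sroot i) (chev true i) /\
                        root_space (- sroot i) (chev false i);
  chev_form : forall i, form (chev true i) (chev false i) = 1;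
  chevxiP : forall i, chevxi i = lieb (chev true i) (chev false i);

  omega : {linear g -> g};
  omega_lie : forall x y, omega (lieb x y) = lieb (omega x) (omega y);
  omega_xi : forall i, omega (chevxi i) = - chevxi i;
  omega_chev : forall e i, omega (chev e i) = - chev (~~ e) i;

  posroots : seq (rlattice I);
  posroots_uniq : uniq posroots;
  posrootsP : forall k, k \in posroots <->
    (is_root (weight_of sroot k) /\ forall i, 0 <= k i);

  rvec : bool -> rlattice I -> g;
  rvec_root : forall k, k \in posroots ->
    root_space (weight_of sroot k) (rvec true k) /\
    root_space (- weight_of sroot k) (rvec false k);
  rvec_form : forall k, k \in posroots -> form (rvec true k) (rvec false k) = 1;
  rvec_simple : forall e i, rvec e (rdelta i) = chev e i;
  rvec_omega : forall e k, k \in posroots -> omega (rvec e k) = - rvec (~~ e) k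
}.

Section RootForm.
Variables (K : numFieldType) (g : lieAlgType K) (I : finType) (D : lie_datum g I).

(* (alpha_i, alpha_j) *)
Definition sform (i j : I) : K := form D (rdual D i) (rdual D j).

(* (alpha, alpha_i) for alpha in the root lattice *)
Definition rform (k : rlattice I) (i : I) : K := \sum_j (k j)%:~R * sform j i.

End RootForm.

Definition typeG2 (I : finType) (c : I -> I -> int) : Prop :=
  exists i j : I, [/\ i != j, forall k, k = i \/ k = j, c i j = -1 & c j i = -3].


Definition comm (A : pzRingType) (x y : A) : A := x * y - y * x.
Definition acomm (A : pzRingType) (x y : A) : A := x * y + y * x.

Inductive ygen (I : Type) : Type := YX of bool & I & nat | YXi of I & nat.

Definition ygen_code (I : Type) (t : ygen I) : bool * I * nat + I * nat :=
  match t with YX e i r => inl (e, i, r) | YXi i r => inr (i, r) end.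
Definition ygen_decode (I : Type) (t : bool * I * nat + I * nat) : ygen I :=
  match t with inl (e, i, r) => YX e i r | inr (i, r) => YXi i r end.
Lemma ygen_codeK (I : Type) : cancel (@ygen_code I) (@ygen_decode I).
Proof. by case. Qed.
HB.instance Definition _ (I : choiceType) :=
  Choice.copy (ygen I) (can_type (@ygen_codeK I)).

(* TH i r is the generator h_{i,2r+1}, and TB i r is b_{i,r}. *)
Inductive tgen (I : Type) : Type := TH of I & nat | TB of I & nat.

Definition tgen_code (I : Type) (t : tgen I) : I * nat + I * nat :=
  match t with TH i r => inl (i, r) | TB i r => inr (i, r) end.
Definition tgen_decode (I : Type) (t : I * nat + I * nat) : tgen I :=
  match t with inl (i, r) => TH i r | inr (i, r) => TB i r end.
Lemma tgen_codeK (I : Type) : cancel (@tgen_code I) (@tgen_decode I).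
Proof. by case. Qed.
HB.instance Definition _ (I : choiceType) :=
  Choice.copy (tgen I) (can_type (@tgen_codeK I)).

(* h_{i,k} for an arbitrary integer index k, the generators of odd index being
   given by th. *)
Definition hindex (A : pzRingType) (th : nat -> A) (k : int) : A :=
  match k with
  | Posz n => if odd n then th n./2 else 0
  | Negz n => if n == 0%N then 1 else 0
  end.

Section Yangians.
Variables (K : fieldType) (I : finType).
(* af i j = (alpha_i, alpha_j), and c is the Cartan matrix. *)
Variables (af : I -> I -> K) (c : I -> I -> int).

Section Relations.

Let F := free_alg K (ygen I).
Let x (e : bool) (i : I) (r : nat) : F := fgen K (YX e i r).
Let xi (i : I) (r : nat) : F := fgen K (YXi i r).
Let sg (e : bool) : K := if e then 1 else -1.

Inductive yangian_rel : F -> Prop :=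
| yrel_xixi i r j s :
    yangian_rel (comm (xi i r) (xi j s))
| yrel_xi0x e i j s :
    yangian_rel (comm (xi i 0) (x e j s) - (sg e * af i j) *: x e j s)
| yrel_xx i r j s :
    yangian_rel (comm (x true i r) (x false j s) - (i == j)%:R *: xi i (r + s)%N)
| yrel_xix e i r j s :
    yangian_rel (comm (xi i r.+1) (x e j s) - comm (xi i r) (x e j s.+1)
                 - (sg e * (af i j / 2)) *: acomm (xi i r) (x e j s))
| yrel_xexe e i r j s :
    yangian_rel (comm (x e i r.+1) (x e j s) - comm (x e i r) (x e j s.+1)
                 - (sg e * (af i j / 2)) *: acomm (x e i r) (x e j s))
| yrel_serre e i j (r : 'I_(absz (1 - c i j)) -> nat) s : i != j ->
    yangian_rel (\sum_(p : 'S_(absz (1 - c i j)))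
      foldr (fun k y => comm (x e i (r (p k))) y) (x e j s)
            (enum 'I_(absz (1 - c i j)))).

End Relations.

Section TwistedRelations.

Let F := free_alg K (tgen I).
Let h (i : I) (k : int) : F := hindex (fun r => fgen K (TH i r)) k.
Let b (i : I) (r : nat) : F := fgen K (TB i r).
Let d (i : I) : K := af i i / 2.
Let ad (i : I) : F -> F := comm (b i 0).

Inductive tyangian_rel : F -> Prop :=
| trel_hh i (r : nat) j (s : nat) :
    tyangian_rel (comm (h i r) (h j s))
| trel_hb i (r : nat) j s :
    tyangian_rel (comm (h i (r%:Z + 1)) (b j s) - comm (h i (r%:Z - 1)) (b j s.+2)
                  - (af i j *: acomm (h i (r%:Z - 1)) (b j s.+1)
                     + (af i j ^+ 2 / 4) *: comm (h i (r%:Z - 1)) (b j s)))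
| trel_bb i r j s :
    tyangian_rel (comm (b i r.+1) (b j s) - comm (b i r) (b j s.+1)
                  - ((af i j / 2) *: acomm (b i r) (b j s)
                     - (2 * (i == j)%:R * (-1) ^+ s) *: h i (r + s + 1)%N))
| trel_serre0 i j : c i j = 0 ->
    tyangian_rel (ad i (b j 0))
| trel_serre1 i j : c i j = -1 ->
    tyangian_rel (iter 2 (ad i) (b j 0) - (- d i) *: b j 0)
| trel_serre2 i j : c i j = -2 ->
    tyangian_rel (iter 3 (ad i) (b j 0) - (- (4 * d i)) *: ad i (b j 0))
| trel_serre3 i j : c i j = -3 ->
    tyangian_rel (iter 4 (ad i) (b j 0)
                  - ((- (10 * d i)) *: iter 2 (ad i) (b j 0)
                     - (9 * d i ^+ 2) *: b j 0)).

End TwistedRelations.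

Section ConstantTerms.
Variable G : choiceType.
Implicit Types y z : free_alg K G.

Definition const0 y : Prop := y@_(mone : {fmonom G}) = 0.

Lemma const0B y z : const0 y -> const0 z -> const0 (y - z).
Proof. by rewrite /const0 mcoeffB => -> ->; rewrite subr0. Qed.
Lemma const0D y z : const0 y -> const0 z -> const0 (y + z).
Proof. by rewrite /const0 mcoeffD => -> ->; rewrite addr0. Qed.
Lemma const0Z a y : const0 y -> const0 (a *: y).
Proof. by rewrite /const0 mcoeffZ => ->; rewrite mulr0. Qed.
Lemma const0_gen (t : G) : const0 (fgen K t).
Proof.
rewrite /const0 /fgen mcoeffU1; case: eqP => // /(congr1 (@fdeg G)).
by rewrite fdegU fdeg1.
Qed.
Let coeff0M y z :
  (y * z)@_(mone : {fmonom G}) = y@_(mone : {fmonom G}) * z@_(mone : {fmonom G}).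
Proof. exact: (rmorphM (mcoeff (mone : {fmonom G}))). Qed.
Lemma const0_comm y z : const0 (comm y z).
Proof.
rewrite /const0 /comm mcoeffB.
apply: etrans (congr2 (fun a a' => a - a') (coeff0M y z) (coeff0M z y)) _.
by rewrite [X in _ - X]mulrC subrr.
Qed.
Lemma const0_acomm y z : const0 z -> const0 (acomm y z).
Proof.
rewrite /const0 /acomm mcoeffD => hz.
apply: etrans (congr2 (fun a a' => a + a') (coeff0M y z) (coeff0M z y)) _.
by rewrite hz mulr0 mul0r addr0.
Qed.
End ConstantTerms.

Lemma yangian_rel_const y : yangian_rel y -> const0 y.
Proof.
case=> [i r j s|e i j s|i r j s|e i r j s|e i r j s|e i j r s _].
- exact: const0_comm.
- by apply: const0B (const0_comm _ _) (const0Z _ (const0_gen _)).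
- by apply: const0B (const0_comm _ _) (const0Z _ (const0_gen _)).
- apply: const0B (const0Z _ (const0_acomm _ (const0_gen _))).
  exact: const0B (const0_comm _ _) (const0_comm _ _).
- apply: const0B (const0Z _ (const0_acomm _ (const0_gen _))).
  exact: const0B (const0_comm _ _) (const0_comm _ _).
rewrite /const0 raddf_sum big1 // => p _.
case: (enum _) => [|k l]; [exact: const0_gen | exact: const0_comm].
Qed.

Lemma tyangian_rel_const y : tyangian_rel y -> const0 y.
Proof.
case=> [i r j s|i r j s|i r j s|i j _|i j _|i j _|i j _].
- exact: const0_comm.
- apply: const0B; first exact: const0B (const0_comm _ _) (const0_comm _ _).
  apply: const0D; first exact: const0Z (const0_acomm _ (const0_gen _)).
  exact: const0Z (const0_comm _ _).
- apply: const0B; first exact: const0B (const0_comm _ _) (const0_comm _ _).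
  apply: const0B; first exact: const0Z (const0_acomm _ (const0_gen _)).
  apply: const0Z; rewrite addn1 /=.
  by case: ifP => _; [exact: const0_gen | rewrite /const0 mcoeff0].
- exact: const0_comm.
- exact: const0B (const0_comm _ _) (const0Z _ (const0_gen _)).
- exact: const0B (const0_comm _ _) (const0Z _ (const0_comm _ _)).
- apply: const0B (const0_comm _ _) _.
  exact: const0B (const0Z _ (const0_comm _ _)) (const0Z _ (const0_gen _)).
Qed.

Definition yangian : algType K := presented (Relations yangian_rel_const).
Definition tyangian : algType K := presented (Relations tyangian_rel_const).

Definition yx (e : bool) (i : I) (r : nat) : yangian := pres_gen _ (YX e i r).
Definition yxi (i : I) (r : nat) : yangian := pres_gen _ (YXi i r).
Definition th (i : I) (k : int) : tyangian :=
  hindex (fun r => pres_gen _ (TH i r) : tyangian) k.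
Definition tb (i : I) (r : nat) : tyangian := pres_gen _ (TB i r).

End Yangians.

Notation yangian_of D := (yangian (sform D) (cmx D)).
Notation tyangian_of D := (tyangian (sform D) (cmx D)).

Definition lspan (K : fieldType) (V : lmodType K) (P : V -> Prop) (v : V) : Prop :=
  exists s : seq (K * V), (forall p, p \in s -> P p.2) /\
                          v = \sum_(p <- s) p.1 *: p.2.

Section Grading.
Variables (K : fieldType) (I : finType) (af : I -> I -> K) (c : I -> I -> int).

Definition ydeg (t : ygen I) : rlattice I :=
  match t with
  | YX e i _ => if e then rdelta i else - rdelta i
  | YXi _ _ => 0
  end.

(* The relations are homogeneous, so the homogeneous component of degree k is
   spanned by the monomials of degree k in the generators. *)
Definition yhomog (k : rlattice I) : yangian af c -> Prop :=
  lspan (fun y => exists w : seq (ygen I),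
    \sum_(t <- w) ydeg t = k /\ y = \prod_(t <- w) pres_gen _ t).

Definition yspan (S : rlattice I -> Prop) : yangian af c -> Prop :=
  lspan (fun y => exists2 k, S k & yhomog k y).

Definition Qplus (k : rlattice I) : Prop := (forall i, 0 <= k i) /\ 0 < \sum_i k i.

Definition shift_set (S : rlattice I -> Prop) (a k : rlattice I) : Prop := S (k - a).

End Grading.

(* A formal power series in u^-1 is its sequence of coefficients: f n is the
   coefficient of u^-n. *)
Definition series (A : Type) := nat -> A.

Definition series_mul (A : pzRingType) (f f' : series A) : series A :=
  fun n => \sum_(k < n.+1) f k * f' (n - k)%N.

(* f(-u) *)
Definition series_neg (K : fieldType) (A : lmodType K) (f : series A) : series A :=
  fun n => (-1) ^+ n *: f n.

Definition series_tens (K : fieldType) (A B : algType K) (f : series A) (f' : series B) :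
    series (tensor A B) :=
  fun n => \sum_(k < n.+1) tens (f k) (f' (n - k)%N).

Definition series_congr (V : zmodType) (P : V -> Prop) (f f' : series V) : Prop :=
  forall n, P (f n - f' n).

Section GeneratingSeries.
Variables (K : fieldType) (I : finType) (af : I -> I -> K) (c : I -> I -> int).

Definition xi_ser (i : I) : series (yangian af c) :=
  fun n => if n is r.+1 then yxi af c i r else 1.
Definition x_ser (e : bool) (i : I) : series (yangian af c) :=
  fun n => if n is r.+1 then yx af c e i r else 0.
(* th i (n - 1) is 1 for n = 0, h_{i,2r+1} for n = 2r+2, and 0 for n odd. *)
Definition h_ser (i : I) : series (tyangian af c) := fun n => th af c i (n%:Z - 1).
Definition b_ser (i : I) : series (tyangian af c) :=
  fun n => if n is r.+1 then tb af c i r else 0.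

End GeneratingSeries.

Section Maps.
Variables (K : numFieldType) (g : lieAlgType K) (I : finType) (D : lie_datum g I).
Local Notation Y := (yangian_of D).
Local Notation iY := (tyangian_of D).

Variable iota : {linear g -> Y}.

Record classical_inclusion : Prop := ClassicalInclusion {
  iota_lie : forall x y, iota (lieb x y) = comm (iota x) (iota y);
  iota_xi : forall i, iota (chevxi D i) = yxi _ _ i 0;
  iota_chev : forall e i, iota (chev D e i) = yx _ _ e i 0
}.

Record yangian_coproduct (Delta : {lrmorphism Y -> tensor Y Y}) : Prop :=
  YangianCoproduct {
  Delta_lie : forall x, Delta (iota x) = tens (iota x) 1 + tens 1 (iota x);
  Delta_xi1 : forall i, Delta (yxi _ _ i 1) =
    tens (yxi _ _ i 1) 1 + tens 1 (yxi _ _ i 1)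
    + tens (iota (chevxi D i)) (iota (chevxi D i))
    - \sum_(a <- posroots D)
        rform D a i *: tens (iota (rvec D false a)) (iota (rvec D true a))
}.

Record twisted_embedding (phi : {lrmorphism iY -> Y}) : Prop := TwistedEmbedding {
  phi_inj : injective phi;
  phi_b0 : forall i, phi (tb _ _ i 0) = iota (chev D true i) - iota (chev D false i);
  phi_h1 : forall i, phi (th _ _ i 1) =
    2%:R *: yxi _ _ i 1 - iota (chevxi D i) ^+ 2
    + \sum_(a <- posroots D) rform D a i *: iota (rvec D true a) ^+ 2
}.

(* The image of iY (x) Y_S in Y (x) Y. *)
Definition coideal_span (phi : {lrmorphism iY -> Y}) (S : rlattice I -> Prop) :
    tensor Y Y -> Prop :=
  lspan (fun t => exists a y, yspan S y /\ t = tens (phi a) y).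

End Maps.

(* Main.v *)
Require Import Defs.
From HB Require Import structures.
From mathcomp Require Import all_boot all_order all_algebra.
From mathcomp Require Import boolp reals complex.
From mathcomp Require Import monalg ring.
Set Implicit Arguments.
Unset Strict Implicit.
Unset Printing Implicit Defensive.
Import Order.TTheory GRing.Theory Num.Theory.
Local Open Scope ring_scope.

(** Choose c_j with sum_j c_j (alpha_j, alpha_l) = delta_il and put H = sum_j c_j h_{j,1}.
    Then b_{i,s+1} = 1/2 [H, b_{i,s}], so the explicit images of H turn b_i(u) and its
    coproduct into the unique solution of B = u^-1 (B_0 + 1/2 [H, B]), B_0 being the image
    of b_{i,0}.  An explicit series that solves this recursion up to terms of degree
    alpha_i + Q_+ therefore agrees with B up to such terms.  Summing the relations
    between the b_{i,r} gives h_i(u) = 1 + [b_{i,0}, b_i(u)] + d_i b_i(u)^2, from which the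
    congruences for h_i(u) follow.  The congruences in Y and in Y (x) Y are two cases of one
    computation with a pair of commuting subalgebras: the scalars and Y, respectively
    Y (x) 1 and 1 (x) Y.  The error terms for the coproduct lie in iY (x) Y and in
    Y (x) Y_{Q_+}; they lie in iY (x) Y_{Q_+} because the commuting operators
    ad (1 (x) xi_{j,0}) separate the degrees of the second factor. *)

(** * Commutators and power series *)

(** The precision alpha_i + Q_+ is finer than the coproduct formula asks for. It is forced by the
    passage to h_i(u), in which b_i(u) is squared: its lowest term x_i^-(-u) has degree -alpha_i and
    would carry a coarser error out of Q_+. The approximate solution is built for the operator L =
    u^-1 (1/2) ad(H + 2 Xi), where Xi = sum_j c_j (xi_{j,1} - xi_{j,0}^2 / 2). Since H and Xi shift
    modes, L f = f - u^-1 f_0 for the currents b(u) and x_i^±(±u) with matching sign, and a product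
    of such series satisfies a similar equation with a computable source. The rest of the image of H
    is a sum over positive roots al, with coefficient sum_j c_j (al, alpha_j), the multiplicity of
    alpha_i in al. Only multiplicity one produces terms outside alpha_i + Q_+, and these dictate the
    sources. The delicate component has degree alpha_i: its source contains
    [b_0 x_0, b(u) xi_i(-u)], which is balanced by a multiple of b(u)^2 [x_0, xi_i(-u)] besides h(u)
    times half of {x_i^+(u), xi_i(-u)}. *)

Section Commutators.
Variable A : pzRingType.
Implicit Types x y z t : A.

Lemma comm_eq0 x y : GRing.comm x y -> comm x y = 0.
Proof. by move=> xy; rewrite /comm xy subrr. Qed.
Lemma commC x y : comm x y = - comm y x. Proof. by rewrite /comm opprB. Qed.
Lemma commxx x : comm x x = 0. Proof. exact: subrr. Qed.
Lemma comm0l x : comm 0 x = 0. Proof. by rewrite /comm mul0r mulr0 subrr. Qed.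
Lemma comm0r x : comm x 0 = 0. Proof. by rewrite /comm mul0r mulr0 subrr. Qed.
Lemma comm1r x : comm x 1 = 0. Proof. by rewrite /comm mul1r mulr1 subrr. Qed.
Lemma commDl x y z : comm (x + y) z = comm x z + comm y z.
Proof. by rewrite /comm mulrDl mulrDr opprD addrACA. Qed.
Lemma commDr x y z : comm x (y + z) = comm x y + comm x z.
Proof. by rewrite /comm mulrDl mulrDr opprD addrACA. Qed.
Lemma commNl x y : comm (- x) y = - comm x y.
Proof. by rewrite /comm mulNr mulrN opprD. Qed.
Lemma commNr x y : comm x (- y) = - comm x y.
Proof. by rewrite /comm mulNr mulrN opprD. Qed.
Lemma commBl x y z : comm (x - y) z = comm x z - comm y z.
Proof. by rewrite commDl commNl. Qed.
Lemma commBr x y z : comm x (y - z) = comm x y - comm x z.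
Proof. by rewrite commDr commNr. Qed.
Lemma comm_sumr (J : Type) (s : seq J) (P : pred J) x (f : J -> A) :
  comm x (\sum_(j <- s | P j) f j) = \sum_(j <- s | P j) comm x (f j).
Proof. exact: (big_morph _ (commDr x) (comm0r x)). Qed.
Lemma comm_suml (J : Type) (s : seq J) (P : pred J) x (f : J -> A) :
  comm (\sum_(j <- s | P j) f j) x = \sum_(j <- s | P j) comm (f j) x.
Proof. by rewrite commC comm_sumr -sumrN; apply: eq_bigr => j _; rewrite -commC. Qed.

Lemma commMr x y z : comm x (y * z) = comm x y * z + y * comm x z.
Proof. by rewrite /comm mulrBl mulrBr !mulrA addrA subrK. Qed.
Lemma commMl x y z : comm (x * y) z = x * comm y z + comm x z * y.
Proof. by rewrite commC commMr opprD -mulNr -mulrN -!commC addrC. Qed.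

Lemma acommC x y : acomm x y = acomm y x. Proof. exact: addrC. Qed.
Lemma acommDl x y z : acomm (x + y) z = acomm x z + acomm y z.
Proof. by rewrite /acomm mulrDl mulrDr addrACA. Qed.
Lemma acommDr x y z : acomm x (y + z) = acomm x y + acomm x z.
Proof. by rewrite /acomm mulrDl mulrDr addrACA. Qed.
Lemma acommNr x y : acomm x (- y) = - acomm x y.
Proof. by rewrite /acomm mulrN mulNr opprD. Qed.
Lemma acommBr x y z : acomm x (y - z) = acomm x y - acomm x z.
Proof. by rewrite acommDr acommNr. Qed.
Lemma acomm1r x : acomm x 1 = x *+ 2.
Proof. by rewrite /acomm mul1r mulr1 mulr2n. Qed.
Lemma acomm_sumr (J : Type) (s : seq J) (P : pred J) x (f : J -> A) :
  acomm x (\sum_(j <- s | P j) f j) = \sum_(j <- s | P j) acomm x (f j).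
Proof.
apply: (big_morph _ (acommDr x)); by rewrite /acomm mulr0 mul0r addr0.
Qed.

Lemma comm_acomm x y z : comm x (acomm y z) = acomm (comm x y) z + acomm y (comm x z).
Proof.
by rewrite /acomm commDr !commMr [comm x z * y + _]addrC addrACA.
Qed.

Lemma comm_jacobi x y z : comm x (comm y z) = comm (comm x y) z + comm y (comm x z).
Proof.
rewrite [comm y z in LHS]/comm commBr !commMr [comm (comm x y) z]/comm [comm y (comm x z)]/comm.
by rewrite opprD [- _ - _]addrC addrACA.
Qed.

Lemma acomm_assoc x y z : acomm x (acomm y z) - acomm (acomm x y) z = comm (comm x z) y.
Proof.
rewrite /acomm /comm !(mulrDl, mulrDr, mulrBl, mulrBr) !mulrA !opprD.
rewrite [LHS](AC ((2*2)*(2*2)) ((1*5)*(4*8)*((2*7)*(6*3)))) /= !subrr !add0r.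
by rewrite !(mulNr, mulrN) !mulrA opprK.
Qed.

Lemma comm_mull x y z : GRing.comm y x -> comm x (y * z) = y * comm x z.
Proof. by move=> /commr_sym/comm_eq0 xy; rewrite commMr xy mul0r add0r. Qed.
Lemma acomm_mull x y z : GRing.comm y x -> acomm x (y * z) = y * acomm x z.
Proof. by move=> yx; rewrite /acomm mulrDr !mulrA yx. Qed.

(** After expansion the mixed monomials cancel and the two others occur twice. Together with
    [comm_mul_cross] this turns a bracket of products taken across two commuting subalgebras into
    brackets inside each of them, see [C_source]. *)
Lemma comm_acomm_cross x y z t :
  comm x y * acomm z t + acomm x y * comm z t =
  (x * y * (z * t) - y * x * (t * z)) + (x * y * (z * t) - y * x * (t * z)).
Proof.
rewrite /comm /acomm !(mulrDl, mulrDr) !(mulrN, mulNr).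
by rewrite [LHS](AC ((2*2)*(2*2)) ((1*4)*(5*8)*((2*6)*(3*7)))) /= subrr addNr !addr0.
Qed.

Lemma comm_mul_cross x y z t : GRing.comm x t -> GRing.comm z y ->
  comm (x * y) (z * t) = (x * z) * (y * t) - (z * x) * (t * y).
Proof.
move=> xt zy; rewrite /comm !mulrA; congr (_ - _).
  by rewrite -[x * y * z]mulrA -zy mulrA.
by rewrite -[z * t * x]mulrA -xt mulrA.
Qed.

End Commutators.

Section AlgebraCommutators.
Variables (K : fieldType) (A : algType K).
Implicit Types (c : K) (x y : A).

Lemma commZl c x y : comm (c *: x) y = c *: comm x y.
Proof. by rewrite /comm -scalerAl -scalerAr -scalerBr. Qed.
Lemma commZr c x y : comm x (c *: y) = c *: comm x y.
Proof. by rewrite /comm -scalerAl -scalerAr -scalerBr. Qed.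
Lemma acommZl c x y : acomm (c *: x) y = c *: acomm x y.
Proof. by rewrite /acomm -scalerAl -scalerAr -scalerDr. Qed.
Lemma acommZr c x y : acomm x (c *: y) = c *: acomm x y.
Proof. by rewrite /acomm -scalerAl -scalerAr -scalerDr. Qed.
Lemma commr_scale c x y : GRing.comm x y -> GRing.comm x (c *: y).
Proof. by move=> xy; rewrite /GRing.comm -scalerAl -scalerAr xy. Qed.

End AlgebraCommutators.

Section CommMorphism.
Variables (A B : pzRingType) (f : {rmorphism A -> B}).

Lemma rmorph_commutator x y : f (comm x y) = comm (f x) (f y).
Proof. by rewrite /comm rmorphB !rmorphM. Qed.
Lemma rmorph_anticommutator x y : f (acomm x y) = acomm (f x) (f y).
Proof. by rewrite /acomm rmorphD !rmorphM. Qed.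

End CommMorphism.

(** * The ring of power series in u^-1 over a noncommutative ring *)

Definition pser (A : pzRingType) : Type := series A.

HB.instance Definition _ (A : pzRingType) := gen_eqMixin (pser A).
HB.instance Definition _ (A : pzRingType) := gen_choiceMixin (pser A).

Section SeriesRing.
Variable A : pzRingType.
Implicit Types f g h : pser A.

Definition pser_zero : pser A := fun _ => 0.
Definition pser_one : pser A := fun n => (n == 0%N)%:R.
Definition pser_add f g : pser A := fun n => f n + g n.
Definition pser_opp f : pser A := fun n => - f n.
Definition pser_mul f g : pser A := series_mul f g.

Lemma pser_addA : associative pser_add.
Proof. by move=> f g h; apply: funext => n; apply: addrA. Qed.
Lemma pser_addC : commutative pser_add.
Proof. by move=> f g; apply: funext => n; apply: addrC. Qed.
Lemma pser_add0 : left_id pser_zero pser_add.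
Proof. by move=> f; apply: funext => n; apply: add0r. Qed.
Lemma pser_addN : left_inverse pser_zero pser_opp pser_add.
Proof. by move=> f; apply: funext => n; apply: addNr. Qed.
HB.instance Definition _ :=
  GRing.isZmodule.Build (pser A) pser_addA pser_addC pser_add0 pser_addN.

Lemma pser_mul_rev f g n : pser_mul f g n = \sum_(k < n.+1) f (n - k)%N * g k.
Proof.
rewrite /pser_mul /series_mul (reindex_inj rev_ord_inj) /=.
by apply: eq_bigr => k _; rewrite subSS subKn // -ltnS.
Qed.

Lemma pser_mulA : associative pser_mul.
Proof.
move=> f g h; apply: funext => n; rewrite [RHS]pser_mul_rev.
pose F k j := f k * (g (n - k - j)%N * h j).
transitivity (\sum_(k < n.+1) \sum_(j < n.+1 | (j <= n - k)%N) F k j).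
  apply: eq_bigr => k _; rewrite [X in _ * X]pser_mul_rev big_distrr /=.
  rewrite (big_ord_narrow_leq (leq_subr _ _)).
  by apply: eq_bigr => j _.
transitivity (\sum_(j < n.+1) \sum_(k < n.+1 | (k <= n - j)%N) F k j).
  rewrite (exchange_big_dep xpredT) //=; apply: eq_bigr => j _.
  by apply: eq_bigl => k; rewrite !leq_subRL ?leq_ord // addnC.
apply: eq_bigr => j _; rewrite big_distrl /=.
rewrite (big_ord_narrow_leq (leq_subr _ _)).
by apply: eq_bigr => k _; rewrite /F /= mulrA subnAC.
Qed.

Lemma pser_mul1r : left_id pser_one pser_mul.
Proof.
move=> f; apply: funext => n; rewrite /pser_mul /series_mul big_ord_recl.
by rewrite /= mul1r subn0 big1 ?addr0 // => k _; rewrite mul0r.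
Qed.
Lemma pser_mulr1 : right_id pser_one pser_mul.
Proof.
move=> f; apply: funext => n; rewrite pser_mul_rev big_ord_recl.
by rewrite /= mulr1 subn0 big1 ?addr0 // => k _; rewrite mulr0.
Qed.
Lemma pser_mulDl : left_distributive pser_mul +%R.
Proof.
move=> f g h; apply: funext => n; rewrite -[RHS]big_split.
by apply: eq_bigr => k _; apply: mulrDl.
Qed.
Lemma pser_mulDr : right_distributive pser_mul +%R.
Proof.
move=> f g h; apply: funext => n; rewrite -[RHS]big_split.
by apply: eq_bigr => k _; apply: mulrDr.
Qed.
HB.instance Definition _ := GRing.Zmodule_isPzRing.Build (pser A)
  pser_mulA pser_mul1r pser_mulr1 pser_mulDl pser_mulDr.

Lemma pserDE f g n : (f + g) n = f n + g n. Proof. by []. Qed.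
Lemma pserNE f n : (- f) n = - f n. Proof. by []. Qed.
Lemma pserBE f g n : (f - g) n = f n - g n. Proof. by []. Qed.
Lemma pserME f g n : (f * g) n = \sum_(k < n.+1) f k * g (n - k)%N.
Proof. by []. Qed.
Lemma pserM_rev f g n : (f * g) n = \sum_(k < n.+1) f (n - k)%N * g k.
Proof. exact: pser_mul_rev. Qed.
Definition pconst (a : A) : pser A := fun n => if n is 0%N then a else 0.

Lemma pconstME a f n : (pconst a * f) n = a * f n.
Proof.
by rewrite pserME big_ord_recl subn0 big1 ?addr0 // => k _; rewrite mul0r.
Qed.
Lemma pserMconst f a n : (f * pconst a) n = f n * a.
Proof.
by rewrite pserM_rev big_ord_recl subn0 big1 ?addr0 // => k _; rewrite mulr0.
Qed.

Lemma pconst_zmod : zmod_morphism pconst.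
Proof. by move=> a b; apply: funext => -[|n] //=; rewrite pserBE /= subr0. Qed.
HB.instance Definition _ := GRing.isZmodMorphism.Build A (pser A) pconst pconst_zmod.
Lemma pconst_monoid : monoid_morphism pconst.
Proof.
split=> [|a b]; first by apply: funext => -[].
by apply: funext => n; rewrite pconstME; case: n => //= n; rewrite mulr0.
Qed.
HB.instance Definition _ := GRing.isMonoidMorphism.Build A (pser A) pconst pconst_monoid.

Lemma pconstD a b : pconst (a + b) = pconst a + pconst b. Proof. exact: raddfD. Qed.
Lemma pconstN a : pconst (- a) = - pconst a. Proof. exact: raddfN. Qed.
Lemma pconstM a b : pconst (a * b) = pconst a * pconst b. Proof. exact: rmorphM. Qed.
Lemma comm_pconst a b : comm (pconst a) (pconst b) = pconst (comm a b).
Proof. by rewrite /comm pconstD pconstN !pconstM. Qed.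

Lemma comm_pconstE a f n : comm (pconst a) f n = comm a (f n).
Proof. by rewrite /comm pserBE pconstME pserMconst. Qed.

(* u^-1 f(u) *)
Definition pshift f : pser A := fun n => if n is m.+1 then f m else 0.

Lemma pshift_zmod : zmod_morphism pshift.
Proof. by move=> f g; apply: funext => -[|n] //=; rewrite pserBE subr0. Qed.
HB.instance Definition _ :=
  GRing.isZmodMorphism.Build (pser A) (pser A) pshift pshift_zmod.
Lemma pshiftD f g : pshift (f + g) = pshift f + pshift g. Proof. exact: raddfD. Qed.
Lemma pshiftN f : pshift (- f) = - pshift f. Proof. exact: raddfN. Qed.
Lemma pshift0 : pshift 0 = 0. Proof. exact: raddf0. Qed.
Lemma pshiftMl f g : pshift (f * g) = pshift f * g.
Proof.
apply: funext => -[|n]; rewrite pserME ?big_ord1 /= ?mul0r // pserME.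
by rewrite [RHS]big_ord_recl mul0r add0r.
Qed.
Lemma pshiftMr f g : pshift (f * g) = f * pshift g.
Proof.
apply: funext => -[|n]; rewrite pserM_rev ?big_ord1 /= ?mulr0 // pserM_rev.
by rewrite [RHS]big_ord_recl mulr0 add0r.
Qed.
Lemma pshift_acomml f g : pshift (acomm f g) = acomm (pshift f) g.
Proof. by rewrite /acomm raddfD /= pshiftMl pshiftMr. Qed.
Lemma pshift_acommr f g : pshift (acomm f g) = acomm f (pshift g).
Proof. by rewrite /acomm raddfD /= pshiftMr pshiftMl. Qed.

Lemma pser_comm f g : (forall m n, GRing.comm (f m) (g n)) -> GRing.comm f g.
Proof.
move=> fg; apply: funext => n; rewrite pserME pserM_rev.
by apply: eq_bigr => k _; apply: fg.
Qed.

Lemma comm_coefE f g n : comm f g n = \sum_(k < n.+1) comm (f k) (g (n - k)%N).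
Proof. by rewrite /comm pserBE pserME [X in _ - X]pserM_rev -sumrB. Qed.
Lemma acomm_coefE f g n : acomm f g n = \sum_(k < n.+1) acomm (f k) (g (n - k)%N).
Proof. by rewrite /acomm pserDE pserME [X in _ + X]pserM_rev -big_split. Qed.

End SeriesRing.

Section SeriesAlgebra.
Variables (K : fieldType) (A : algType K).
Implicit Types (c d : K) (f g : pser A).

Lemma pser_one_neq0 : (1 : pser A) != 0.
Proof. by apply/eqP => /(congr1 (fun f : pser A => f 0%N))/eqP; rewrite oner_eq0. Qed.
HB.instance Definition _ := GRing.PzSemiRing_isNonZero.Build (pser A) pser_one_neq0.

Definition pser_scale c f : pser A := fun n => c *: f n.
Lemma pser_scaleA c d f : pser_scale c (pser_scale d f) = pser_scale (c * d) f.
Proof. by apply: funext => n; apply: scalerA. Qed.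
Lemma pser_scale1 : left_id 1 pser_scale.
Proof. by move=> f; apply: funext => n; apply: scale1r. Qed.
Lemma pser_scaleDr : right_distributive pser_scale +%R.
Proof. by move=> c f g; apply: funext => n; apply: scalerDr. Qed.
Lemma pser_scaleDl f : {morph pser_scale^~ f : c d / c + d}.
Proof. by move=> c d; apply: funext => n; apply: scalerDl. Qed.
HB.instance Definition _ := GRing.Zmodule_isLmodule.Build K (pser A)
  pser_scaleA pser_scale1 pser_scaleDr pser_scaleDl.
Lemma pserZE c f n : (c *: f) n = c *: f n. Proof. by []. Qed.

Lemma pser_scalerAl c f g : c *: (f * g) = (c *: f) * g.
Proof.
apply: funext => n; rewrite pserZE !pserME scaler_sumr.
by apply: eq_bigr => k _; apply: scalerAl.
Qed.
HB.instance Definition _ :=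
  GRing.LSemiModule_isLSemiAlgebra.Build K (pser A) pser_scalerAl.
Lemma pser_scalerAr c f g : c *: (f * g) = f * (c *: g).
Proof.
apply: funext => n; rewrite pserZE !pserME scaler_sumr.
by apply: eq_bigr => k _; apply: scalerAr.
Qed.
HB.instance Definition _ :=
  GRing.LSemiAlgebra_isSemiAlgebra.Build K (pser A) pser_scalerAr.

Lemma pconstZ c a : pconst (c *: a) = c *: pconst a :> pser A.
Proof. by apply: funext => -[|n] //; rewrite pserZE /= scaler0. Qed.
Lemma pshiftZ c f : pshift (c *: f) = c *: pshift f.
Proof. by apply: funext => -[|n] //; rewrite pserZE /= scaler0. Qed.

(** The hypothesis is the shape of the quadratic relations between currents. Summed over a fixed
    total index it telescopes: only brackets with a zeroth coefficient survive on the left, and a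
    coefficient of {f(u), g(u)} appears on the right. *)
Lemma telescope_comm (d : K) (f g : nat -> A) :
  (forall m n, comm (f m.+1) (g n) - comm (f m) (g n.+1) = d *: acomm (f m) (g n)) ->
  forall n, comm (f n.+1) (g 0%N) - comm (f 0%N) (g n.+1) = d *: acomm (f : pser A) g n.
Proof.
move=> rel n; rewrite acomm_coefE scaler_sumr.
pose T k := comm (f k) (g (n.+1 - k)%N).
have -> : comm (f n.+1) (g 0%N) - comm (f 0%N) (g n.+1) = T n.+1 - T 0%N.
  by rewrite /T subnn subn0.
rewrite -(telescope_sumr T (leq0n n.+1)) big_mkord.
by apply: eq_bigr => k _; rewrite /T subSS subSn -?rel // -ltnS.
Qed.

End SeriesAlgebra.

(** * Root vectors *)

Section LieBasics.
Variables (K : fieldType) (g : lieAlgType K).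
Implicit Types (c : K) (x y z : g).

Lemma lieb_is_linear x : linear (lieb x).
Proof. by move=> c y z; apply: lieb_linearr. Qed.
HB.instance Definition _ x := GRing.isLinear.Build K g g _ (lieb x) (lieb_is_linear x).

Lemma liebDl x y z : lieb (x + y) z = lieb x z + lieb y z.
Proof. by have := lieb_linearl 1 x y z; rewrite !scale1r. Qed.

Lemma lieb_antisym x y : lieb x y = - lieb y x.
Proof.
apply/eqP; rewrite -subr_eq0 opprK; apply/eqP.
by have := liebxx (x + y); rewrite liebDl !linearD /= !liebxx add0r addr0.
Qed.

Lemma liebNl x y : lieb (- x) y = - lieb x y.
Proof. by rewrite lieb_antisym linearN /= opprK lieb_antisym. Qed.
Lemma liebZl c x y : lieb (c *: x) y = c *: lieb x y.
Proof. by rewrite lieb_antisym linearZ -scalerN -lieb_antisym. Qed.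

Lemma lieb_derivation x y z : lieb x (lieb y z) = lieb (lieb x y) z + lieb y (lieb x z).
Proof.
have /eqP := lieb_jacobi x y z; rewrite -addrA addr_eq0 => /eqP ->.
by rewrite [lieb z x]lieb_antisym [lieb z (lieb x y)]lieb_antisym linearN /= opprD !opprK addrC.
Qed.

End LieBasics.

Section RootVectors.
Variables (K : numFieldType) (g : lieAlgType K) (I : finType) (D : lie_datum g I).
Local Notation hh := (cartan D).
Local Notation sr := (sroot D).
Local Notation xp := (chev D true).
Local Notation xm := (chev D false).
Local Notation lat := (rlattice I).
Local Notation form := Defs.form.
Implicit Types (k l : lat) (c : K) (x y z : g) (t : subvs_of hh).

Definition gsp k y := root_space (weight_of sr k) y.

Lemma weightE k t : (weight_of sr k t : K) = \sum_i (k i)%:~R * (sr i t : K).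
Proof. by rewrite sum_lfunE; apply: eq_bigr => j _; rewrite scale_lfunE. Qed.
Lemma weightD k l : weight_of sr (k + l) = weight_of sr k + weight_of sr l.
Proof.
by rewrite -big_split; apply: eq_bigr => i _; rewrite ffunE intrD scalerDl.
Qed.
Lemma weight0 : weight_of sr 0 = 0.
Proof. by apply: big1 => i _; rewrite ffunE scale0r. Qed.
Lemma weightN k : weight_of sr (- k) = - weight_of sr k.
Proof. by apply/eqP; rewrite -addr_eq0 -weightD addNr weight0. Qed.
Lemma weight_delta i : weight_of sr (rdelta i) = sr i.
Proof.
rewrite /weight_of (bigD1 i) //= ffunE eqxx scale1r big1 ?addr0 // => j ji.
by rewrite ffunE eq_sym (negPf ji) scale0r.
Qed.

Lemma sroot_free (c : I -> K) : \sum_i c i *: sr i = 0 -> forall i, c i = 0.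
Proof.
move=> c0 i; have [/basis_free fr _ _] := srootP D.
have /freeP/(_ (fun j => c (enum_val j))) frP : free (codom_tuple sr) by [].
rewrite -(enum_rankK i); apply: frP; rewrite -[RHS]c0 [RHS]big_enum_val /=.
by apply: eq_bigr => j _; rewrite nth_codom.
Qed.

Lemma weight_inj : injective (weight_of sr).
Proof.
move=> k l /eqP; rewrite -subr_eq0 -weightN -weightD => /eqP /sroot_free kl.
apply/eqP; rewrite -subr_eq0; apply/eqP/ffunP => i.
by rewrite [RHS]ffunE; apply/eqP; rewrite -(intr_eq0 K) (kl i).
Qed.

Lemma weight_neq0 k : k != 0 -> exists t, (weight_of sr k t : K) != 0.
Proof.
move=> k0; apply: contrapT => /forallNP all0; case/eqP: k0; apply: weight_inj.
rewrite weight0; apply/lfunP => t; rewrite [RHS]lfunE /=.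
by apply/eqP; apply/negPn/negP; apply: all0.
Qed.

Lemma gsp0 k : gsp k 0. Proof. by move=> t; rewrite linear0 scaler0. Qed.
Lemma gspD k y z : gsp k y -> gsp k z -> gsp k (y + z).
Proof. by move=> yk zk t; rewrite linearD /= yk zk scalerDr. Qed.
Lemma gspZ k c y : gsp k y -> gsp k (c *: y).
Proof. by move=> yk t; rewrite linearZ /= yk !scalerA mulrC. Qed.
Lemma gsp_sum (J : Type) (s : seq J) (P : pred J) k (f : J -> g) :
  (forall j, P j -> gsp k (f j)) -> gsp k (\sum_(j <- s | P j) f j).
Proof. by move=> fk; elim/big_ind: _ => //; [exact: gsp0 | exact: gspD]. Qed.
Lemma gsp_lieb k l y z : gsp k y -> gsp l z -> gsp (k + l) (lieb y z).
Proof.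
move=> yk zl t; rewrite lieb_derivation yk zl liebZl linearZ /= -scalerDl.
by rewrite weightD lfunE.
Qed.
Lemma gsp_xp i : gsp (rdelta i) (xp i).
Proof. by rewrite /gsp weight_delta; case: (chev_root D i). Qed.
Lemma gsp_xm i : gsp (- rdelta i) (xm i).
Proof. by rewrite /gsp weightN weight_delta; case: (chev_root D i). Qed.

Lemma gsp0_cartan y : gsp 0 y <-> y \in hh.
Proof.
have [cent _] := cartanP D; split=> [y0|/cent y0 t].
  apply/cent => t tH; rewrite -(vsprojK tH) y0 weight0 lfunE.
  exact: scale0r.
by rewrite y0 ?subvsP // weight0 lfunE scale0r.
Qed.

Lemma gsp_sign k y : gsp k y -> y != 0 -> (forall i, 0 <= k i) \/ (forall i, k i <= 0).
Proof.
move=> yk y0; have [->|k0] := eqVneq k 0; first by left=> i; rewrite ffunE.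
have [_ _ base] := srootP D.
have /base[l [/weight_inj <-]] // : is_root (weight_of sr k).
split; last by exists y.
by apply: contra_neq k0 => kw; apply: weight_inj; rewrite weight0.
Qed.

Lemma formDl x y z : form D (x + y) z = form D x z + form D y z.
Proof. by have := form_linear (formP D) 1 x y z; rewrite scale1r mul1r. Qed.
Lemma form0l z : form D 0 z = 0.
Proof. by apply: (addrI (form D 0 z)); rewrite -formDl !addr0. Qed.
Lemma formZl c x z : form D (c *: x) z = c * form D x z.
Proof. by have := form_linear (formP D) c x 0 z; rewrite addr0 form0l addr0. Qed.
Lemma formC x y : form D x y = form D y x. Proof. exact: form_sym (formP D) x y. Qed.
Lemma formNl x z : form D (- x) z = - form D x z.
Proof. by rewrite -scaleN1r formZl mulN1r. Qed.
Lemma formI x y z : form D (lieb x y) z = form D x (lieb y z).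
Proof. exact: form_inv (formP D) x y z. Qed.
Lemma form_sum (J : Type) (s : seq J) (P : pred J) (f : J -> g) z :
  form D (\sum_(j <- s | P j) f j) z = \sum_(j <- s | P j) form D (f j) z.
Proof. exact: (big_morph (fun x => form D x z) (fun x y => formDl x y z) (form0l z)). Qed.

Lemma form_orth k l y z : k + l != 0 -> gsp k y -> gsp l z -> form D y z = 0.
Proof.
move=> /weight_neq0[t]; rewrite weightD lfunE /= => nz yk zl; apply/eqP.
have /eqP : (weight_of sr k t + weight_of sr l t : K) * form D y z = 0.
  rewrite mulrDl -formZl -yk lieb_antisym formNl formI zl.
  by rewrite [form D y (_ *: _)]formC formZl [form D z y]formC addNr.
by rewrite mulf_eq0 (negPf nz) => /eqP/eqP.
Qed.

Definition weight_basis n (X : n.-tuple g) (wt : 'I_n -> lat) : Prop :=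
  basis_of fullv X /\ forall j, gsp (wt j) X`_j.

Section WeightFunctional.
Variables (n : nat) (X : n.-tuple g) (j : 'I_n).
Definition weight_fun (t : subvs_of hh) : K^o := coord X j (lieb (vsval t) X`_j).
Lemma weight_fun_is_linear : linear weight_fun.
Proof.
move=> c s t; by rewrite /weight_fun linearP /= lieb_linearl linearP /=.
Qed.
HB.instance Definition _ :=
  GRing.isLinear.Build K (subvs_of hh) K^o _ weight_fun weight_fun_is_linear.

End WeightFunctional.

(** The diagonalizing basis gives an eigenvalue for each t separately. Read off as a coordinate of
    [t, X_j], it is linear in t, hence zero or a root, hence given by an element of the root
    lattice. *)
Lemma weight_basis_exists : exists n (X : n.-tuple g) wt, weight_basis X wt.
Proof.
have [_ [e eb diag]] := cartanP D; pose X := in_tuple e.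
exists (size e), X.
suff wtP (j : 'I_(size e)) : exists k, gsp k X`_j.
  by have [wt wtX] := boolp.choice wtP; exists wt.
have Xe : X`_j \in e by rewrite mem_nth // ltn_ord.
have X0 : X`_j != 0 by apply: free_not0 (basis_free eb) Xe.
have wX t : lieb (vsval t) X`_j = (linfun (weight_fun X j) t : K) *: X`_j.
  have [c tX] := diag _ _ (subvsP t) Xe; rewrite lfunE /= /weight_fun tX.
  by rewrite linearZ /= coord_free ?(basis_free eb) // eqxx mulr1.
have [w0|w0] := eqVneq (linfun (weight_fun X j)) 0.
  by exists 0 => t; rewrite wX w0 weight0.
have [_ _ base] := srootP D.
have [k [wk _]] : exists k, linfun (weight_fun X j) = weight_of sr k /\
    ((forall i, 0 <= k i) \/ (forall i, k i <= 0)).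
  by apply: base; split=> //; exists X`_j.
by exists k => t; rewrite wX wk.
Qed.

Lemma rdual_weight k i : exists2 t, vsval t = rdual D i &
  (weight_of sr k t : K) = rform D k i.
Proof.
exists (vsproj hh (rdual D i)); first exact: vsprojK (rdual_cartan D i).
rewrite weightE; apply: eq_bigr => j _; rewrite /sform -rdualP.
by rewrite vsprojK ?rdual_cartan.
Qed.

(** By invariance of the form, [x_i^+, x_i^-] pairs with the Cartan subalgebra as alpha_i does. The
    difference of the two sides lies in the Cartan subalgebra, so it is also orthogonal to the other
    weight spaces, and nondegeneracy applies. *)
Lemma chevxi_rdual i : chevxi D i = rdual D i.
Proof.
have ch : chevxi D i \in hh.
  by apply/gsp0_cartan; rewrite chevxiP -(subrr (rdelta i)); apply: gsp_lieb (gsp_xp i) (gsp_xm i).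
apply/eqP; rewrite -subr_eq0; apply/eqP; apply: (form_nondeg (formP D)) => y.
set z := _ - _; have zh : z \in hh by rewrite rpredB ?rdual_cartan.
have zorth t : form D z (vsval t) = 0.
  rewrite /z formDl formNl rdualP chevxiP formI.
  rewrite lieb_antisym [lieb _ (xm i)]gsp_xm weightN weight_delta opp_lfunE scaleNr opprK.
  by rewrite formC formZl formC chev_form mulr1 subrr.
have [n [X [wt [Xb wtX]]]] := weight_basis_exists.
rewrite formC (coord_basis Xb (memvf y)) form_sum big1 // => j _.
rewrite formZl; suff -> : form D X`_j z = 0 by rewrite mulr0.
have [w0|w0] := eqVneq (wt j) 0.
  have Xh : X`_j \in hh by apply/gsp0_cartan; rewrite -w0.
  by rewrite formC -(vsprojK Xh) zorth.
rewrite formC; apply: (@form_orth 0 (wt j)); rewrite ?add0r //.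
exact/gsp0_cartan.
Qed.

Lemma chevxi_lieb k i y : gsp k y -> lieb (chevxi D i) y = rform D k i *: y.
Proof. by move=> yk; have [t ti <-] := rdual_weight k i; rewrite chevxi_rdual -ti yk. Qed.

Section Step.
Variables (n : nat) (X : n.-tuple g) (wt : 'I_n -> lat).
Hypothesis (Xwt : weight_basis X wt).
Let Xb : basis_of fullv X := proj1 Xwt.
Let wtX j : gsp (wt j) X`_j := proj2 Xwt j.

Definition wproj k y := \sum_(j | wt j == k) coord X j y *: X`_j.

Lemma wproj_gsp k y : gsp k (wproj k y).
Proof. by apply: gsp_sum => j /eqP <-; apply/gspZ/wtX. Qed.

Lemma wproj_is_linear k : linear (wproj k).
Proof.
move=> c y z; rewrite /wproj scaler_sumr -big_split; apply: eq_bigr => j _ /=.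
by rewrite linearP /= scalerDl scalerA.
Qed.
HB.instance Definition _ k := GRing.isLinear.Build K g g _ (wproj k) (wproj_is_linear k).

(** Some t in the Cartan subalgebra separates the two weights; compare the j-th coordinates of both
    sides of [t, y] = k(t) y. *)
Lemma wproj_coord k (j : 'I_n) y : gsp k y -> wt j != k -> coord X j y = 0.
Proof.
move=> yk wj; have [t nz] : exists t, (weight_of sr (wt j - k) t : K) != 0.
  by apply: weight_neq0; rewrite subr_eq0.
have /(congr1 (coord X j)) := yk t.
rewrite {1}(coord_basis Xb (memvf y)) linear_sum /= [X in coord _ _ X](_ : _ =
   \sum_l (coord X l y * weight_of sr (wt l) t) *: X`_l); last first.
  by apply: eq_bigr => l _; rewrite linearZ /= wtX scalerA.
rewrite coord_sum_free ?(basis_free Xb) // linearZ /= => /eqP.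
rewrite -subr_eq0 [X in _ - X]mulrC -mulrBr mulf_eq0 => /orP[/eqP //|].
by rewrite weightD weightN lfunE /= opp_lfunE in nz; rewrite (negPf nz).
Qed.

Lemma wproj_id k y : gsp k y -> wproj k y = y.
Proof.
move=> yk; rewrite [RHS](coord_basis Xb (memvf y)) /wproj big_mkcond.
apply: eq_bigr => j _; case: eqP => // /eqP wj.
by rewrite (wproj_coord yk wj) scale0r.
Qed.

Lemma wproj_neq k l y : gsp l y -> l != k -> wproj k y = 0.
Proof.
move=> yl lk; apply: big1 => j /eqP wj.
by rewrite (wproj_coord yl) ?scale0r // wj eq_sym.
Qed.

Lemma wproj_lieb k l y z : gsp k y -> wproj (k + l) (lieb y z) = lieb y (wproj l z).
Proof.
move=> yk; rewrite (coord_basis Xb (memvf z)) (linear_sum (wproj l)).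
rewrite !(linear_sum (lieb y)) (linear_sum (wproj (k + l))) /=.
apply: eq_bigr => j _.
rewrite !linearZ /=; congr (_ *: _).
have yX := gsp_lieb yk (wtX j); have [wl|wl] := eqVneq (wt j) l.
  by rewrite wproj_id -?wl // wproj_id.
rewrite (wproj_neq (wtX j) wl) linear0; apply: wproj_neq yX _.
by apply: contra wl => /eqP/addrI ->.
Qed.

Lemma form_wproj k v y : gsp k y -> form D (wproj (- k) v) y = form D v y.
Proof.
move=> yk; rewrite [in RHS](coord_basis Xb (memvf v)) /wproj !form_sum [LHS]big_mkcond.
apply: eq_bigr => j _; case: eqP => // /eqP wj.
by rewrite formZl (form_orth _ (wtX j) yk) ?mulr0 // addr_eq0.
Qed.

(** A coordinate functional that vanishes on W and is 1 at y is represented by a vector, obtained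
    with the inverse of the Gram matrix [M] of the form. *)
Lemma form_separates (W : {vspace g}) y : y \notin W ->
  exists2 v, (forall z, z \in W -> form D v z = 0) & form D v y != 0.
Proof.
move=> yW; pose B := [tuple of y :: vbasis W].
have Bfree : free B by rewrite free_cons (span_basis (vbasisP W)) yW (basis_free (vbasisP W)).
pose f z := coord B ord0 z.
have fy : f y = 1 by rewrite /f -[y]/(B`_(@ord0 (\dim W))) coord_free // eqxx.
have fW z : z \in W -> f z = 0.
  move=> zW; rewrite (coord_vbasis zW) /f linear_sum big1 // => j _.
  rewrite linearZ /= (_ : (vbasis W)`_j = B`_(lift ord0 j)) // coord_free //.
  by rewrite mulr0.
pose M := \matrix_(p < n, q < n) form D X`_p X`_q.
have M_unit : M \in unitmx.
  rewrite unitmxE unitfE; apply/negP => /det0P[u /negP u0 uM]; apply: u0.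
  have w0 : \sum_p u 0 p *: X`_p = 0.
    apply: (form_nondeg (formP D)) => z; rewrite (coord_basis Xb (memvf z)).
    rewrite formC form_sum big1 // => q _; rewrite formZl formC form_sum.
    have /rowP/(_ q) := uM; rewrite !mxE => uq.
    rewrite -[X in _ * X]/(\sum_p _) (eq_bigr (fun p => u 0 p * M p q)) ?uq ?mulr0 //.
    by move=> p _; rewrite formZl mxE.
  apply/eqP/rowP => p; rewrite mxE.
  by move/freeP : (basis_free Xb) => /(_ (fun p => u 0 p) w0 p).
pose r : 'rV_n := (\row_q f X`_q) *m invmx M.
have vf z : form D (\sum_p r 0 p *: X`_p) z = f z.
  rewrite (coord_basis Xb (memvf z)) /f linear_sum formC form_sum; apply: eq_bigr => q _.
  rewrite formZl linearZ /= formC form_sum; congr (_ * _).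
  have rM : (r *m M) 0 q = f X`_q by rewrite mulmxKV // mxE.
  by rewrite -/(f X`_q) -rM mxE; apply: eq_bigr => p _; rewrite formZl [M _ _]mxE.
exists (\sum_p r 0 p *: X`_p) => [z zW|]; first by rewrite vf fW.
by rewrite vf fy oner_eq0.
Qed.

Lemma gsp_weight k y : gsp k y -> y != 0 -> exists j, wt j = k.
Proof.
move=> yk y0; apply: contrapT => /forallNP wt_k; case/eqP: y0.
rewrite (coord_basis Xb (memvf y)) big1 // => j _.
rewrite (wproj_coord yk) ?scale0r //; apply/eqP; exact: wt_k.
Qed.

End Step.

Lemma sformC i j : sform D i j = sform D j i. Proof. exact: formC. Qed.

Lemma rform_delta i j : rform D (rdelta i) j = sform D i j.
Proof.
rewrite /rform (bigD1 i) //= ffunE eqxx mul1r big1 ?addr0 // => l li.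
by rewrite ffunE eq_sym (negPf li) mul0r.
Qed.
Lemma rformD k l i : rform D (k + l) i = rform D k i + rform D l i.
Proof. by rewrite -big_split; apply: eq_bigr => j _; rewrite ffunE intrD mulrDl. Qed.
Lemma rformN k i : rform D (- k) i = - rform D k i.
Proof. by rewrite -sumrN; apply: eq_bigr => j _; rewrite ffunE mulrNz mulNr. Qed.

Lemma rform_pos k : k != 0 -> 0 < \sum_i (k i)%:~R * rform D k i.
Proof.
move=> /(form_pos D); congr (_ < _); apply: eq_bigr => i _.
by rewrite mulr_sumr; apply: eq_bigr => j _; rewrite mulrA -/(sform D i j) sformC.
Qed.

Lemma rdelta_neq0 (i : I) : rdelta i != 0.
Proof. by apply/eqP => /ffunP/(_ i); rewrite !ffunE eqxx. Qed.

Lemma sform_gt0 i : 0 < sform D i i.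
Proof.
have := rform_pos (rdelta_neq0 i); rewrite (bigD1 i) //= ffunE eqxx mul1r big1.
  by rewrite addr0 rform_delta.
by move=> j ji; rewrite ffunE eq_sym (negPf ji) mul0r.
Qed.

(** The order of a [numFieldType] is partial. Realness allows [no_lowest_vector] to pass from not
    positive to nonpositive. *)
Lemma rform_real k i : rform D k i \is Num.real.
Proof.
apply: rpred_sum => j _; rewrite rpredM ?realz //.
rewrite sformC -[sform D i j](cmxP D) rpredM ?realz // rpredM ?rpredV ?realn //.
exact/gtr0_real/sform_gt0.
Qed.

(** The usual sl_2 computation: x_i^+ sends the (m+1)-st vector of the string to c_m times the m-th,
    where c_m is a sum of pairings of weights with alpha_i. These are negative from the start and
    decrease along the string, so c_m never vanishes. *)
Lemma lowering_string k i v : gsp k v -> lieb (xp i) v = 0 -> v != 0 -> rform D k i < 0 ->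
  forall n, iter n (lieb (xm i)) v != 0.
Proof.
move=> vk xv v0 ki n; pose u m := iter m (lieb (xm i)) v.
have uk m : gsp (k - rdelta i *+ m) (u m).
  elim: m => [|m IH]; first by rewrite subr0.
  by rewrite mulrS opprD addrCA; apply: gsp_lieb (gsp_xm i) IH.
have ki_m m : rform D (k - rdelta i *+ m) i < 0.
  elim: m => [|m IH]; first by rewrite subr0.
  rewrite mulrSr opprD addrA rformD rformN rform_delta.
  by rewrite subr_lt0 (lt_trans IH) ?sform_gt0.
have xu m : exists2 c : K, c < 0 & lieb (xp i) (u m.+1) = c *: u m.
  have step : lieb (xp i) (u m.+1) =
      rform D (k - rdelta i *+ m) i *: u m + lieb (xm i) (lieb (xp i) (u m)).
    by rewrite [u m.+1]/= lieb_derivation -chevxiP (chevxi_lieb _ (uk m)).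
  elim: m step => [|m IH] step.
    by exists (rform D (k - rdelta i *+ 0) i); rewrite // step xv linear0 addr0.
  have [c c0 xum] : exists2 c : K, c < 0 & lieb (xp i) (u m.+1) = c *: u m.
    by apply: IH; rewrite [u m.+1]/= lieb_derivation -chevxiP (chevxi_lieb _ (uk m)).
  exists (rform D (k - rdelta i *+ m.+1) i + c); last first.
    by rewrite step xum linearZ /= scalerDl.
  by rewrite -(addr0 0) ltrD.
elim: n => // n IH; apply: contra IH => /eqP un0; have [c c0] := xu n.
rewrite /u un0 linear0 => /esym/eqP; rewrite scaler_eq0 => /orP[/eqP c_eq0|//].
by rewrite c_eq0 ltxx in c0.
Qed.

(** As (k, k) > 0 and k has nonnegative coordinates, some alpha_i pairs positively with k. A nonzero
    v would then generate an unending lowering string, although there are finitely many weights. *)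
Lemma no_lowest_vector k v :
  Qplus k -> gsp (- k) v -> (forall j, lieb (xp j) v = 0) -> v = 0.
Proof.
move=> [k0 kpos] vk xv; apply/eqP/negPn/negP => v0.
have k_neq0 : k != 0 by apply: contraTneq kpos => ->; rewrite big1 ?ltxx // => i _; rewrite ffunE.
have [i ki] : exists i, 0 < rform D k i.
  apply: contrapT => /forallNP npos; have /lt_geF/negP := rform_pos k_neq0; apply.
  apply: sumr_le0 => i _; rewrite mulr_ge0_le0 ?ler0z // real_leNgt ?real0 ?rform_real //.
  exact/negP.
have [n [X [wt [Xwt wtX]]]] := weight_basis_exists.
(* [N] exceeds the alpha_i-coordinate of every weight in absolute value, so -k - N alpha_i is not a
   weight. *)
pose N := (\sum_j `|wt j i|)%N.+1.
have lt_wt j : (`|wt j i| < N)%N by rewrite ltnS (bigD1 j) //= leq_addr.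
have kn : rform D (- k) i < 0 by rewrite rformN oppr_lt0.
have uN0 := lowering_string vk (xv i) v0 kn N.
have uk : gsp (- k - rdelta i *+ N) (iter N (lieb (xm i)) v).
  elim: (N) => [|m IH]; first by rewrite subr0.
  by rewrite mulrS opprD addrCA; apply: gsp_lieb (gsp_xm i) IH.
have [j wj] := gsp_weight (conj Xwt wtX) uk uN0.
have deltaN m : (rdelta i *+ m) i = m%:Z.
  by elim: m => [|m IH]; rewrite ?mulrS !ffunE ?eqxx // IH.
have := lt_wt j; have := k0 i; rewrite wj !ffunE deltaN.
by case: (k i) => // a _; rewrite -opprD -PoszD abszN absz_nat ltnNge leq_addl.
Qed.

(** If y were outside the sum W of the images of ad x_j^+, the form would give v orthogonal to W and
    not to y. By invariance every x_j^+ kills v, so the component of v of weight -k vanishes by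
    [no_lowest_vector]; but only this component pairs with y. Projecting the resulting summands to
    weights k - alpha_j makes them homogeneous. *)
Lemma raising_decomposition k y : Qplus k -> gsp k y ->
  exists2 z : I -> g, forall j, gsp (k - rdelta j) (z j) & y = \sum_j lieb (xp j) (z j).
Proof.
move=> kQ yk; have [n [X [wt Xwt]]] := weight_basis_exists.
pose W := (\sum_j limg (linfun (lieb (xp j))))%VS.
have imW j z : lieb (xp j) z \in W.
  apply: (subvP (sumv_sup j isT (subvv _))).
  by apply/memv_imgP; exists z; rewrite ?memvf ?lfunE.
have [yW|/(form_separates Xwt)[v vW]] := boolP (y \in W); last first.
  rewrite -(form_wproj Xwt _ yk) (no_lowest_vector kQ (wproj_gsp Xwt _ _)).
    by rewrite form0l eqxx.
  move=> j; rewrite -(wproj_lieb Xwt _ _ (gsp_xp j)).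
  suff -> : lieb (xp j) v = 0 by rewrite linear0.
  apply: (form_nondeg (formP D)) => z.
  by rewrite lieb_antisym formNl formI vW ?oppr0.
have [vs vsW yE] := memv_sumP yW.
have /boolp.choice[z zE] j : exists z, vs j = lieb (xp j) z.
  by have /memv_imgP[z _ ->] := vsW j isT; exists z; rewrite lfunE.
exists (fun j => wproj X wt (k - rdelta j) (z j)) => [j|]; first exact: wproj_gsp.
rewrite -{1}(wproj_id Xwt yk) yE linear_sum; apply: eq_bigr => j _.
by rewrite zE -(wproj_lieb Xwt _ _ (gsp_xp j)) addrC subrK.
Qed.
Lemma sum_delta (i : I) : \sum_j rdelta i j = 1.
Proof.
by rewrite (bigD1 i) //= ffunE eqxx big1 // => j ji; rewrite ffunE eq_sym (negPf ji).
Qed.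
Lemma sum_latD k l : \sum_j (k + l) j = \sum_j k j + \sum_j l j.
Proof. by rewrite -big_split; apply: eq_bigr => j _; rewrite ffunE. Qed.
Lemma sum_latN k : \sum_j (- k) j = - \sum_j k j.
Proof. by rewrite -sumrN; apply: eq_bigr => j _; rewrite ffunE. Qed.

Lemma Qplus_neq0 k : (forall i, 0 <= k i) -> k != 0 -> Qplus k.
Proof.
move=> k0 nz; split=> //; rewrite lt_def sumr_ge0 // andbT.
apply: contra nz => /eqP; move/psumr_eq0P => /(_ (fun i _ => k0 i)) z.
by apply/eqP/ffunP => i; rewrite z ?ffunE.
Qed.

Lemma Qplus_delta (i : I) : Qplus (rdelta i).
Proof. by apply: Qplus_neq0 (rdelta_neq0 i) => j; rewrite ffunE; case: eqP. Qed.

(** The coordinates of a weight have one sign. If those of k - alpha_j were nonpositive, k would be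
    supported at j with coordinate 1. *)
Lemma Qplus_sub_delta k j z : Qplus k -> k != rdelta j -> gsp (k - rdelta j) z ->
  z != 0 -> Qplus (k - rdelta j).
Proof.
move=> [k0 kpos] kj zk z0; case: (gsp_sign zk z0) => [|neg].
  by move/Qplus_neq0; apply; rewrite subr_eq0.
case/eqP: kj; have kE i : i != j -> k i = 0.
  move=> ij; apply/eqP; rewrite eq_le k0 andbT.
  by have := neg i; rewrite !ffunE eq_sym (negPf ij) subr0.
have kj : k j = \sum_i k i by rewrite (bigD1 j) //= big1 ?addr0 // => i /kE.
have k1 : k j = 1.
  apply/eqP; rewrite eq_le kj -gtz0_ge1 kpos andbT -kj.
  by have := neg j; rewrite !ffunE eqxx subr_le0.
by apply/ffunP => i; rewrite ffunE eq_sym; case: eqVneq => [->|/kE].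
Qed.

(** Induction on height by [raising_decomposition]. The inductive hypothesis covers every weight of
    height at most that of k, because [omega_symmetrized] needs it for [x_j^-, z] as well as for
    z. *)
Lemma posroot_ind (P : lat -> g -> Prop) :
  (forall k, P k 0) -> (forall k y z, P k y -> P k z -> P k (y + z)) ->
  (forall k c y, P k y -> P k (c *: y)) ->
  (forall j, P (rdelta j) (xp j)) ->
  (forall j k z, Qplus k -> gsp k z ->
    (forall l y, Qplus l -> \sum_i l i <= \sum_i k i -> gsp l y -> P l y) ->
    P (k + rdelta j) (lieb (xp j) z)) ->
  forall k y, Qplus k -> gsp k y -> P k y.
Proof.
move=> P0 PD PZ Pbase Pstep k y.
have [n] := ubnP (absz (\sum_i k i)); elim: n k y => // n IH k y kn kQ yk.
have [z zk ->] := raising_decomposition kQ yk.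
elim/big_ind: _ => // [|j _]; first exact: PD.
have [->|z0] := eqVneq (z j) 0; first by rewrite linear0.
(* In this case z_j has weight 0, so it lies in the Cartan subalgebra and acts on x_j^+ by a
   scalar. *)
have [kj|kj] := eqVneq k (rdelta j).
  have zh : z j \in hh by apply/gsp0_cartan; rewrite -(subrr k) {2}kj.
  rewrite kj lieb_antisym -(vsprojK zh) gsp_xp -scaleNr; exact/PZ/Pbase.
have kjQ := Qplus_sub_delta kQ kj (zk j) z0.
rewrite -[k](subrK (rdelta j)); apply: Pstep => // l x lQ lk xl; apply: IH => //.
move: lQ.2 kQ.2 lk kn; rewrite sum_latD sum_latN sum_delta.
case: (\sum_i l i) => // a; case: (\sum_i k i) => // b _ b0.
by rewrite lerBrDr -PoszD lez_nat addn1 !absz_nat ltnS => /leq_trans h /h.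
Qed.

Lemma delta_inj : injective (@rdelta I).
Proof.
by move=> i j /ffunP/(_ j); rewrite !ffunE eqxx; case: eqP.
Qed.

Lemma simple_root_space i y : gsp (rdelta i) y -> exists c, y = c *: xp i.
Proof.
move=> yi; have : forall k z, Qplus k -> gsp k z -> k = rdelta i -> exists c, z = c *: xp i.
  apply: posroot_ind => [k _|k y1 y2 h1 h2 /[dup]/h1[c1 ->] /h2[c2 ->]|k c y1 h /h[c1 ->]||].
  - by exists 0; rewrite scale0r.
  - by exists (c1 + c2); rewrite scalerDl.
  - by exists (c * c1); rewrite scalerA.
  - by move=> j /delta_inj ->; exists 1; rewrite scale1r.
  move=> j k z [_ k0] _ _ /(congr1 (fun l : lat => \sum_i l i)).
  by rewrite sum_latD !sum_delta -[1 in RHS]add0r => /addIr k00; rewrite k00 ltxx in k0.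
by move=> /(_ _ _ (Qplus_delta i) yi erefl).
Qed.

(** A vector of weight 2 alpha_i is a sum of brackets of some x_j^+ with a vector of weight 2
    alpha_i - alpha_j. Signs leave only j = i, where that vector is a multiple of x_i^+. *)
Lemma double_root_space i y : gsp (rdelta i + rdelta i) y -> y = 0.
Proof.
move=> yi; have iiQ : Qplus (rdelta i + rdelta i).
  by split=> [j|]; [rewrite !ffunE; case: eqP | rewrite sum_latD sum_delta].
have [z zk ->] := raising_decomposition iiQ yi; apply: big1 => j _.
have [->|z0] := eqVneq (z j) 0; first exact: linear0.
have ij : rdelta i + rdelta i != rdelta j.
  by apply/eqP => /(congr1 (fun l : lat => \sum_i l i)); rewrite sum_latD !sum_delta.
have := (Qplus_sub_delta iiQ ij (zk j) z0).1 j; rewrite !ffunE eqxx.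
case: eqP => // ij' _; have := zk j; rewrite -ij' addrK => /simple_root_space[c ->].
by rewrite linearZ /= liebxx scaler0.
Qed.

(** With w = [x_j^-, z], the bracket [x_j^+ - x_j^-, z + omega z] is the symmetrization of
    [x_j^+, z] minus that of w, and w has smaller height than [x_j^+, z]. Applied to root vectors,
    this brings x_al^+ - x_al^- into the twisted Yangian, see [B_coideal]. *)
Lemma omega_symmetrized (P : g -> Prop) :
  P 0 -> (forall y z, P y -> P z -> P (y + z)) -> (forall c y, P y -> P (c *: y)) ->
  (forall i, P (xp i - xm i)) -> (forall i y, P y -> P (lieb (xp i - xm i) y)) ->
  forall k y, Qplus k -> gsp k y -> P (y + omega D y).
Proof.
move=> P0 PD PZ Pb Pad; apply: posroot_ind => [k|k y z Py Pz|k c y Py|j|j k z kQ zk IH].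
- by rewrite linear0 addr0.
- by rewrite linearD /= addrACA; apply: PD.
- by rewrite linearZ /= -scalerDr; apply: PZ.
- by rewrite omega_chev.
have [kj|kj] := eqVneq k (rdelta j).
  have [c ->] : exists c, z = c *: xp j by apply: simple_root_space; rewrite -kj.
  by rewrite linearZ /= liebxx scaler0 linear0 addr0.
pose w := lieb (xm j) z.
have Pw : P (w + omega D w).
  have [->|w0] := eqVneq w 0; first by rewrite linear0 addr0.
  have wk : gsp (k - rdelta j) w by rewrite addrC; apply: gsp_lieb (gsp_xm j) zk.
  apply: (IH (k - rdelta j)) => //; first exact: Qplus_sub_delta wk w0.
  by rewrite sum_latD sum_latN sum_delta gerDl.
have Pz : P (z + omega D z) by apply: (IH k).
have -> : lieb (xp j) z + omega D (lieb (xp j) z) =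
    lieb (xp j - xm j) (z + omega D z) + (w + omega D w).
  rewrite !omega_lie !omega_chev /= liebDl !liebNl !linearD /= ?opprD.
  by rewrite [RHS](AC ((2*2)*2) ((1*4)*(2*6)*(3*5))) /= subrr addNr !addr0.
by apply: PD => //; apply: Pad.
Qed.

(** Positivity of the form is available on the root lattice only, not on K-combinations of simple
    roots. Hence the Gram matrix is factored through the integral Cartan matrix: a kernel vector of
    the latter over the integers would be a nonzero lattice element of norm zero. *)
Lemma coweight_exists i : exists c : I -> K, forall l : I, \sum_j c j * sform D j l = (i == l)%:R.
Proof.
pose C := \matrix_(p < #|I|, q < #|I|) cmx D (enum_val p) (enum_val q).
pose d : 'rV[K]_#|I| := \row_p (sform D (enum_val p) (enum_val p) / 2).
pose M := \matrix_(p < #|I|, q < #|I|) sform D (enum_val p) (enum_val q).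
have ME : M = diag_mx d *m map_mx intr C.
  by apply/matrixP => p q; rewrite mul_diag_mx !mxE; exact/esym/cmxP.
have C0 : \det C != 0.
  rewrite -det_tr; apply/negP => /det0P[v v0 vC].
  pose k : lat := [ffun j => v 0 (enum_rank j)].
  have k0 : k != 0.
    apply: contra v0 => /eqP/ffunP k0; apply/eqP/rowP => p.
    by have := k0 (enum_val p); rewrite !ffunE enum_valK mxE.
  have := form_pos D k0; rewrite big1 ?ltxx // => j _.
  have /rowP/(_ (enum_rank j)) := vC; rewrite !mxE => vCj.
  have : \sum_l k l * cmx D j l = 0.
    rewrite big_enum_val -[RHS]vCj; apply: eq_bigr => p _.
    by rewrite !mxE ffunE enum_valK enum_rankK.
  move=> /(congr1 (intr : int -> K)).
  rewrite rmorph_sum => /(congr1 ( *%R ((k j)%:~R * (sform D j j / 2)))).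
  rewrite mulr0 mulr_sumr => kc; rewrite -[RHS]kc; apply: eq_bigr => l _.
  by rewrite -(cmxP D) rmorphM /sform /=; ring.
have M_unit : M \in unitmx.
  rewrite unitmxE unitfE ME det_mulmx det_diag det_map_mx mulf_neq0 ?intr_eq0 //.
  apply/prodf_neq0 => p _; rewrite mxE mulf_neq0 ?gt_eqF ?sform_gt0 ?invr_gt0 ?ltr0n //.
exists (fun j => invmx M (enum_rank i) (enum_rank j)) => l.
have /matrixP/(_ (enum_rank i) (enum_rank l)) := mulVmx M_unit.
rewrite !mxE (inj_eq enum_rank_inj) => <-; rewrite big_enum_val.
by apply: eq_bigr => p _; rewrite mxE enum_valK enum_rankK.
Qed.

End RootVectors.

(** * Graded spans *)

Section LinearSpan.
Variables (K : fieldType) (V : lmodType K).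
Implicit Types (P Q : V -> Prop) (v w : V).

Lemma lspan_ind P Q : Q 0 -> (forall v w, Q v -> Q w -> Q (v + w)) ->
  (forall c v, P v -> Q (c *: v)) -> forall v, lspan P v -> Q v.
Proof.
move=> Q0 QD QZ _ [s [sP ->]]; rewrite big_seq.
by elim/big_ind: _ => // p /sP; apply: QZ.
Qed.
Lemma lspan0 P : lspan P 0. Proof. by exists [::]; rewrite big_nil. Qed.
Lemma lspanD P v w : lspan P v -> lspan P w -> lspan P (v + w).
Proof.
move=> [s [sP ->]] [t [tP ->]]; exists (s ++ t); rewrite big_cat; split=> // p.
by rewrite mem_cat => /orP[/sP|/tP].
Qed.
Lemma lspanZ P c v : lspan P v -> lspan P (c *: v).
Proof.
move=> [s [sP ->]]; exists [seq (c * p.1, p.2) | p <- s]; split.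
  by move=> p /mapP[q /sP qP ->].
by rewrite big_map scaler_sumr; apply: eq_bigr => p _; rewrite scalerA.
Qed.
Lemma lspan_gen P v : P v -> lspan P v.
Proof.
by move=> Pv; exists [:: (1, v)]; rewrite big_seq1 scale1r; split=> // p /[!inE]/eqP ->.
Qed.
Lemma lspanN P v : lspan P v -> lspan P (- v).
Proof. by rewrite -scaleN1r; apply: lspanZ. Qed.
Lemma lspanB P v w : lspan P v -> lspan P w -> lspan P (v - w).
Proof. by move=> Pv Pw; apply: lspanD Pv (lspanN Pw). Qed.
Lemma lspan_sum P (J : Type) (s : seq J) (R : pred J) (f : J -> V) :
  (forall j, R j -> lspan P (f j)) -> lspan P (\sum_(j <- s | R j) f j).
Proof. by move=> fP; elim/big_ind: _ => //; [exact: lspan0 | exact: lspanD]. Qed.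
Lemma lspan_sub P Q v : (forall w, P w -> lspan Q w) -> lspan P v -> lspan Q v.
Proof.
move=> PQ; apply: lspan_ind v; [exact: lspan0 | exact: lspanD |].
by move=> c v /PQ; apply: lspanZ.
Qed.

End LinearSpan.

Section AlgebraSpan.
Variables (K : fieldType) (A : algType K).

Lemma lspanM (P Q R : A -> Prop) x y : (forall x y, P x -> Q y -> R (x * y)) ->
  lspan P x -> lspan Q y -> lspan R (x * y).
Proof.
move=> PQR xP yQ; move: x xP; apply: lspan_ind => [|x x' hx hx'|c x Px].
- by rewrite mul0r; apply: lspan0.
- by rewrite mulrDl; apply: lspanD.
rewrite -scalerAl; apply: lspanZ; move: y yQ.
apply: lspan_ind => [|y y' hy hy'|b y Qy].
- by rewrite mulr0; apply: lspan0.
- by rewrite mulrDr; apply: lspanD.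
by rewrite -scalerAr; apply/lspanZ/lspan_gen/PQR.
Qed.

End AlgebraSpan.

Section Grading.
Variables (K : fieldType) (A : algType K) (I : finType).
Variable G : rlattice I -> A -> Prop.
Hypothesis GM : forall k l x y, G k x -> G l y -> G (k + l) (x * y).
Implicit Types (S T U : rlattice I -> Prop) (x y : A) (f h : pser A).

Definition gspan S := lspan (fun x => exists2 k, S k & G k x).

Lemma gspan_gen S k x : S k -> G k x -> gspan S x.
Proof. by move=> Sk Gx; apply: lspan_gen; exists k. Qed.
Lemma gspan_sub S T x : (forall k, S k -> T k) -> gspan S x -> gspan T x.
Proof.
by move=> ST; apply: lspan_sub => y [k /ST Tk Gy]; apply: gspan_gen Tk Gy.
Qed.
Lemma gspanM S T U x y : (forall k l, S k -> T l -> U (k + l)) ->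
  gspan S x -> gspan T y -> gspan U (x * y).
Proof.
move=> STU; apply: lspanM => {}x {}y [k Sk Gx] [l Tl Gy].
by exists (k + l); [exact: STU | exact: GM].
Qed.

Definition sgspan S f := forall n, gspan S (f n).

Lemma sgspan0 S : sgspan S 0. Proof. by move=> n; apply: lspan0. Qed.
Lemma sgspanD S f h : sgspan S f -> sgspan S h -> sgspan S (f + h).
Proof. by move=> fS hS n; apply: lspanD (fS n) (hS n). Qed.
Lemma sgspanN S f : sgspan S f -> sgspan S (- f).
Proof. by move=> fS n; apply: lspanN (fS n). Qed.
Lemma sgspanB S f h : sgspan S f -> sgspan S h -> sgspan S (f - h).
Proof. by move=> fS hS; apply: sgspanD (sgspanN hS). Qed.
Lemma sgspanZ S c f : sgspan S f -> sgspan S (c *: f).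
Proof. by move=> fS n; apply: lspanZ (fS n). Qed.
Lemma sgspan_sum S (J : Type) (s : seq J) (P : pred J) (f : J -> pser A) :
  (forall j, P j -> sgspan S (f j)) -> sgspan S (\sum_(j <- s | P j) f j).
Proof. by move=> fS; elim/big_ind: _ => //; [exact: sgspan0 | move=> *; exact: sgspanD]. Qed.
Lemma sgspan_sub S T f : (forall k, S k -> T k) -> sgspan S f -> sgspan T f.
Proof. by move=> ST fS n; apply: gspan_sub ST (fS n). Qed.
Lemma sgspanM S T U f h : (forall k l, S k -> T l -> U (k + l)) ->
  sgspan S f -> sgspan T h -> sgspan U (f * h).
Proof.
move=> STU fS hT n; rewrite pserME; apply: lspan_sum => k _.
exact: gspanM STU (fS _) (hT _).
Qed.
Lemma sgspan_comm S T U f h : (forall k l, S k -> T l -> U (k + l)) ->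
  sgspan S f -> sgspan T h -> sgspan U (comm f h).
Proof.
move=> STU fS hT; apply: sgspanB; first exact: sgspanM STU fS hT.
by apply: sgspanM hT fS => k l Tk Sl; rewrite addrC; apply: STU.
Qed.
Lemma sgspan_acomm S T U f h : (forall k l, S k -> T l -> U (k + l)) ->
  sgspan S f -> sgspan T h -> sgspan U (acomm f h).
Proof.
move=> STU fS hT; apply: sgspanD; first exact: sgspanM STU fS hT.
by apply: sgspanM hT fS => k l Tk Sl; rewrite addrC; apply: STU.
Qed.
Lemma sgspan_pshift S f : sgspan S f -> sgspan S (pshift f).
Proof. by move=> fS [|n]; [exact: lspan0 | exact: fS]. Qed.
Lemma sgspan_pconst S x : gspan S x -> sgspan S (pconst x).
Proof. by move=> xS [|n] //; exact: lspan0. Qed.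

End Grading.

(** * Subalgebras and series with coefficients in them *)

Record subalgebra (K : fieldType) (A : algType K) (P : A -> Prop) : Prop := Subalgebra {
  subalgebra1 : P 1;
  subalgebraD : forall x y, P x -> P y -> P (x + y);
  subalgebraZ : forall c x, P x -> P (c *: x);
  subalgebraM : forall x y, P x -> P y -> P (x * y)
}.

Section SubalgebraSeries.
Variables (K : fieldType) (A : algType K) (P : A -> Prop).
Hypothesis subP : subalgebra P.
Implicit Types (x y : A) (f h : pser A).

Lemma subalgebra0 : P 0.
Proof. by rewrite -(scale0r 1); apply/(subalgebraZ subP)/(subalgebra1 subP). Qed.
Lemma subalgebraN x : P x -> P (- x).
Proof. by rewrite -scaleN1r; apply: subalgebraZ. Qed.
Lemma subalgebraB x y : P x -> P y -> P (x - y).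
Proof. by move=> Px Py; apply: subalgebraD => //; apply: subalgebraN. Qed.
Lemma subalgebra_comm x y : P x -> P y -> P (comm x y).
Proof. by move=> Px Py; apply: subalgebraB; apply: subalgebraM. Qed.
Lemma subalgebra_sum (J : Type) (s : seq J) (R : pred J) (f : J -> A) :
  (forall j, R j -> P (f j)) -> P (\sum_(j <- s | R j) f j).
Proof. by move=> fP; elim/big_ind: _ => //; [exact: subalgebra0 | exact: subalgebraD]. Qed.

Definition coef_in f := forall n, P (f n).

Lemma coef_in1 : coef_in 1.
Proof. by case=> [|n]; [exact: subalgebra1 | exact: subalgebra0]. Qed.
Lemma coef_inD f h : coef_in f -> coef_in h -> coef_in (f + h).
Proof. by move=> fP hP n; apply: subalgebraD. Qed.
Lemma coef_inB f h : coef_in f -> coef_in h -> coef_in (f - h).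
Proof. by move=> fP hP n; apply: subalgebraB. Qed.
Lemma coef_inZ c f : coef_in f -> coef_in (c *: f).
Proof. by move=> fP n; apply: subalgebraZ. Qed.
Lemma coef_inM f h : coef_in f -> coef_in h -> coef_in (f * h).
Proof. by move=> fP hP n; apply: subalgebra_sum => k _; apply: subalgebraM. Qed.
Lemma coef_in_comm f h : coef_in f -> coef_in h -> coef_in (comm f h).
Proof. by move=> fP hP; apply: coef_inB; apply: coef_inM. Qed.
Lemma coef_in_acomm f h : coef_in f -> coef_in h -> coef_in (acomm f h).
Proof. by move=> fP hP; apply: coef_inD; apply: coef_inM. Qed.
Lemma coef_in_pconst x : P x -> coef_in (pconst x).
Proof. by move=> Px [|n] //; apply: subalgebra0. Qed.
Lemma coef_in_pshift f : coef_in f -> coef_in (pshift f).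
Proof. by move=> fP [|n]; [exact: subalgebra0 | exact: fP]. Qed.

End SubalgebraSeries.

(** The Yangian relations at one node, with d = d_i, and an element Xi that shifts modes. They are
    kept abstract so as to hold both in Y and in the second factor of Y (x) Y, where
    [yangian_string_map] transports them. *)
Record yangian_string (K : fieldType) (A : algType K) (d : K)
    (x y xi : nat -> A) (Xi : A) : Prop := YangianString {
  ys_xixi : forall r s, comm (xi r) (xi s) = 0;
  ys_xy : forall r s, comm (x r) (y s) = xi (r + s)%N;
  ys_xi0x : forall s, comm (xi 0%N) (x s) = (d *+ 2) *: x s;
  ys_xi0y : forall s, comm (xi 0%N) (y s) = - (d *+ 2) *: y s;
  ys_xix : forall r s,
    comm (xi r.+1) (x s) - comm (xi r) (x s.+1) = d *: acomm (xi r) (x s);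
  ys_xiy : forall r s,
    comm (xi r.+1) (y s) - comm (xi r) (y s.+1) = - d *: acomm (xi r) (y s);
  ys_yy : forall r s,
    comm (y r.+1) (y s) - comm (y r) (y s.+1) = - d *: acomm (y r) (y s);
  ys_Xixi : forall r, comm Xi (xi r) = 0;
  ys_Xix : forall s, comm Xi (x s) = x s.+1;
  ys_Xiy : forall s, comm Xi (y s) = - y s.+1
}.

Lemma mulr2n_lmod_inj (K : numFieldType) (V : lmodType K) (v w : V) : v *+ 2 = w *+ 2 -> v = w.
Proof.
move/eqP; rewrite -subr_eq0 -mulrnBl -scaler_nat scaler_eq0 pnatr_eq0 /=.
by rewrite subr_eq0 => /eqP.
Qed.

Lemma half_scaleD (K : numFieldType) (V : lmodType K) (v : V) : 2^-1 *: (v + v) = v.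
Proof. by rewrite -mulr2n -scaler_nat scalerA mulVf ?pnatr_eq0 // scale1r. Qed.

(** * Identities between the currents at one node *)

Section String.
Variables (K : numFieldType) (A : algType K) (d : K).
Variables (x y xi : nat -> A) (Xi : A).
Hypothesis str : yangian_string d x y xi Xi.

Definition xi_plus : pser A := fun n => if n is r.+1 then xi r else 1.
(* eta = xi(-u), F = x^-(-u), xneg = x^+(-u) *)
Definition xi_minus : pser A := series_neg xi_plus.
Definition x_neg (z : nat -> A) : pser A := fun n => (-1) ^+ n.+1 *: z n.
Local Notation eta := xi_minus.
Local Notation F := (pshift (x_neg y)).
Local Notation xneg := (pshift (x_neg x)).
Local Notation X := (pshift (x : pser A)).
Local Notation F0 := (pconst (- y 0%N)).
Local Notation x0 := (pconst (x 0%N)).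
Local Notation xi0 := (pconst (xi 0%N)).
Local Notation cXi := (pconst Xi).

Lemma comm_pconst_pshift a (f : nat -> A) (g : pser A) : g 0%N = 0 ->
  (forall n, comm a (f n) = g n.+1) -> comm (pconst a) (pshift f) = g.
Proof.
by move=> g0 gS; apply: funext => -[|n]; rewrite comm_pconstE /= ?comm0r ?g0 ?gS.
Qed.

Lemma x_neg0 z : x_neg z 0%N = - z 0%N.
Proof. by rewrite /x_neg expr1 scaleN1r. Qed.

Lemma comm_x0_F : comm x0 F = eta - 1.
Proof.
apply: comm_pconst_pshift; first by rewrite pserBE /eta /series_neg expr0 scale1r subrr.
by move=> n; rewrite commZr (ys_xy str) pserBE subr0.
Qed.

Lemma comm_F0_X : comm F0 X = xi_plus - 1.
Proof.
apply: comm_pconst_pshift; first by rewrite pserBE subrr.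
by move=> n; rewrite commNl -commC (ys_xy str) addn0 pserBE subr0.
Qed.

Lemma xi_plus_x m n :
  comm (xi_plus m.+1) (x n) - comm (xi_plus m) (x n.+1) = d *: acomm (xi_plus m) (x n).
Proof.
case: m => [|m] /=; last exact: (ys_xix str).
by rewrite (ys_xi0x str) commC comm1r oppr0 subr0 acommC acomm1r -scalerMnl scalerMnr.
Qed.
Lemma xi_plus_y m n :
  comm (xi_plus m.+1) (y n) - comm (xi_plus m) (y n.+1) = - d *: acomm (xi_plus m) (y n).
Proof.
case: m => [|m] /=; last exact: (ys_xiy str).
rewrite (ys_xi0y str) commC comm1r oppr0 subr0 acommC acomm1r.
by rewrite -mulNrn -scalerMnl scalerMnr.
Qed.

(** With both sequences equal, the two boundary brackets of the telescoped relation coincide, and it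
    reads twice the claim. The substitution of -u for u turns the coefficient -d into d. *)
Lemma comm_F0_F : comm F0 F + d *: (F * F) = 0.
Proof.
have rel m n : comm (x_neg y m.+1) (x_neg y n) - comm (x_neg y m) (x_neg y n.+1) =
    d *: acomm (x_neg y m) (x_neg y n).
  rewrite /x_neg !exprS !commZl !commZr acommZl acommZr !scalerA.
  set p := (-1) ^+ m; set q := (-1) ^+ n.
  have -> : -1 * (-1 * p) * (-1 * q) = - (p * q) by ring.
  have -> : -1 * p * (-1 * (-1 * q)) = - (p * q) by ring.
  by rewrite -scalerBr (ys_yy str) scalerA; congr (_ *: _); ring.
have tel := telescope_comm rel.
apply/eqP; rewrite addr_eq0 -pshiftMl -pshiftMr -scalerN; apply/eqP.
apply: comm_pconst_pshift => [|[|n]]; first by rewrite pserZE pserNE /= oppr0 scaler0.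
  by rewrite -x_neg0 commxx pserZE pserNE /= oppr0 scaler0.
rewrite -x_neg0 pserZE pserNE /=; apply: mulr2n_lmod_inj; rewrite !mulr2n; have := tel n.
rewrite /acomm pserDE [comm (x_neg y n.+1) _]commC => /(congr1 -%R).
by rewrite opprD opprK => ->; rewrite scalerDr scalerN opprD.
Qed.

(** One proof serves x_i^+ (e = d) and x_i^- (e = -d). The constant coefficient of eta is 1, so one
    boundary bracket of the telescoped relation is zero. *)
Lemma comm_eta_neg (e : K) (z : nat -> A) :
  (forall m n, comm (xi_plus m.+1) (z n) - comm (xi_plus m) (z n.+1) = e *: acomm (xi_plus m) (z n)) ->
  comm (pconst (z 0%N)) eta = - e *: acomm eta (pshift (x_neg z)).
Proof.
move=> rel; have rel' m n : comm (eta m.+1) (x_neg z n) - comm (eta m) (x_neg z n.+1) =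
    - e *: acomm (eta m) (x_neg z n).
  rewrite /xi_minus /series_neg /x_neg !exprS !(commZl, commZr, acommZl, acommZr) !scalerA.
  set p := (-1) ^+ m; set q := (-1) ^+ n.
  have -> : -1 * p * (-1 * q) = p * q by ring.
  have -> : p * (-1 * (-1 * q)) = p * q by ring.
  by rewrite -scalerBr rel scalerA; congr (_ *: _); ring.
rewrite -pshift_acommr; apply: funext => -[|n]; rewrite comm_pconstE pserZE /=.
  by rewrite /eta /series_neg expr0 scale1r comm1r scaler0.
have := telescope_comm rel' n.
rewrite [comm (eta 0%N) _]commC {2}/eta /series_neg expr0 scale1r comm1r oppr0 subr0.
by rewrite x_neg0 commNr -commC.
Qed.

Lemma comm_x0_eta : comm x0 eta = - d *: acomm eta xneg.
Proof. exact: comm_eta_neg xi_plus_x. Qed.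
Lemma comm_F0_eta : comm F0 eta = - d *: acomm eta F.
Proof.
rewrite raddfN commNl (comm_eta_neg xi_plus_y) opprK.
by rewrite scaleNr.
Qed.

(** Every coefficient of [x^+(u), x^-(-u)] is a combination of the commuting elements xi_r. *)
Lemma comm_X_F_eta : comm (comm X F) eta = 0.
Proof.
apply/comm_eq0/pser_comm => m n; rewrite comm_coefE; apply: commr_sym.
apply: commr_sum => k _; apply/commr_sym/commr_scale.
case: (nat_of_ord k) => [|p]; first by rewrite comm0l; apply/commr_sym/commr0.
case: (m - p.+1)%N => [|q]; first by rewrite comm0r; apply/commr_sym/commr0.
rewrite commZr (ys_xy str); apply/commr_sym/commr_scale.
case: n => [|n] /=; first exact/commr_sym/commr1.
by apply/eqP; rewrite -subr_eq0; apply/eqP/(ys_xixi str).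
Qed.

Lemma comm_Xi_eta : comm cXi eta = 0.
Proof.
apply: funext => n; rewrite comm_pconstE commZr.
by case: n => [|n] /=; rewrite ?comm1r ?(ys_Xixi str) scaler0.
Qed.

(** If ad a shifts the modes of f up to the factor e, then f(u) is a geometric series in u^-1 e^-1
    ad a for e nonzero; this is its functional equation, cleared of the denominator. *)
Lemma pshift_comm_geometric (a : A) (e : K) (f : nat -> A) :
  (forall s, comm a (f s) = e *: f s.+1) ->
  pshift (comm (pconst a) (pshift f)) = e *: (pshift f - pshift (pconst (f 0%N))).
Proof.
move=> fS; apply: funext => -[|[|n]]; rewrite pserZE pserBE /=.
- by rewrite subrr scaler0.
- by rewrite comm_pconstE comm0r subrr scaler0.
by rewrite comm_pconstE fS subr0.
Qed.

Lemma pshift_Xi_X : pshift (comm cXi X) = X - pshift x0.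
Proof.
rewrite (pshift_comm_geometric (e := 1)) ?scale1r // => s.
by rewrite (ys_Xix str) scale1r.
Qed.
Lemma pshift_Xi_F : pshift (comm cXi F) = F - pshift F0.
Proof.
rewrite (pshift_comm_geometric (e := 1)) ?scale1r ?x_neg0 // => s.
by rewrite /x_neg commZr (ys_Xiy str) [in RHS]exprS mulN1r !scaleNr scale1r scalerN.
Qed.
Lemma pshift_Xi_xneg : pshift (comm cXi xneg) = - (xneg + pshift x0).
Proof.
rewrite (pshift_comm_geometric (e := -1)) ?scaleN1r ?x_neg0 //.
  by rewrite !raddfN /= opprK.
by move=> s; rewrite /x_neg commZr (ys_Xix str) scaleN1r [in RHS]exprS mulN1r scaleNr opprK.
Qed.

Definition half_acomm : pser A := 2^-1 *: acomm X eta.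
Local Notation E := half_acomm.
Local Notation q0 := (comm x0 eta).

Lemma xi_plus_eta : GRing.comm xi_plus eta.
Proof.
apply: pser_comm => m n; apply: commr_scale.
case: m n => [|m] [|n] /=; try exact: commr1; first exact/commr_sym/commr1.
by apply/eqP; rewrite -subr_eq0; apply/eqP/(ys_xixi str).
Qed.

(** The derivation ad F0 acts on both factors of E. From eta it yields -(d/2) {X, {eta, F}}, which
    equals -d {E, F} by [acomm_assoc] and [comm_X_F_eta]; from X it yields half of {xi(u) - 1,
    eta}. *)
Lemma comm_F0_E : comm F0 E + d *: acomm E F = xi_plus * eta - eta.
Proof.
rewrite commZr comm_acomm comm_F0_X comm_F0_eta acommZr acommZl scalerA mulrC -scalerA.
rewrite -scalerDr -addrA scaleNr.
have -> : acomm X (acomm eta F) = acomm (acomm X eta) F.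
  by apply/eqP; rewrite -subr_eq0 acomm_assoc comm_X_F_eta.
rewrite addNr addr0 acommC acommBr acomm1r acommC /acomm -xi_plus_eta.
by rewrite -mulr2n -mulrnBl mulr2n half_scaleD.
Qed.

Lemma comm_F0_x0 : comm F0 x0 = xi0.
Proof. by rewrite comm_pconst commNl -commC (ys_xy str). Qed.
Lemma comm_xi0_eta : comm xi0 eta = 0.
Proof.
apply: funext => n; rewrite comm_pconstE commZr.
by case: n => [|n] /=; rewrite ?comm1r ?(ys_xixi str) scaler0.
Qed.
Lemma comm_xi0_F : comm xi0 F = - (d *+ 2) *: F.
Proof.
apply: comm_pconst_pshift; first by rewrite pserZE scaler0.
by move=> n; rewrite commZr (ys_xi0y str) pserZE /= !scalerA mulrC.
Qed.

(** [F0, x_0] = xi_0 commutes with eta, so ad F0 passes to eta and gives -d [x_0, {eta, F}]. The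
    bracket [x_0, F] = eta - 1 is the origin of the right-hand side. *)
Lemma comm_F0_q0 : comm F0 q0 + d *: acomm q0 F = - (d *+ 2) *: (eta * eta - eta).
Proof.
rewrite comm_jacobi comm_F0_x0 comm_xi0_eta add0r comm_F0_eta commZr comm_acomm.
rewrite comm_x0_F scaleNr scalerDr opprD addrAC addNr add0r -mulNrn -scalerMnl scaleNr.
by rewrite acommBr acomm1r /acomm -mulr2n -mulrnBl -scalerMnr mulNrn.
Qed.

Lemma pshift_Xi_E : pshift (comm cXi E) = E - 2^-1 *: pshift (acomm x0 eta).
Proof.
rewrite commZr pshiftZ comm_acomm comm_Xi_eta [acomm X 0]/acomm mulr0 mul0r !addr0.
rewrite [in LHS]pshift_acomml pshift_Xi_X acommC acommBr acommC scalerBr.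
by rewrite -pshift_acommr [acomm eta x0]acommC.
Qed.

(** By [comm_x0_eta], q0 is a multiple of {eta, x^+(-u)}, and x^+(-u) has eigenvalue -1 up to its
    source, where x^+(u) has 1. In [Cpart] the factor b(u)^2, of eigenvalue 2, restores the value
    1. *)
Lemma pshift_Xi_q0 : pshift (comm cXi q0) = - q0 + d *: pshift (acomm x0 eta).
Proof.
rewrite comm_x0_eta commZr pshiftZ comm_acomm comm_Xi_eta [acomm 0 _]/acomm mulr0 mul0r.
rewrite !add0r [in LHS]pshift_acommr pshift_Xi_xneg acommNr acommDr -[acomm eta (pshift x0)]pshift_acommr.
by rewrite [acomm eta x0]acommC scalerN !scaleNr !opprK scalerDr.
Qed.

End String.

(** In this and the following identities the summands are variables, so that [AC] permutes atoms and
    not long products of series. *)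
Lemma cancel_common_terms (V : zmodType) (u v p q r s : V) :
  u + v + (p + (q + r + s)) - (p + (u + q)) = v + r + s.
Proof.
rewrite !opprD [LHS](AC ((2*(1*(2*1)))*(1*2)) ((2*5*6)*((1*8)*((3*7)*(4*9))))) /=.
by rewrite !subrr !addr0.
Qed.

Lemma split_source_terms (V : zmodType) (u v p q r s : V) :
  u + (v + p) + (q + r) = v + s + u + (p + (q - s + r)).
Proof. by rewrite [RHS](AC (3*(1*(2*1))) (3*(1*4)*(5*7)*(2*6))) /= subrr addr0. Qed.

Lemma cancel_degree0 (V : zmodType) (u v w t e o : V) :
  u - (e + v + t) - (w - t) + (o + (e - o + v) + w) = u.
Proof.
rewrite !opprD opprK.
rewrite [LHS](AC ((1*3*2)*((1*3)*1)) (1*((2*8)*(3*10))*((4*6)*(5*11)*(7*9)))) /=.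
by rewrite !addNr subrr !addr0.
Qed.

Lemma cancel_main_terms (V : zmodType) (o f v c p r q s t f' v' c' p' w z : V) :
  f + f' = 0 -> v + v' = 0 ->
  o + (f + v + c + (p + r) + (q + s) + t) + (f' + v' + c' + p' + w + z) -
    (o + c + q + p + c' + p') = r + s + t + (w + z).
Proof.
move=> ff vv; rewrite !opprD.
rewrite [LHS](AC (1*((3*2)*2*1)*6*6)
  ((6*8*9)*(14*15)*((2*10)*(3*11)*(1*16)*(4*17)*(7*18)*(5*19)*(12*20)*(13*21)))) /=.
by rewrite ff vv !subrr !addr0.
Qed.

Lemma drop_high_terms (V : zmodType) (u v w p q : V) :
  u - (v + w) = u - (w + (v + p) + q) + p + q.
Proof.
rewrite !opprD [RHS](AC ((1*((1*2)*1))*1*1) ((1*(3*2))*(4*6)*(5*7))) /=.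
by rewrite !addNr !addr0.
Qed.

(** * The recursion for the currents *)

Section CurrentSeries.
Variables (K : numFieldType) (A : algType K) (I : finType).
Implicit Types (al k l : rlattice I) (f g : pser A).
Variable G : rlattice I -> A -> Prop.
Hypothesis GM : forall k l x y, G k x -> G l y -> G (k + l) (x * y).
Variables (i : I) (d : K) (x y xi : nat -> A) (Xi : A).
Hypothesis str : yangian_string d x y xi Xi.

Variables first second : A -> Prop.
Hypotheses (first_sub : subalgebra first) (second_sub : subalgebra second).
Hypothesis cross : forall a z, first a -> second z -> GRing.comm a z.
Hypothesis first_deg : forall a, first a -> G 0 a.
Hypotheses (second_x : forall s, second (x s)) (second_y : forall s, second (y s)).
Hypotheses (second_xi : forall s, second (xi s)) (second_Xi : second Xi).
Hypotheses (x_deg : forall s, G (rdelta i) (x s)) (y_deg : forall s, G (- rdelta i) (y s)).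
Hypothesis xi_deg : forall s, G 0 (xi s).
Hypothesis Xi_deg : G 0 Xi.

Variables (H : A) (b : nat -> A) (roots : seq (rlattice I)) (B X : rlattice I -> A).
Hypotheses (first_H : first H) (first_b : forall s, first (b s)).
Hypothesis first_B : forall al, al \in roots -> first (B al).
Hypothesis second_X : forall al, al \in roots -> second (X al).
Hypothesis X_deg : forall al, al \in roots -> G al (X al).
Hypothesis H_b : forall s, comm H (b s) = 2 *: b s.+1.
Hypothesis roots_pos : forall al, al \in roots -> Qplus al.
Hypothesis roots_uniq : uniq roots.
Hypotheses (i_root : rdelta i \in roots) (B_i : B (rdelta i) = b 0%N) (X_i : X (rdelta i) = x 0%N).
Hypothesis X_double : rdelta i + rdelta i \in roots -> X (rdelta i + rdelta i) = 0.
Hypothesis X_y_y : forall al s, al \in roots -> al i = 1 -> al != rdelta i ->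
  comm (comm (X al) (y 0%N)) (y s) = 0.
Hypothesis Xi_X_y : forall al s, al \in roots -> al i = 1 ->
  comm Xi (comm (X al) (y s)) = 0.

Local Notation ai := (rdelta i).
Local Notation eta := (xi_minus xi).
Local Notation F := (pshift (x_neg y)).
Local Notation F0 := (pconst (- y 0%N)).
Local Notation x0 := (pconst (x 0%N)).
Local Notation E := (half_acomm x xi).
Local Notation q0 := (comm x0 eta).
Local Notation bS := (pshift (b : pser A)).
Local Notation b0 := (pconst (b 0%N)).

Definition h_of_b : pser A := 1 + comm b0 bS + d *: (bS * bS).
Local Notation h := h_of_b.
Hypothesis H_h : forall n, comm H (h n) = 0.

(* sum_s (1/2 ad H)^s (B al) u^(-s-1) *)
Definition beta al : pser A := pshift (fun s => iter s (fun z => 2^-1 *: comm H z) (B al)).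
(** It has degree al - alpha_i. If al contains alpha_i once, this degree is free of alpha_i and the
    series commutes with Xi; for al = alpha_i it is eta - 1. *)
Definition Zroot al : pser A := comm (pconst (X al)) F.
(* Modulo alpha_i + Q_+, the current to be computed is F + Vpart + Cpart. *)
Definition Vpart : pser A := bS + \sum_(al <- roots | al i == 1) beta al * Zroot al.
(** The component of degree alpha_i. As h is killed by [Lop], the first term inherits the equation
    of E, with source half of h {x_0, eta}; the second term corrects this source to the one in
    [C_source]. For b = 0 only E remains. *)
Definition Cpart : pser A := h * E + 2^-1 *: (bS * bS * q0).

Lemma eta_second : coef_in second eta.
Proof.
by case=> [|n]; apply: (subalgebraZ second_sub); [exact: subalgebra1 | exact: second_xi].
Qed.
Lemma F_second : coef_in second F.
Proof. by apply: coef_in_pshift => // n; apply: (subalgebraZ second_sub). Qed.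
Lemma const_second z : second z -> coef_in second (pconst z).
Proof. exact: coef_in_pconst. Qed.
Lemma E_second : coef_in second E.
Proof.
apply: coef_inZ => //; apply: coef_in_acomm => //; last exact: eta_second.
exact: coef_in_pshift.
Qed.
Lemma q0_second : coef_in second q0.
Proof. by apply: coef_in_comm => //; [exact: const_second | exact: eta_second]. Qed.
Lemma Z_second al : al \in roots -> coef_in second (Zroot al).
Proof.
by move=> /second_X alX; apply: coef_in_comm => //; [exact: const_second | exact: F_second].
Qed.
Lemma const_first a : first a -> coef_in first (pconst a).
Proof. exact: coef_in_pconst. Qed.
Lemma bS_first : coef_in first bS. Proof. exact: coef_in_pshift. Qed.
Lemma beta_first al : al \in roots -> coef_in first (beta al).
Proof.
move=> alR; apply: coef_in_pshift => // s; elim: s => [|s IH] /=; first exact: first_B.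
by apply: subalgebraZ => //; apply: subalgebra_comm.
Qed.
Lemma h_first : coef_in first h.
Proof.
have bF := bS_first; have b0F := const_first (first_b 0).
apply: coef_inD => //; last by apply: coef_inZ => //; apply: coef_inM.
by apply: coef_inD => //; [exact: coef_in1 | exact: coef_in_comm].
Qed.
Lemma series_cross (f g : pser A) : coef_in first f -> coef_in second g -> GRing.comm f g.
Proof. by move=> fF gS; apply: pser_comm => m n; apply: cross. Qed.
Lemma series_cross0 (f g : pser A) : coef_in first f -> coef_in second g -> comm f g = 0.
Proof. by move=> fF gS; apply/comm_eq0/series_cross. Qed.

(* [Lop] is u^-1 times the derivation 1/2 ad (H + 2 Xi). *)
Definition Lop (f : pser A) : pser A := pshift (2^-1 *: comm (pconst (H + 2 *: Xi)) f).

Lemma LD f g : Lop (f + g) = Lop f + Lop g.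
Proof. by rewrite /Lop commDr scalerDr pshiftD. Qed.
Lemma LZ c f : Lop (c *: f) = c *: Lop f.
Proof. by rewrite /Lop commZr -pshiftZ !scalerA mulrC. Qed.
Lemma L_sum (J : Type) (s : seq J) (P : pred J) (f : J -> pser A) :
  Lop (\sum_(j <- s | P j) f j) = \sum_(j <- s | P j) Lop (f j).
Proof. by rewrite /Lop comm_sumr scaler_sumr raddf_sum. Qed.
Lemma LM f g : Lop (f * g) = Lop f * g + f * Lop g.
Proof. by rewrite /Lop commMr scalerDr pshiftD scalerAl scalerAr pshiftMl pshiftMr. Qed.

Lemma L_second g : coef_in second g -> Lop g = pshift (comm (pconst Xi) g).
Proof.
move=> gS; rewrite /Lop pconstD commDl (series_cross0 (const_first first_H) gS) add0r.
by rewrite pconstZ commZl scalerA mulVf ?pnatr_eq0 // scale1r.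
Qed.
Lemma L_first f : coef_in first f -> Lop f = 2^-1 *: pshift (comm (pconst H) f).
Proof.
move=> fF; rewrite /Lop pconstD commDl pconstZ commZl.
by rewrite [comm (pconst Xi) f]commC (series_cross0 fF (const_second second_Xi)) oppr0 scaler0 addr0 pshiftZ.
Qed.

Lemma L_bS : Lop bS = bS - pshift b0.
Proof.
rewrite (L_first bS_first) (pshift_comm_geometric (e := 2)) //.
by rewrite scalerA mulVf ?pnatr_eq0 // scale1r.
Qed.
Lemma L_h : Lop h = 0.
Proof.
rewrite (L_first h_first); suff -> : comm (pconst H) h = 0 by rewrite pshift0 scaler0.
by apply: funext => n; rewrite comm_pconstE H_h.
Qed.
Lemma L_beta al : al \in roots -> Lop (beta al) = beta al - pshift (pconst (B al)).
Proof.
move=> alR; rewrite (L_first (beta_first alR)) (pshift_comm_geometric (e := 2)) => [|s].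
  by rewrite scalerA mulVf ?pnatr_eq0 // scale1r.
by rewrite /= scalerA mulfV ?pnatr_eq0 // scale1r.
Qed.
Lemma L_F : Lop F = F - pshift F0.
Proof. by rewrite (L_second F_second) (pshift_Xi_F str). Qed.
Lemma L_Z al : al \in roots -> al i = 1 -> Lop (Zroot al) = 0.
Proof.
move=> alR ali; rewrite (L_second (Z_second alR)).
suff -> : comm (pconst Xi) (Zroot al) = 0 by rewrite pshift0.
apply: funext => n; rewrite comm_pconstE /Zroot comm_pconstE.
by case: n => [|n] /=; rewrite ?comm0r // !commZr Xi_X_y // scaler0.
Qed.
Lemma L_E : Lop E = E - 2^-1 *: pshift (acomm x0 eta).
Proof. by rewrite (L_second E_second) (pshift_Xi_E str). Qed.
Lemma L_q0 : Lop q0 = - q0 + d *: pshift (acomm x0 eta).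
Proof. by rewrite (L_second q0_second) (pshift_Xi_q0 str). Qed.

(** [Lop] kills each [Zroot al] involved, and [beta al] is made to have source B_al. The sources are
    thus the brackets [B_al X_al, F] that the root terms of [Htotal] supply. *)
Lemma L_V : Lop Vpart = Vpart - pshift (b0 + \sum_(al <- roots | al i == 1) pconst (B al) * Zroot al).
Proof.
rewrite /Vpart LD L_bS L_sum pshiftD opprD addrACA; congr (_ + _).
rewrite raddf_sum /= -sumrN -big_split /= big_seq_cond [RHS]big_seq_cond.
apply: eq_bigr => al /andP[alR /eqP ali].
by rewrite LM (L_beta alR) (L_Z alR ali) mulr0 addr0 mulrBl [in RHS]pshiftMl.
Qed.

(** Twice [b_0 x_0, b(u) eta] is [b_0, b(u)] {x_0, eta} + {b_0, b(u)} [x_0, eta] by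
    [comm_acomm_cross], and [b_0, b(u)] = h - 1 - d b(u)^2. *)
Lemma C_source : 2^-1 *: acomm x0 eta + comm (b0 * x0) (bS * eta) =
  2^-1 *: (h * acomm x0 eta + acomm b0 bS * q0 - d *: (bS * bS * acomm x0 eta)).
Proof.
have b0F := const_first (first_b 0); have x0S := const_second (second_x 0).
rewrite comm_mul_cross; first last.
- exact: series_cross bS_first x0S.
- exact: series_cross b0F eta_second.
rewrite /h_of_b [(1 + _ + _) * _]mulrDl [(1 + _) * _]mulrDl mul1r -scalerAl [X in _ = _ *: X](_ : _ =
  acomm x0 eta + (comm b0 bS * acomm x0 eta + acomm b0 bS * q0)); last first.
  by rewrite [LHS](AC (3*1*1) ((1*(2*4))*(3*5))) /= subrr addr0.
by rewrite [in RHS]scalerDr comm_acomm_cross half_scaleD.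
Qed.

Lemma pshift_square (f g q : pser A) : ((f - pshift g) * f + f * (f - pshift g)) * q =
  f * f * q + f * f * q - pshift (acomm g f * q).
Proof.
by rewrite mulrBl mulrBr addrACA -opprD -pshiftMl -pshiftMr -pshiftD mulrBl mulrDl -pshiftMl.
Qed.

Lemma L_C : Lop Cpart = Cpart - pshift (2^-1 *: acomm x0 eta + comm (b0 * x0) (bS * eta)).
Proof.
have L_hE : h * (E - 2^-1 *: pshift (acomm x0 eta)) =
    h * E - 2^-1 *: pshift (h * acomm x0 eta).
  by rewrite mulrBr -[h * (_ *: pshift _)]scalerAr -pshiftMr.
have L_bb : ((bS - pshift b0) * bS + bS * (bS - pshift b0)) * q0 =
    bS * bS * q0 + bS * bS * q0 - pshift (acomm b0 bS * q0).
  exact: pshift_square.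
have L_bbq : bS * bS * (- q0 + d *: pshift (acomm x0 eta)) =
    - (bS * bS * q0) + d *: pshift (bS * bS * acomm x0 eta).
  by rewrite mulrDr mulrN -[bS * bS * (_ *: _)]scalerAr -[bS * bS * pshift _]pshiftMr.
rewrite C_source /Cpart LD LZ !LM L_h mul0r add0r L_E L_bS L_q0 L_hE L_bb L_bbq.
rewrite [X in _ + 2^-1 *: X](_ : _ = bS * bS * q0 -
  (pshift (acomm b0 bS * q0) - d *: pshift (bS * bS * acomm x0 eta))); last first.
  by rewrite [LHS](AC (3*2) ((1*(3*5))*(2*4))) /= subrr addr0 opprB [- _ + _]addrC.
rewrite scalerBr addrACA -opprD -scalerDr [in RHS]pshiftZ.
by congr (_ - _ *: _); rewrite !pshiftD pshiftN pshiftZ addrA.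
Qed.

Definition Qnonneg (k : rlattice I) : Prop := forall j, 0 <= k j.
Local Notation Qp := (@Qplus I).
Local Notation Ni := (shift_set Qp ai).
Local Notation sg := (sgspan G).

Definition Jpart : pser A := \sum_(al <- roots | (al i == 1) && (al != ai)) beta al * Zroot al.

Lemma beta_i : beta ai = bS.
Proof.
rewrite /beta; congr pshift; apply: funext; elim=> [|s IH] /=; first exact: B_i.
by rewrite IH H_b scalerA mulVf ?pnatr_eq0 // scale1r.
Qed.
Lemma Z_i : Zroot ai = eta - 1.
Proof. by rewrite /Zroot X_i (comm_x0_F str). Qed.

(** The summand of alpha_i is b(u) (eta - 1), which merges with the separate term b(u). *)
Lemma V_split : Vpart = bS * eta + Jpart.
Proof.
have ii : ai i == 1 by rewrite ffunE eqxx.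
rewrite /Vpart big_mkcond (bigD1_seq ai) //= ii beta_i Z_i -big_mkcondr /= addrA.
rewrite mulrBr mulr1 [bS + _]addrC subrK /Jpart; congr (_ + _).
by apply: eq_bigl => al; rewrite andbC.
Qed.

Lemma Qplus_ge0 k : Qp k -> Qnonneg k. Proof. by case. Qed.
Lemma Qplus_addl k l : Qnonneg k -> Qp l -> Qp (k + l).
Proof.
move=> k0 [l0 lpos]; split=> [j|]; first by rewrite ffunE addr_ge0.
by rewrite sum_latD ltr_wpDl ?sumr_ge0.
Qed.
Lemma Qplus_addr k l : Qp k -> Qnonneg l -> Qp (k + l).
Proof. by move=> kQ lQ; rewrite addrC; apply: Qplus_addl. Qed.
Lemma Ni_addl k l : Qnonneg k -> Ni l -> Ni (k + l).
Proof. by move=> kQ lN; rewrite /shift_set -addrA; apply: Qplus_addl. Qed.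
Lemma Ni_addr k l : Ni k -> Qnonneg l -> Ni (k + l).
Proof. by move=> kQ lN; rewrite addrC; apply: Ni_addl. Qed.
Lemma delta_ge0 : Qnonneg ai. Proof. exact: (Qplus_delta i).1. Qed.
Lemma Ni_Qplus k : Ni k -> Qp k.
Proof. by move=> kN; rewrite -[k](subrK ai); apply: Qplus_addr kN delta_ge0. Qed.
Lemma Ni_delta k : Qp k -> Ni (ai + k). Proof. by rewrite /shift_set addrC addKr. Qed.

Lemma eta_deg : sg (eq 0) eta.
Proof.
case=> [|n]; apply: lspanZ; apply: (gspan_gen (k := 0)) => //=.
exact/first_deg/(subalgebra1 first_sub).
Qed.
Lemma F_deg : sg (eq (- ai)) F.
Proof. by apply: sgspan_pshift => n; apply/lspanZ/(gspan_gen (k := - ai)). Qed.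
Lemma first_sdeg f : coef_in first f -> sg (eq 0) f.
Proof. by move=> fF n; apply: (gspan_gen (k := 0)) (first_deg (fF n)). Qed.
Lemma Z_deg al : al \in roots -> sg (eq (al - ai)) (Zroot al).
Proof.
move=> alR; apply: sgspan_comm GM (eq al) _ _ _ _ _ _ F_deg => [k l <- <- //|].
by apply/sgspan_pconst/(gspan_gen (k := al)) => //; apply: X_deg.
Qed.
Lemma root_sub_delta al : al \in roots -> 0 < al i -> al != ai -> Qp (al - ai).
Proof.
move=> /roots_pos[al0 _] ali al_ai; apply: Qplus_neq0 => [j|]; last by rewrite subr_eq0.
by rewrite !ffunE; case: eqP => [<-|_]; rewrite ?subr0 ?subr_ge0 ?gtz0_ge1.
Qed.

Lemma J_deg : sg Qp Jpart.
Proof.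
rewrite /Jpart big_seq_cond; apply: sgspan_sum => al /andP[alR /andP[/eqP ali al_ai]].
apply: (sgspanM GM _ (first_sdeg (beta_first alR)) (Z_deg alR)) => k l <- <-.
by rewrite add0r; apply: root_sub_delta; rewrite // ali.
Qed.

Lemma V_deg : sg Qnonneg Vpart.
Proof.
rewrite V_split; apply: sgspanD; last exact: sgspan_sub Qplus_ge0 J_deg.
apply: (sgspanM GM _ (first_sdeg bS_first) eta_deg) => k l <- <-.
by rewrite addr0 => j; rewrite ffunE.
Qed.
Lemma x_sdeg : sg (eq ai) x0.
Proof. by apply/sgspan_pconst/(gspan_gen (k := ai)). Qed.
Lemma C_deg : sg (eq ai) Cpart.
Proof.
have xS : sg (eq ai) (pshift (x : pser A)).
  by apply: sgspan_pshift => n; apply: (gspan_gen (k := ai)).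
have E0 k l : ai = k -> 0 = l -> ai = k + l by move=> <- <-; rewrite addr0.
have E1 k l : 0 = k -> ai = l -> ai = k + l by move=> <- <-; rewrite add0r.
apply: sgspanD.
  apply: (sgspanM GM E1 (first_sdeg h_first)); apply: sgspanZ.
  exact: (sgspan_acomm GM E0 xS eta_deg).
apply: sgspanZ; apply: (sgspanM GM E1 (T := eq ai)).
  by apply: (sgspanM GM _ (first_sdeg bS_first) (first_sdeg bS_first)) => k l <- <-; rewrite addr0.
exact: (sgspan_comm GM E0 x_sdeg eta_deg).
Qed.

Definition Bapprox : pser A := F + Vpart + Cpart.
Definition root_const (al : rlattice I) : pser A :=
  pconst ((al i)%:~R *: (X al * X al + 2 *: (B al * X al))).
Definition simple_term : pser A :=
  2^-1 *: acomm x0 eta - x0 + comm (b0 * x0) (bS * eta).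

Lemma root_constE al f : 2^-1 *: comm (root_const al) f =
  ((al i)%:~R / 2) *: comm (pconst (X al) * pconst (X al)) f +
  (al i)%:~R *: comm (pconst (B al) * pconst (X al)) f.
Proof.
rewrite /root_const pconstZ commZl pconstD commDl !pconstM pconstZ commZl pconstM.
by rewrite [in LHS]scalerA [in LHS]scalerDr [in LHS]scalerA [2^-1 * _]mulrC divfK ?pnatr_eq0.
Qed.

Lemma X_sdeg al : al \in roots -> sg (eq al) (pconst (X al)).
Proof. by move=> alR; apply/sgspan_pconst/(gspan_gen (k := al)) => //; apply: X_deg. Qed.
Lemma XX_sdeg al : al \in roots -> sg (eq (al + al)) (pconst (X al) * pconst (X al)).
Proof. by move=> alR; apply: (sgspanM GM _ (X_sdeg alR) (X_sdeg alR)) => k l <- <-. Qed.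
Lemma BX_sdeg al : al \in roots -> sg (eq al) (pconst (B al) * pconst (X al)).
Proof.
move=> alR; apply: (sgspanM GM _ (first_sdeg (const_first (first_B alR))) (X_sdeg alR)).
by move=> k l <- <-; rewrite add0r.
Qed.
Lemma comm_BX_F al : al \in roots ->
  comm (pconst (B al) * pconst (X al)) F = pconst (B al) * Zroot al.
Proof.
move=> alR; rewrite commMl (series_cross0 (const_first (first_B alR)) F_second).
by rewrite mul0r addr0.
Qed.

Lemma delta_sub_ge0 al : al \in roots -> 0 < al i -> Qnonneg (al - ai).
Proof.
move=> alR ali; have [->|ne] := eqVneq al ai; last exact: (root_sub_delta alR ali ne).1.
by rewrite subrr => j; rewrite ffunE.
Qed.
Lemma C_ge0 : sg Qnonneg Cpart. Proof. by apply: sgspan_sub C_deg => k <-; apply: delta_ge0. Qed.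

Lemma comm_XX_VC al : al \in roots -> 0 < al i ->
  sg Ni (comm (pconst (X al) * pconst (X al)) (Vpart + Cpart)).
Proof.
move=> alR ali; apply: (sgspan_comm GM _ (XX_sdeg alR) (sgspanD V_deg C_ge0)) => k l <- l0.
apply: Ni_addr l0; rewrite /shift_set -addrA; apply: Qplus_addr (roots_pos alR) _.
exact: delta_sub_ge0.
Qed.
Lemma comm_BX_C al : al \in roots -> sg Ni (comm (pconst (B al) * pconst (X al)) Cpart).
Proof.
move=> alR; apply: (sgspan_comm GM _ (BX_sdeg alR) C_deg) => k l <- <-.
by rewrite /shift_set addrK; apply: roots_pos.
Qed.
Lemma comm_XX_F al : al \in roots -> 0 < al i -> al != ai ->
  sg Ni (comm (pconst (X al) * pconst (X al)) F).
Proof.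
move=> alR ali ne; apply: (sgspan_comm GM _ (XX_sdeg alR) F_deg) => k l <- <-.
rewrite /shift_set -addrA -addrA [al + (- ai - ai)]addrA addrCA.
have P := root_sub_delta alR ali ne; exact: Qplus_addr P (Qplus_ge0 P).
Qed.
Lemma comm_BX_V al : al \in roots -> 0 < al i -> al != ai ->
  sg Ni (comm (pconst (B al) * pconst (X al)) Vpart).
Proof.
move=> alR ali ne; apply: (sgspan_comm GM _ (BX_sdeg alR) V_deg) => k l <- l0.
by apply: Ni_addr l0; apply: root_sub_delta.
Qed.
(** The degree is al - alpha_i, and al - 2 alpha_i lies in Q_+ unless al = 2 alpha_i, in which case
    X_al = 0. *)
Lemma BZ_high al : al \in roots -> 1 < al i -> sg Ni (pconst (B al) * Zroot al).
Proof.
move=> alR ali; have [al2|ne] := eqVneq al (ai + ai).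
  have -> : Zroot al = 0.
    rewrite /Zroot al2 X_double -?al2 //; apply/comm_eq0.
    by rewrite raddf0; apply/commr_sym/commr0.
  by rewrite mulr0; apply: sgspan0.
apply: (sgspanM GM _ (first_sdeg (const_first (first_B alR))) (Z_deg alR)) => k l <- <-.
rewrite add0r; apply: Qplus_neq0 => [j|]; last by rewrite -addrA -opprD subr_eq0.
rewrite !ffunE -addrA -opprD subr_ge0; case: eqP => [<-|_]; first by rewrite lez1D.
exact: (roots_pos alR).1.
Qed.

(** The contribution of al to half of [Htotal, Bapprox] modulo alpha_i + Q_+. Brackets with X_al^2
    and brackets of B_al X_al with [Vpart] leave a trace for al = alpha_i only, which is
    [simple_term]. *)
Definition root_value (al : rlattice I) : pser A :=
  (if al i == 1 then pconst (B al) * Zroot al else 0) + (if al == ai then simple_term else 0).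

Lemma comm_x0x0_F : 2^-1 *: comm (x0 * x0) F = 2^-1 *: acomm x0 eta - x0.
Proof.
rewrite commMl (comm_x0_F str) -/(acomm x0 (eta - 1)) acommBr acomm1r mulr2n scalerBr.
by rewrite half_scaleD.
Qed.

Lemma root_term al : al \in roots ->
  sg Ni (2^-1 *: comm (root_const al) Bapprox - root_value al).
Proof.
move=> alR; rewrite root_constE /root_value.
have : 0 <= al i by exact: (roots_pos alR).1.
rewrite le_eqVlt => /orP[/eqP ali|ali].
  have ne : (al == ai) = false.
    by apply/negP => /eqP e; move: ali; rewrite e ffunE eqxx.
  by rewrite -ali ne mul0r !scale0r !addr0 subrr; apply: sgspan0.
have XXVC := comm_XX_VC alR ali; have BXC := comm_BX_C alR.
have BapE : Bapprox = F + (Vpart + Cpart) by exact: (esym (addrA _ _ _)).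
have XXE : comm (pconst (X al) * pconst (X al)) Bapprox =
    comm (pconst (X al) * pconst (X al)) F + comm (pconst (X al) * pconst (X al)) (Vpart + Cpart).
  by rewrite BapE; apply: commDr.
have BXE : comm (pconst (B al) * pconst (X al)) Bapprox = pconst (B al) * Zroot al +
    (comm (pconst (B al) * pconst (X al)) Vpart + comm (pconst (B al) * pconst (X al)) Cpart).
  rewrite BapE [LHS]commDr comm_BX_F //; congr (_ + _); exact: commDr.
have [e|ne] := eqVneq al ai.
  have ii : ai i = 1 by rewrite ffunE eqxx.
  rewrite e in XXVC BXC *; rewrite ii eqxx div1r scale1r.
  have BXJ : sg Ni (comm (b0 * x0) Jpart).
    rewrite -B_i -X_i; apply: (sgspan_comm GM _ (BX_sdeg i_root) J_deg) => k l <-.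
    exact: Ni_delta.
  have BXV : comm (pconst (B ai) * pconst (X ai)) Vpart =
      comm (b0 * x0) (bS * eta) + comm (b0 * x0) Jpart.
    by rewrite B_i X_i V_split; apply: commDr.
  rewrite e in XXE BXE; rewrite XXE BXE BXV scalerDr X_i comm_x0x0_F -X_i /simple_term.
  rewrite [X in sg _ X](_ : _ = 2^-1 *: comm (pconst (X ai) * pconst (X ai)) (Vpart + Cpart) +
      comm (b0 * x0) Jpart + comm (pconst (B ai) * pconst (X ai)) Cpart).
    by apply: sgspanD => //; apply: sgspanD => //; apply: sgspanZ.
  rewrite X_i.
  exact: cancel_common_terms.
rewrite addr0; have BXV := comm_BX_V alR ali ne; have XXF := comm_XX_F alR ali ne.
rewrite XXE BXE.
have XX : sg Ni (((al i)%:~R / 2) *: (comm (pconst (X al) * pconst (X al)) F +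
    comm (pconst (X al) * pconst (X al)) (Vpart + Cpart))).
  exact/sgspanZ/sgspanD.
case: eqP => [ali1|ali1].
  rewrite ali1 scale1r -addrA [X in _ + X](_ : _ =
    comm (pconst (B al) * pconst (X al)) Vpart + comm (pconst (B al) * pconst (X al)) Cpart).
    by rewrite ali1 in XX; apply: sgspanD XX _; apply: sgspanD.
  by rewrite addrAC subrr add0r.
have BZ : sg Ni (pconst (B al) * Zroot al).
  by apply: BZ_high => //; rewrite lt_def -gtz0_ge1 ali andbT; apply/eqP.
by rewrite subr0; apply: sgspanD XX _; apply: sgspanZ; apply: sgspanD BZ _; apply: sgspanD.
Qed.

Variable bb : nat -> A.
(** The common shape of the images of sum_j c_j h_{j,1} in Y ([phi_hl], where H and all B_al are 0)
    and in Y (x) Y ([Delta_hl]). *)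
Definition Htotal : A :=
  H + 2 *: Xi + \sum_(al <- roots) (al i)%:~R *: (X al * X al + 2 *: (B al * X al)).
Hypothesis bb_0 : bb 0%N = b 0%N + x 0%N - y 0%N.
Hypothesis bb_S : forall s, bb s.+1 = 2^-1 *: comm Htotal (bb s).
Local Notation BB := (pshift (bb : pser A)).
Local Notation bb0 := (pconst (bb 0%N)).

(** The sources of the three parts under [Lop] add up to bb_0 plus all root values. The summand x_0
    of bb_0 is accounted for by the -x_0 in [simple_term], which stems from half of [x_0^2, F]. *)
Lemma Htotal_Bapprox : pshift (2^-1 *: comm (pconst Htotal) Bapprox) = Bapprox - pshift bb0 +
  pshift (\sum_(al <- roots) (2^-1 *: comm (root_const al) Bapprox - root_value al)).
Proof.
have sum_roots : pconst Htotal = pconst (H + 2 *: Xi) + \sum_(al <- roots) root_const al.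
  by rewrite pconstD raddf_sum.
have sum_value : \sum_(al <- roots) root_value al =
    \sum_(al <- roots | al i == 1) pconst (B al) * Zroot al + simple_term.
  rewrite big_split /= -big_mkcond; congr (_ + _).
  rewrite (bigD1_seq ai) //= eqxx big1 ?addr0 // => al /negPf ->; by [].
have L_Bap : Lop Bapprox = Bapprox - pshift bb0 - pshift (\sum_(al <- roots) root_value al).
  rewrite {1}/Bapprox LD [Lop (F + Vpart)]LD L_F L_V L_C sum_value bb_0 /Bapprox.
  rewrite [LHS](AC (2*2*2) ((1*3*5)*((2*4)*6))) /= -[in RHS]addrA; congr (_ + _).
  rewrite -!opprD -!pshiftD !pconstD; congr (- pshift _).
  exact: split_source_terms.
rewrite sum_roots commDl scalerDr pshiftD -/(Lop Bapprox) L_Bap comm_suml scaler_sumr.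
by rewrite sumrB [in RHS]pshiftD pshiftN [in RHS]addrA addrAC.
Qed.

Lemma Htotal_deg : gspan G Qnonneg Htotal.
Proof.
have ge0_0 : Qnonneg 0 by move=> j; rewrite ffunE.
have G0 z : G 0 z -> gspan G Qnonneg z by apply: gspan_gen.
apply: lspanD; first by apply: lspanD; [exact/G0/first_deg | exact/lspanZ/G0].
rewrite big_seq; apply: lspan_sum => al alR; apply: lspanZ.
have al0 := (roots_pos alR).1; have Xal := gspan_gen (S := Qnonneg) al0 (X_deg alR).
have GGD k l : Qnonneg k -> Qnonneg l -> Qnonneg (k + l).
  by move=> k0 l0 j; rewrite ffunE addr_ge0.
apply: lspanD; first exact: (gspanM GM GGD Xal Xal).
apply: lspanZ; apply: (gspanM GM GGD _ Xal).
exact/G0/first_deg/first_B.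
Qed.

(* The recursion for the coefficients of [BB] holds for those of [Bapprox] up to Y_{alpha_i + Q_+}. *)
Lemma current_approx : sg Ni (BB - Bapprox).
Proof.
pose R := pshift (\sum_(al <- roots) (2^-1 *: comm (root_const al) Bapprox - root_value al)).
have R_Ni : sg Ni R.
  by apply: sgspan_pshift; rewrite big_seq; apply: sgspan_sum => al /root_term.
have BB_rec : BB = pshift bb0 + pshift (2^-1 *: comm (pconst Htotal) BB).
  apply: funext => -[|[|n]]; rewrite pserDE /=.
  - by rewrite addr0.
  - by rewrite pserZE comm_pconstE comm0r scaler0 addr0.
  by rewrite add0r pserZE comm_pconstE.
have diff : BB - Bapprox = R + pshift (2^-1 *: comm (pconst Htotal) (BB - Bapprox)).
  rewrite [in LHS]BB_rec [in RHS]commBr [in RHS]scalerBr [in RHS]pshiftD pshiftN Htotal_Bapprox -/R.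
  by rewrite !opprD opprK [RHS](AC (1*(1*(2*1))) ((4*2*3)*(1*5))) /= subrr addr0.
(* Because of u^-1, a coefficient of the error depends only on the previous one, through a bracket
   with [Htotal]. All degrees of [Htotal] are nonnegative, so alpha_i + Q_+ is preserved. *)
elim=> [|n IH]; rewrite diff pserDE; apply: lspanD (R_Ni _) _; first exact: lspan0.
rewrite /= pserZE comm_pconstE; apply: lspanZ; apply: lspanB.
  exact: (gspanM GM Ni_addl Htotal_deg IH).
exact: (gspanM GM Ni_addr IH Htotal_deg).
Qed.

(** Apply the derivation ad X_al to [comm_F0_F]. *)
Lemma comm_F0_Z al : comm F0 (Zroot al) + d *: acomm F (Zroot al) =
  - comm (comm (pconst (X al)) F0) F.
Proof.
have := congr1 (comm (pconst (X al))) (comm_F0_F str).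
rewrite comm0r [LHS]commDr comm_jacobi commZr commMr -/(Zroot al) => XF.
by apply/eqP; rewrite -addr_eq0 addrC addrA acommC; apply/eqP.
Qed.

(** For al other than alpha_i the double bracket in [comm_F0_Z] vanishes by [X_y_y]. For alpha_i it
    is a bracket with xi_0 and gives -2d b(u) F, cancelling d {F, b(u)}. *)
Lemma comm_F0_V : comm F0 Vpart + d *: acomm F Vpart = 0.
Proof.
have F0S := const_second (subalgebraN second_sub (second_y 0)).
have commF0_b : comm F0 bS = 0 by rewrite commC (series_cross0 bS_first F0S) oppr0.
have term al : al \in roots -> al i = 1 ->
    comm F0 (beta al * Zroot al) + d *: acomm F (beta al * Zroot al) =
    if al == ai then - (d *+ 2) *: (bS * F) else 0.
  move=> alR ali; have betaF := beta_first alR.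
  rewrite (comm_mull _ (series_cross betaF F0S)) (acomm_mull _ (series_cross betaF F_second)).
  rewrite scalerAr -mulrDr comm_F0_Z; case: eqVneq => [->|ne].
    rewrite beta_i X_i -commNl -[comm x0 F0]opprK -commC (comm_F0_x0 str) opprK.
    by rewrite (comm_xi0_F str) scalerAr.
  suff -> : comm (comm (pconst (X al)) F0) F = 0 by rewrite oppr0 mulr0.
  rewrite comm_pconst; apply: funext => -[|n]; rewrite comm_pconstE ?comm0r //=.
  by rewrite commZr commNr commNl X_y_y // oppr0 scaler0.
rewrite /Vpart commDr commF0_b add0r acommDr comm_sumr acomm_sumr scalerDr addrCA scaler_sumr.
rewrite -big_split /= big_seq_cond.
rewrite (eq_bigr (fun al => if al == ai then - (d *+ 2) *: (bS * F) else 0)); last first.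
  by move=> al /andP[alR /eqP ali]; apply: term.
rewrite -big_seq_cond big_mkcond (bigD1_seq ai) //= ffunE !eqxx big1 ?addr0 => [|al /negPf ->].
  rewrite /acomm -(series_cross bS_first F_second) -mulr2n.
  by rewrite scaleNr -scalerMnl -scalerMnr subrr.
by rewrite if_same.
Qed.

(** By [comm_F0_E] and [comm_F0_q0] the two terms with [Cpart] give h xi(u) eta - h eta - d b(u)^2
    (eta^2 - eta). The remaining four terms add up to h eta + d b(u)^2 (eta^2 - eta), the 1
    cancelling that of [x_0, F] = eta - 1. *)
Lemma degree0_part : 1 + comm F0 Cpart + comm x0 F + comm b0 (bS * eta) + d *: acomm F Cpart +
  d *: (bS * eta * (bS * eta)) = h * (xi_plus xi * eta).
Proof.
have F0S := const_second (subalgebraN second_sub (second_y 0)).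
have bbF : coef_in first (bS * bS) by apply: coef_inM => //; exact: bS_first.
have comm_first f z : coef_in first f -> comm F0 (f * z) = f * comm F0 z.
  by move=> fF; apply/comm_mull/series_cross.
have acomm_first f z : coef_in first f -> acomm F (f * z) = f * acomm F z.
  by move=> fF; apply/acomm_mull/series_cross/F_second.
have FC : comm F0 Cpart + d *: acomm F Cpart =
    h * (xi_plus xi * eta) - h * eta - d *: (bS * bS * (eta * eta) - bS * bS * eta).
  have -> : comm F0 Cpart = h * comm F0 E + 2^-1 *: (bS * bS * comm F0 q0).
    rewrite -(comm_first _ E h_first) -(comm_first _ q0 bbF) -commZr; exact: commDr.
  have -> : acomm F Cpart = h * acomm F E + 2^-1 *: (bS * bS * acomm F q0).
    rewrite -(acomm_first _ E h_first) -(acomm_first _ q0 bbF) -acommZr; exact: acommDr.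
  rewrite scalerDr addrACA ![acomm F _]acommC; congr (_ + _).
    by rewrite scalerAr -mulrDr (comm_F0_E str) mulrBr.
  rewrite scalerA mulrC -scalerA -scalerDr scalerAr -mulrDr (comm_F0_q0 str).
  rewrite -[bS * bS * (_ *: _)]scalerAr [bS * bS * (_ - _)]mulrBr scalerA (_ : 2^-1 * - (d *+ 2) = - d); last by field.
  exact: scaleNr.
have hE : h * eta = eta + comm b0 bS * eta + d *: (bS * bS * eta).
  by rewrite /h_of_b [(1 + _ + _) * _]mulrDl [(1 + _) * _]mulrDl mul1r -[d *: _ * _]scalerAl.
have bb_sq : bS * eta * (bS * eta) = bS * bS * (eta * eta).
  by rewrite mulrA -(mulrA bS) -(series_cross bS_first eta_second) !mulrA.
have b0b : comm b0 (bS * eta) = comm b0 bS * eta.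
  have b0F := const_first (first_b 0).
  by rewrite commMr (series_cross0 b0F eta_second) mulr0 addr0.
rewrite (comm_x0_F str) bb_sq b0b.
rewrite [LHS](AC ((1*1*2*1)*1*1) ((2*6)*(1*((3*4)*5)*7))) /= FC hE scalerBr.
exact: cancel_degree0.
Qed.

(** Only products with F or F0 lower the degree. They carry the error of [current_approx] from
    alpha_i + Q_+ into Q_+, still negligible. Outside Q_+ there remain [F0, F] + d F^2 and [F0, V] +
    d {F, V}, both zero, and the terms of [degree0_part]. *)
Lemma current_h : sg Qp (1 + comm bb0 BB + d *: (BB * BB) - h * (xi_plus xi * eta)).
Proof.
pose N := BB - Bapprox; have N_deg : sg Ni N := current_approx.
have BBE : BB = Bapprox + N by rewrite /N addrC subrK.
have N_Qp : sg Qp N by apply: sgspan_sub Ni_Qplus N_deg.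
have C_Qp : sg Qp Cpart by apply: sgspan_sub C_deg => k <-; apply: Qplus_delta.
have b0_deg := first_sdeg (const_first (first_b 0)).
have F0_deg : sg (eq (- ai)) F0.
  by apply/sgspan_pconst; rewrite -scaleN1r; apply/lspanZ/(gspan_gen (k := - ai)).
have bb0E : bb0 = F0 + b0 + x0.
  by rewrite bb_0 -!pconstD; congr pconst; rewrite addrC addrA.
have VC_ge0 : sg Qnonneg (Vpart + Cpart) := sgspanD V_deg C_ge0.
have FVC_N : sg Qnonneg (Vpart + Cpart + N) := sgspanD VC_ge0 (sgspan_sub Qplus_ge0 N_Qp).
have add0 k l : 0 = k -> Qp l -> Qp (k + l) by move=> <-; rewrite add0r.
have addi k l : ai = k -> Qnonneg l -> Qp (k + l).
  by move=> <-; apply: Qplus_addr; apply: Qplus_delta.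
have addF k l : - ai = k -> Ni l -> Qp (k + l) by move=> <-; rewrite addrC.
have addF' k l : Ni k -> - ai = l -> Qp (k + l) by move=> kN <-.
have F0Bap : comm F0 Bapprox = comm F0 F + comm F0 Vpart + comm F0 Cpart.
  by rewrite [LHS]commDr; congr (_ + _); exact: commDr.
have [r1 r1_deg b0Bap] : exists2 r, sg Qp r & comm b0 Bapprox = comm b0 (bS * eta) + r.
  exists (comm b0 Jpart + comm b0 Cpart).
    by apply: sgspanD; apply: (sgspan_comm GM add0 b0_deg); [exact: J_deg | exact: C_Qp].
  rewrite [LHS]commDr [comm b0 (F + Vpart)]commDr V_split [comm b0 (_ + Jpart)]commDr.
  by rewrite (series_cross0 (const_first (first_b 0)) F_second) add0r -addrA.
have [r2 r2_deg x0Bap] : exists2 r, sg Qp r & comm x0 Bapprox = comm x0 F + r.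
  exists (comm x0 (Vpart + Cpart)); first exact: (sgspan_comm GM addi x_sdeg VC_ge0).
  by rewrite /Bapprox -addrA; apply: commDr.
have sqD (u v : pser A) : (u + v) * (u + v) = u * u + acomm u v + v * v.
  by rewrite /acomm mulrDl !mulrDr !addrA.
have [r3 r3_deg BapBap] : exists2 r, sg Qp r & Bapprox * Bapprox =
    F * F + acomm F Vpart + acomm F Cpart + bS * eta * (bS * eta) + r.
  have bS_eta : sg (eq 0) (bS * eta).
    by apply: (sgspanM GM _ (first_sdeg bS_first) eta_deg) => k l <- <-; rewrite addr0.
  exists (acomm (bS * eta) Jpart + Jpart * Jpart + acomm Vpart Cpart + Cpart * Cpart).
    apply: sgspanD; first apply: sgspanD; first apply: sgspanD.
    - exact: (sgspan_acomm GM add0 bS_eta J_deg).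
    - exact: (sgspanM GM (fun k l kQ lQ => Qplus_addr kQ (Qplus_ge0 lQ)) J_deg J_deg).
    - exact: (sgspan_acomm GM Qplus_addl V_deg C_Qp).
    exact: (sgspanM GM Qplus_addr C_Qp C_ge0).
  have VV : Vpart * Vpart = bS * eta * (bS * eta) + (acomm (bS * eta) Jpart + Jpart * Jpart).
    by rewrite V_split sqD -addrA.
  rewrite /Bapprox -[F + Vpart + Cpart]addrA sqD [(Vpart + Cpart) * (Vpart + Cpart)]sqD VV acommDr.
  by rewrite !addrA.
have [r4 r4_deg bb0N] : exists2 r, sg Qp r & comm bb0 N = r.
  exists (comm bb0 N) => //; rewrite bb0E -addrA commDl commDl.
  apply: sgspanD; first exact: (sgspan_comm GM addF F0_deg N_deg).
  apply: sgspanD; first exact: (sgspan_comm GM add0 b0_deg N_Qp).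
  by apply: (sgspan_comm GM addi x_sdeg (sgspan_sub Qplus_ge0 N_Qp)).
have [r5 r5_deg BB2] : exists2 r, sg Qp r & BB * BB = Bapprox * Bapprox + r.
  exists (acomm F N + acomm (Vpart + Cpart) N + N * N).
    apply: sgspanD; first apply: sgspanD.
    - exact: (sgspan_acomm GM addF F_deg N_deg).
    - exact: (sgspan_acomm GM Qplus_addl VC_ge0 N_Qp).
    exact: (sgspanM GM Qplus_addr N_Qp (sgspan_sub Qplus_ge0 N_Qp)).
  have -> : acomm F N + acomm (Vpart + Cpart) N = acomm Bapprox N.
    by rewrite -acommDl /Bapprox addrA.
  by rewrite BBE sqD -addrA.
rewrite BB2 BapBap {1}BBE [comm bb0 (Bapprox + N)]commDr bb0N bb0E.
rewrite [comm (F0 + b0 + x0) Bapprox]commDl [comm (F0 + b0) Bapprox]commDl F0Bap b0Bap x0Bap.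
rewrite [d *: (_ + r5)]scalerDr [d *: (_ + r3)]scalerDr [d *: (_ + _ * (bS * eta))]scalerDr.
rewrite [d *: (_ + acomm F Cpart)]scalerDr [d *: (F * F + _)]scalerDr.
suff -> : 1 + (comm F0 F + comm F0 Vpart + comm F0 Cpart + (comm b0 (bS * eta) + r1) + (comm x0 F + r2) + r4)
   + (d *: (F * F) + d *: acomm F Vpart + d *: acomm F Cpart + d *: (bS * eta * (bS * eta)) + d *: r3 + d *: r5)
   - h * (xi_plus xi * eta) = r1 + r2 + r4 + (d *: r3 + d *: r5).
  by do ![apply: sgspanD => //| apply: sgspanZ => //].
rewrite -degree0_part.
apply: cancel_main_terms; [exact: comm_F0_F str | exact: comm_F0_V].
Qed.

Lemma current_leading : sg Qp (BB - (bS * eta + F)).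
Proof.
have -> : BB - (bS * eta + F) = (BB - Bapprox) + Jpart + Cpart.
  by rewrite /Bapprox V_split; apply: drop_high_terms.
apply: sgspanD; last by apply: sgspan_sub C_deg => k <-; apply: Qplus_delta.
by apply: sgspanD J_deg; apply: sgspan_sub Ni_Qplus current_approx.
Qed.

End CurrentSeries.

(** * The Yangians and the tensor square *)

Section SeriesMap.
Variables (K : numFieldType) (A B : algType K) (f : {lrmorphism A -> B}).
Implicit Types F H : pser A.

Definition smap F : pser B := fun n => f (F n).

Lemma smap1 : smap 1 = 1.
Proof. by apply: funext => -[|n]; rewrite /smap /= ?rmorph1 ?rmorph0. Qed.
Lemma smapD F H : smap (F + H) = smap F + smap H.
Proof. by apply: funext => n; apply: raddfD. Qed.
Lemma smapB F H : smap (F - H) = smap F - smap H.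
Proof. by apply: funext => n; apply: raddfB. Qed.
Lemma smapZ c F : smap (c *: F) = c *: smap F.
Proof. by apply: funext => n; apply: linearZ. Qed.
Lemma smapM F H : smap (F * H) = smap F * smap H.
Proof.
apply: funext => n; rewrite /smap pserME rmorph_sum pserME.
by apply: eq_bigr => k _; apply: rmorphM.
Qed.
Lemma smap_comm F H : smap (comm F H) = comm (smap F) (smap H).
Proof. by rewrite /comm smapB !smapM. Qed.
Lemma smap_pconst a : smap (pconst a) = pconst (f a).
Proof. by apply: funext => -[|n] //; apply: raddf0. Qed.
Lemma smap_pshift F : smap (pshift F) = pshift (smap F).
Proof. by apply: funext => -[|n] //; apply: raddf0. Qed.

Lemma smap_h_of_b d b : smap (h_of_b d b) = h_of_b d (smap b).
Proof. by rewrite /h_of_b [LHS]smapD [smap (1 + _)]smapD smap1 smap_comm smapZ smapM smap_pconst smap_pshift. Qed.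

Lemma yangian_string_map d x y xi Xi : yangian_string d x y xi Xi ->
  yangian_string d (f \o x) (f \o y) (f \o xi) (f Xi).
Proof.
move=> str; split=> [r s|r s|s|s|r s|r s|r s|r|s|s] /=.
- by have /(congr1 f) := ys_xixi str r s; rewrite rmorph_commutator rmorph0.
- by have /(congr1 f) := ys_xy str r s; rewrite rmorph_commutator.
- by have /(congr1 f) := ys_xi0x str s; rewrite rmorph_commutator linearZ.
- by have /(congr1 f) := ys_xi0y str s; rewrite rmorph_commutator linearZ.
- by have /(congr1 f) := ys_xix str r s; rewrite rmorphB !rmorph_commutator linearZ /= rmorph_anticommutator.
- by have /(congr1 f) := ys_xiy str r s; rewrite rmorphB !rmorph_commutator linearZ /= rmorph_anticommutator.
- by have /(congr1 f) := ys_yy str r s; rewrite rmorphB !rmorph_commutator linearZ /= rmorph_anticommutator.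
- by have /(congr1 f) := ys_Xixi str r; rewrite rmorph_commutator rmorph0.
- by have /(congr1 f) := ys_Xix str s; rewrite rmorph_commutator.
- by have /(congr1 f) := ys_Xiy str s; rewrite rmorph_commutator rmorphN.
Qed.

End SeriesMap.

Section TensorAlgebra.
Variables (K : fieldType) (A B : algType K).
Local Notation T := (tensor A B).

Lemma tensor_scalerAl (c : K) (u v : T) : c *: (u * v) = (c *: u) * v.
Proof.
rewrite -[u]tens_pi_repr -[v]tens_pi_repr.
transitivity (tens_pi (fsum_scale c (fsum_mul (repr u) (repr v)))).
  by rewrite -tens_scaleE -tens_mulE.
transitivity (tens_pi (fsum_mul (fsum_scale c (repr u)) (repr v))); last first.
  by rewrite -tens_mulE -tens_scaleE.
congr tens_pi; rewrite /fsum_scale /fsum_mul map_allpairs allpairs_mapl.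
by apply: eq_allpairs => p q /=; rewrite scalerAl.
Qed.
Lemma tensor_scalerAr (c : K) (u v : T) : c *: (u * v) = u * (c *: v).
Proof.
rewrite -[u]tens_pi_repr -[v]tens_pi_repr.
transitivity (tens_pi (fsum_scale c (fsum_mul (repr u) (repr v)))).
  by rewrite -tens_scaleE -tens_mulE.
transitivity (tens_pi (fsum_mul (repr u) (fsum_scale c (repr v)))); last first.
  by rewrite -tens_mulE -tens_scaleE.
congr tens_pi; rewrite /fsum_scale /fsum_mul map_allpairs allpairs_mapr.
by apply: eq_allpairs => p q /=; rewrite scalerAr.
Qed.

(** The product of the two functionals is constant on classes of formal sums and separates 1 from 0.
    A nonzero unit is part of the [algType] structure. *)
Lemma tensor_neq0 (eA : {scalar A}) (eB : {scalar B}) :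
  eA 1 = 1 -> eB 1 = 1 -> (1 : T) != 0.
Proof.
move=> eA1 eB1; pose e (s : seq (A * B)) := \sum_(p <- s) eA p.1 * eB p.2.
suff eP s t : tens_eq s t -> e s = e t.
  apply/eqP => /tens_piP/eP/eqP.
  by rewrite /e big_seq1 big_nil eA1 eB1 mulr1 oner_eq0.
elim=> {s t} //=.
- by move=> s t u _ -> _ ->.
- by move=> s s' t t' _ es _ et; rewrite /e !big_cat /= -/(e s) -/(e t) es et.
- by move=> s t; rewrite /e !big_cat /= addrC.
- by move=> a a' b; rewrite /e !big_cons !big_nil /= linearD mulrDl !addr0.
- by move=> a b b'; rewrite /e !big_cons !big_nil /= linearD mulrDr !addr0.
- by move=> c a b; rewrite /e !big_seq1 /= !linearZ /= mulrCA mulrA.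
- by move=> b; rewrite /e big_seq1 big_nil /= linear0 mul0r.
Qed.

End TensorAlgebra.

Section Augmentation.
Variables (K : fieldType) (G : choiceType) (rel : relations K G).

(** The augmentation that kills all generators; it is independent of the representative because
    elements of the ideal have no constant term. *)
Definition pres_eps (u : presented rel) : K^o := (repr u)@_(mone : {fmonom G}).

Lemma pres_epsE x : pres_eps (pres_pi rel x) = x@_(mone : {fmonom G}).
Proof.
apply/eqP; rewrite -subr_eq0 /pres_eps -mcoeffB; apply/eqP.
by apply/(@rel_ideal_const _ _ rel)/pres_piP; rewrite pres_pi_repr.
Qed.
Lemma pres_eps_linear : linear pres_eps.
Proof.
move=> c u v; rewrite -[u]pres_pi_repr -[v]pres_pi_repr -linearP /= !pres_epsE.
by rewrite mcoeffD mcoeffZ.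
Qed.
HB.instance Definition _ := GRing.isLinear.Build K (presented rel) K^o _ pres_eps pres_eps_linear.
Lemma pres_eps1 : pres_eps 1 = 1.
Proof. by rewrite -[1](rmorph1 (pres_pi rel)) pres_epsE rmorph1. Qed.

End Augmentation.

Section YangianSquare.
Variables (K : fieldType) (I : finType) (af : I -> I -> K) (c : I -> I -> int).
Local Notation Y := (yangian af c).
Local Notation T := (tensor Y Y).

Lemma tensor_yangian_neq0 : (1 : T) != 0.
Proof.
pose e : {scalar Y} := @pres_eps K _ (Relations (@yangian_rel_const K I af c)).
by apply: (@tensor_neq0 _ _ _ e e); apply: pres_eps1.
Qed.
HB.instance Definition _ := GRing.PzSemiRing_isNonZero.Build T tensor_yangian_neq0.
HB.instance Definition _ :=
  GRing.LSemiModule_isLSemiAlgebra.Build K T (@tensor_scalerAl K Y Y).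
HB.instance Definition _ :=
  GRing.LSemiAlgebra_isSemiAlgebra.Build K T (@tensor_scalerAr K Y Y).

Definition tensl (a : Y) : T := tens a 1.
Definition tensr (a : Y) : T := tens 1 a.

Lemma tensl_zmod : zmod_morphism tensl.
Proof. by move=> a b; rewrite /tensl tensDl -scaleN1r tensZl scaleN1r. Qed.
Lemma tensl_monoid : monoid_morphism tensl.
Proof. by split=> // a b; rewrite /tensl tensM mulr1. Qed.
Lemma tensl_scalable : scalable tensl.
Proof. by move=> e a; apply: tensZl. Qed.
HB.instance Definition _ := GRing.isZmodMorphism.Build Y T tensl tensl_zmod.
HB.instance Definition _ := GRing.isMonoidMorphism.Build Y T tensl tensl_monoid.
HB.instance Definition _ := GRing.isScalable.Build K Y T _ tensl tensl_scalable.

Lemma tensr_zmod : zmod_morphism tensr.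
Proof. by move=> a b; rewrite /tensr tensDr -scaleN1r tensZr scaleN1r. Qed.
Lemma tensr_monoid : monoid_morphism tensr.
Proof. by split=> // a b; rewrite /tensr tensM mulr1. Qed.
Lemma tensr_scalable : scalable tensr.
Proof. by move=> e a; apply: tensZr. Qed.
HB.instance Definition _ := GRing.isZmodMorphism.Build Y T tensr tensr_zmod.
HB.instance Definition _ := GRing.isMonoidMorphism.Build Y T tensr tensr_monoid.
HB.instance Definition _ := GRing.isScalable.Build K Y T _ tensr tensr_scalable.

End YangianSquare.

Section PresentedMorphism.
Variables (K : fieldType) (G : choiceType) (rel : relations K G).
Local Notation pi := (pres_pi rel).

Lemma presB x y : pi (x - y) = pi x - pi y. Proof. exact: raddfB. Qed.
Lemma presD x y : pi (x + y) = pi x + pi y. Proof. exact: raddfD. Qed.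
Lemma presZ e x : pi (e *: x) = e *: pi x. Proof. exact: linearZ. Qed.
Lemma pres_comm x y : pi (comm x y) = comm (pi x) (pi y).
Proof. exact: rmorph_commutator. Qed.
Lemma pres_acomm x y : pi (acomm x y) = acomm (pi x) (pi y).
Proof. exact: rmorph_anticommutator. Qed.

Lemma pres_comm_eq a b e z :
  pi (comm a b - e *: z) = 0 -> comm (pi a) (pi b) = e *: pi z.
Proof.
by rewrite (presB (comm a b)) (pres_comm a b) (presZ e z) => /eqP; rewrite subr_eq0 => /eqP.
Qed.
Lemma pres_comm_shift_eq a a' b b' e p q :
  pi (comm a b - comm a' b' - e *: acomm p q) = 0 ->
  comm (pi a) (pi b) - comm (pi a') (pi b') = e *: acomm (pi p) (pi q).
Proof.
have -> : pi (comm a b - comm a' b' - e *: acomm p q) =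
    comm (pi a) (pi b) - comm (pi a') (pi b') - e *: acomm (pi p) (pi q).
  apply: etrans (presB _ _) _; refine (congr2 (fun u v => u - v) _ _).
    by apply: etrans (presB _ _) _; refine (congr2 (fun u v => u - v) _ _); exact: pres_comm.
  by apply: etrans (presZ _ _) _; refine (congr1 (fun u => e *: u) _); exact: pres_acomm.
by move=> /eqP; rewrite subr_eq0 => /eqP.
Qed.

End PresentedMorphism.

Section YangianRelations.
Variables (K : fieldType) (I : finType) (af : I -> I -> K) (c : I -> I -> int).
Local Notation Y := (yangian af c).
Local Notation x := (yx af c).
Local Notation xi := (yxi af c).
Local Notation sg e := (if e then 1 else -1 : K).
Local Notation Yrel := (Relations (@yangian_rel_const K I af c)).
Local Notation pi := (pres_pi Yrel).

Lemma yangian_xi_xi i r j s : comm (xi i r) (xi j s) = 0.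
Proof. exact: etrans (esym (pres_comm _ _ _)) (pres_rel (rel := Yrel) (yrel_xixi af c i r j s)). Qed.
Lemma yangian_xi0_x (e : bool) i j s :
  comm (xi i 0) (x e j s) = (sg e * af i j) *: x e j s.
Proof. exact: pres_comm_eq (pres_rel (rel := Yrel) (yrel_xi0x af c e i j s)). Qed.
Lemma yangian_x_x i r j s : comm (x true i r) (x false j s) = (i == j)%:R *: xi i (r + s).
Proof. exact: pres_comm_eq (pres_rel (rel := Yrel) (yrel_xx af c i r j s)). Qed.
Lemma yangian_xi_x (e : bool) i r j s :
  comm (xi i r.+1) (x e j s) - comm (xi i r) (x e j s.+1) =
  (sg e * (af i j / 2)) *: acomm (xi i r) (x e j s).
Proof. exact: pres_comm_shift_eq (pres_rel (rel := Yrel) (yrel_xix af c e i r j s)). Qed.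
Lemma yangian_xe_xe (e : bool) i r j s :
  comm (x e i r.+1) (x e j s) - comm (x e i r) (x e j s.+1) =
  (sg e * (af i j / 2)) *: acomm (x e i r) (x e j s).
Proof. exact: pres_comm_shift_eq (pres_rel (rel := Yrel) (yrel_xexe af c e i r j s)). Qed.

Lemma yhomog_gen (t : ygen I) : @yhomog K I af c (ydeg t) (pres_gen _ t).
Proof. by apply: lspan_gen; exists [:: t]; rewrite !big_seq1. Qed.
Lemma yhomog1 : @yhomog K I af c 0 1.
Proof. by apply: lspan_gen; exists [::]; rewrite !big_nil. Qed.
Lemma yhomogM k l (y z : Y) : yhomog k y -> yhomog l z -> yhomog (k + l) (y * z).
Proof.
apply: lspanM => {}y {}z [w [wk ->]] [w' [wl ->]]; exists (w ++ w').
by rewrite !big_cat /= wk wl.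
Qed.

End YangianRelations.

(** Relations between elements of an arbitrary algebra, so that the estimates can be carried out
    away from the quotient of the free algebra. *)
Record yangian_generators (K : fieldType) (I : finType) (af : I -> I -> K) (Y : algType K)
    (x : bool -> I -> nat -> Y) (xi : I -> nat -> Y) : Prop := YangianGenerators {
  yg_xi_xi : forall i r j s, comm (xi i r) (xi j s) = 0;
  yg_xi0_x : forall (e : bool) i j s,
    comm (xi i 0%N) (x e j s) = ((if e then 1 else -1) * af i j) *: x e j s;
  yg_x_x : forall i r j s, comm (x true i r) (x false j s) = (i == j)%:R *: xi i (r + s)%N;
  yg_xi_x : forall (e : bool) i r j s,
    comm (xi i r.+1) (x e j s) - comm (xi i r) (x e j s.+1) =
    ((if e then 1 else -1) * (af i j / 2)) *: acomm (xi i r) (x e j s);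
  yg_xe_xe : forall (e : bool) i r j s,
    comm (x e i r.+1) (x e j s) - comm (x e i r) (x e j s.+1) =
    ((if e then 1 else -1) * (af i j / 2)) *: acomm (x e i r) (x e j s)
}.

Lemma yangianP (K : fieldType) (I : finType) (af : I -> I -> K) (c : I -> I -> int) :
  yangian_generators af (yx af c) (yxi af c).
Proof.
split; [exact: yangian_xi_xi | exact: yangian_xi0_x | exact: yangian_x_x |
        exact: yangian_xi_x | exact: yangian_xe_xe].
Qed.

Section YangianString.
Variables (K : numFieldType) (g : lieAlgType K) (I : finType) (D : lie_datum g I).
Local Notation af := (sform D).
Variables (Y : algType K) (x : bool -> I -> nat -> Y) (xi : I -> nat -> Y).
Hypothesis Yrel : yangian_generators af x xi.
Variables (i : I) (cw : I -> K).
Hypothesis cwP : forall l : I, \sum_j cw j * af j l = (i == l)%:R.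

(** The element xi_{j,1} - xi_{j,0}^2 / 2 is the coefficient of u^-2 in log xi_j(u). The square
    cancels the anticommutator in the relation between xi_{j,1} and x_{l,s}, and the coweight
    coefficients single out the node i. *)
Definition Xi_cw : Y := \sum_j cw j *: (xi j 1 - 2^-1 *: (xi j 0%N * xi j 0%N)).

Lemma Xi_cw_xi j r : comm Xi_cw (xi j r) = 0.
Proof.
rewrite comm_suml big1 // => l _.
by rewrite commZl commBl commZl commMl !(yg_xi_xi Yrel) mulr0 mul0r addr0 scaler0 subr0 scaler0.
Qed.

Lemma Xi_cw_x (e : bool) j s :
  comm Xi_cw (x e j s) = ((if e then 1 else -1) * (i == j)%:R) *: x e j s.+1.
Proof.
rewrite -cwP mulr_sumr scaler_suml comm_suml; apply: eq_bigr => l _.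
rewrite commZl commBl commZl commMl (yg_xi0_x Yrel) -scalerAl -scalerAr -scalerDr -/(acomm _ _).
have /eqP := yg_xi_x Yrel e l 0 j s; rewrite subr_eq (yg_xi0_x Yrel) => /eqP ->.
rewrite addrAC scalerA -scalerBl [X in X *: acomm _ _](_ : _ = 0); last by field.
by rewrite scale0r add0r scalerA mulrCA.
Qed.

Lemma yangian_index_string :
  yangian_string (af i i / 2) (x true i) (x false i) (xi i) Xi_cw.
Proof.
have d2 : af i i = af i i / 2 *+ 2 by rewrite -mulr_natr divfK ?pnatr_eq0.
split=> [r s|r s|s|s|r s|r s|r s|r|s|s].
- exact: (yg_xi_xi Yrel).
- by rewrite (yg_x_x Yrel) eqxx scale1r.
- by rewrite (yg_xi0_x Yrel) mul1r -d2.
- by rewrite (yg_xi0_x Yrel) mulN1r -d2.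
- by rewrite (yg_xi_x Yrel) mul1r.
- by rewrite (yg_xi_x Yrel) mulN1r.
- by rewrite (yg_xe_xe Yrel) mulN1r.
- exact: Xi_cw_xi.
- by rewrite Xi_cw_x eqxx mulr1 scale1r.
- by rewrite Xi_cw_x eqxx mulr1 scaleN1r.
Qed.

Variable iota : {linear g -> Y}.
Hypothesis iota_lieb : forall y z, iota (lieb y z) = comm (iota y) (iota z).
Hypothesis iota_x : forall e j, iota (chev D e j) = x e j 0%N.

Section Homogeneity.
Variable G : rlattice I -> Y -> Prop.
Hypotheses (G0 : forall k, G k 0) (GD : forall k y z, G k y -> G k z -> G k (y + z)).
Hypothesis GZ : forall k a y, G k y -> G k (a *: y).
Hypothesis GM : forall k l y z, G k y -> G l z -> G (k + l) (y * z).
Hypothesis Gx : forall j, G (rdelta j) (x true j 0%N).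

Lemma iota_homog k y : Qplus k -> gsp D k y -> G k (iota y).
Proof.
move: k y; apply: posroot_ind => [k|k y z yk zk|k a y|j|j k z kQ zk IH].
- by rewrite linear0.
- by rewrite linearD; apply: GD.
- by rewrite linearZ; apply: GZ.
- by rewrite iota_x.
have Gz := IH k z kQ (lexx _) zk.
rewrite iota_lieb iota_x /comm -scaleN1r; apply: GD; last exact/GZ/GM.
by rewrite addrC; apply: GM.
Qed.

End Homogeneity.

(** Such vectors are built by brackets from x_j^+ with j different from i, which commute with
    x_{i,s}^- and with Xi. *)
Lemma iota_away k y : Qplus k -> gsp D k y -> k i = 0 ->
  (forall s, comm (iota y) (x false i s) = 0) /\ comm Xi_cw (iota y) = 0.
Proof.
move: k y; apply: posroot_ind => [k|k y z hy hz ki|k a y hy ki|j|j k z kQ zk IH].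
- by rewrite linear0 comm0r; split=> // s; rewrite comm0l.
- have [y1 y2] := hy ki; have [z1 z2] := hz ki.
  by rewrite linearD commDr y2 z2 addr0; split=> // s; rewrite commDl y1 z1 addr0.
- have [y1 y2] := hy ki.
  by rewrite linearZ commZr y2 scaler0; split=> // s; rewrite commZl y1 scaler0.
- rewrite ffunE iota_x; case: eqP => // ji _.
  have ij : (i == j) = false by apply/eqP => ij; apply: ji.
  rewrite Xi_cw_x ij mulr0 scale0r; split=> // s.
  by rewrite (yg_x_x Yrel) eq_sym ij scale0r.
rewrite !ffunE => kji; have k0 := kQ.1 i.
have [ki ji] : k i = 0 /\ j != i.
  by move: kji; case: eqVneq => _ /=; rewrite ?addr0 // => /eqP; rewrite paddr_eq0 // andbF.
have [z1 z2] : (forall s, comm (iota z) (x false i s) = 0) /\ comm Xi_cw (iota z) = 0.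
  exact: (IH k).
have xy s : comm (x true j 0%N) (x false i s) = 0 by rewrite (yg_x_x Yrel) (negPf ji) scale0r.
have Xx : comm Xi_cw (x true j 0%N) = 0 by rewrite Xi_cw_x eq_sym (negPf ji) mulr0 scale0r.
rewrite iota_lieb iota_x; split=> [s|].
  by apply/eqP; have /eqP := comm_jacobi (x true j 0%N) (iota z) (x false i s);
     rewrite z1 xy !comm0r addr0 eq_sym.
by rewrite comm_jacobi Xx z2 comm0l comm0r addr0.
Qed.

(** Here x_i^+ occurs once among the brackets. Bracketing with x_{i,s}^- replaces it by xi_{i,s},
    and everything left commutes with Xi. *)
Lemma iota_once k y s : Qplus k -> gsp D k y -> k i = 1 ->
  comm Xi_cw (comm (iota y) (x false i s)) = 0.
Proof.
move: k y; apply: posroot_ind => [k _|k y z hy hz ki|k a y hy ki|j|j k z kQ zk IH].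
- by rewrite linear0 comm0l comm0r.
- by rewrite linearD commDl commDr hy ?hz ?addr0.
- by rewrite linearZ commZl commZr hy ?scaler0.
- rewrite ffunE iota_x; case: eqP => // -> _.
  by rewrite (yg_x_x Yrel) eqxx scale1r Xi_cw_xi.
rewrite !ffunE => kji; have k0 := kQ.1 i; rewrite iota_lieb iota_x.
have -> : comm (comm (x true j 0%N) (iota z)) (x false i s) =
    comm (x true j 0%N) (comm (iota z) (x false i s)) - comm (iota z) (comm (x true j 0%N) (x false i s)).
  by rewrite comm_jacobi addrK.
move: kji; case: eqVneq => [->|ji] /= kji.
  have [z1 z2] : (forall s, comm (iota z) (x false i s) = 0) /\ comm Xi_cw (iota z) = 0.
    by apply: iota_away kQ zk _; apply: (@addIr _ 1); rewrite add0r.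
  rewrite z1 comm0r sub0r (yg_x_x Yrel) eqxx scale1r commNr comm_jacobi z2 Xi_cw_xi.
  by rewrite comm0l comm0r addr0 oppr0.
rewrite addr0 in kji; rewrite (yg_x_x Yrel) (negPf ji) scale0r comm0r subr0 comm_jacobi.
rewrite (IH k z) // comm0r addr0 Xi_cw_x eq_sym (negPf ji) mulr0 scale0r.
exact: comm0l.
Qed.

End YangianString.

Record twisted_generators (K : fieldType) (I : finType) (af : I -> I -> K) (A : algType K)
    (h b : I -> nat -> A) : Prop := TwistedGenerators {
  tg_h_h : forall i r j s, comm (h i r) (h j s) = 0;
  tg_h1_b : forall i j s, comm (h i 1%N) (b j s) = (2 * af i j) *: b j s.+1;
  tg_b_b : forall i r s, comm (b i r.+1) (b i s) - comm (b i r) (b i s.+1) =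
    (af i i / 2) *: acomm (b i r) (b i s) - (2 * (-1) ^+ s) *: h i (r + s + 1)%N;
  tg_h_even : forall i n, ~~ odd n -> h i n = 0
}.

(** * The series h_i(u) in terms of b_i(u) *)

Section HFromB.
Variables (K : numFieldType) (I : finType) (af : I -> I -> K) (A : algType K).
Variables (h b : I -> nat -> A).
Hypothesis rel : twisted_generators af h b.

Definition h_series i : pser A := fun n => if n is r.+1 then h i r else 1.

(* Summing the relation for [b_r, b_s] over r + s = n telescopes. *)
Lemma h_series_of_b i : h_series i = h_of_b (af i i / 2) (b i).
Proof.
apply: funext => -[|[|n]].
- rewrite /h_of_b !pserDE pserZE comm_pconstE /= comm0r addr0.
  by rewrite -pshiftMl /= scaler0 addr0.
- rewrite /h_of_b !pserDE pserZE comm_pconstE /= commxx addr0.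
  by rewrite -pshiftMl -pshiftMr /= scaler0 addr0 (tg_h_even rel).
rewrite /h_of_b !pserDE pserZE comm_pconstE -pshiftMl -pshiftMr /= add0r.
pose T k := comm (b i k) (b i (n.+1 - k)%N).
have tel : T n.+1 - T 0%N = \sum_(k < n.+1) ((af i i / 2) *: acomm (b i k) (b i (n - k)%N)
    - (2 * (-1) ^+ (n - k)) *: h i n.+1).
  rewrite -(telescope_sumr T (leq0n n.+1)) big_mkord; apply: eq_bigr => k _.
  have kn : (k <= n)%N by rewrite -ltnS.
  by rewrite /T subSS subSn // (tg_b_b rel) subnKC // addn1.
(* The alternating sum is 1 for even n. For odd n it is 0, but then h_{i,n+1} is 0 as well. *)
have sign : \sum_(k < n.+1) (2 * (-1) ^+ (n - k)) *: h i n.+1 = h i n.+1 *+ 2.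
  rewrite -scaler_suml -mulr_sumr -[RHS]scaler_nat.
  have [on|en] := boolP (odd n.+1); last by rewrite (tg_h_even rel _ en) !scaler0.
  suff -> : \sum_(k < n.+1) (-1) ^+ (n - k) = 1 :> K by rewrite mulr1.
  have alternating m : \sum_(k < m.+1) (-1) ^+ (m - k) = (~~ odd m)%:R :> K.
    elim: m => [|m IH]; first by rewrite big_ord1.
    rewrite big_ord_recl (eq_bigr (fun k : 'I_m.+1 => (-1) ^+ (m - k))) // IH.
    by rewrite subn0 -signr_odd /=; case: odd; rewrite /= ?addNr ?addr0.
  by rewrite alternating -[~~ _]/(odd n.+1) on.
move: tel; rewrite sumrB sign -scaler_sumr -(acomm_coefE (b i : pser A)) /T subnn subn0.
rewrite [comm (b i n.+1) _]commC /acomm pserDE.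
set d := _ / 2; set S := ((b i : pser A) * b i) n => e; apply: mulr2n_lmod_inj.
have -> : h i n.+1 *+ 2 = d *: (S + S) - (d *: (S + S) - h i n.+1 *+ 2).
  by rewrite opprB addrC subrK.
by rewrite -e opprD !opprK scalerDr addrACA mulr2n addrC addrACA.
Qed.

End HFromB.

Section PresentedTwisted.
Variables (K : fieldType) (G : choiceType) (rel : relations K G).
Local Notation pi := (pres_pi rel).
Implicit Types (a b p q r t u v : free_alg K G).

(** The relation between h and b for r = 0: there h_{i,-1} = 1, so the commutators with it vanish
    and the anticommutator doubles. *)
Lemma algebra_h1_b (A : algType K) (a b p q t : A) e e' :
  comm a b - comm 1 p - (e *: acomm 1 q + e' *: comm 1 t) = 0 -> comm a b = (2 * e) *: q.
Proof.
rewrite ![comm 1 _]commC !comm1r oppr0 scaler0 addr0 subr0 acommC acomm1r.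
by move/eqP; rewrite subr_eq0 => /eqP ->; rewrite -scaler_nat scalerA mulrC.
Qed.

Lemma pres_h1_b a b p q t e e' :
  pi (comm a b - comm 1 p - (e *: acomm 1 q + e' *: comm 1 t)) = 0 ->
  comm (pi a) (pi b) = (2 * e) *: pi q.
Proof.
have one : pi 1 = 1 by exact: (rmorph1 pi).
have comm1 w : pi (comm 1 w) = comm 1 (pi w) by rewrite -one; exact: pres_comm.
have acomm1 w : pi (acomm 1 w) = acomm 1 (pi w) by rewrite -one; exact: pres_acomm.
have -> : pi (comm a b - comm 1 p - (e *: acomm 1 q + e' *: comm 1 t)) =
    comm (pi a) (pi b) - comm 1 (pi p) - (e *: acomm 1 (pi q) + e' *: comm 1 (pi t)).
  refine (etrans (presB _ _ _) _); refine (congr2 (fun y z => y - z) _ _).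
    refine (etrans (presB _ _ _) _); refine (congr2 (fun y z => y - z) _ _); [exact: pres_comm | exact: comm1].
  refine (etrans (presD _ _ _) _); refine (congr2 (fun y z => y + z) _ _).
    by refine (etrans (presZ _ _ _) _); refine (congr1 (fun z => e *: z) _); exact: acomm1.
  by refine (etrans (presZ _ _ _) _); refine (congr1 (fun z => e' *: z) _); exact: comm1.
exact: algebra_h1_b.
Qed.

Lemma pres_b_b a b p q u v w e e' :
  pi (comm a b - comm p q - (e *: acomm u v - e' *: w)) = 0 ->
  comm (pi a) (pi b) - comm (pi p) (pi q) = e *: acomm (pi u) (pi v) - e' *: pi w.
Proof.
have -> : pi (comm a b - comm p q - (e *: acomm u v - e' *: w)) =
    comm (pi a) (pi b) - comm (pi p) (pi q) - (e *: acomm (pi u) (pi v) - e' *: pi w).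
  refine (etrans (presB _ _ _) _); refine (congr2 (fun y z => y - z) _ _).
    by refine (etrans (presB _ _ _) _); refine (congr2 (fun y z => y - z) _ _); exact: pres_comm.
  refine (etrans (presB _ _ _) _); refine (congr2 (fun y z => y - z) _ _).
    by refine (etrans (presZ _ _ _) _); refine (congr1 (fun z => e *: z) _); exact: pres_acomm.
  exact: presZ.
by move=> /eqP; rewrite subr_eq0 => /eqP.
Qed.

End PresentedTwisted.

Section TwistedRelations.
Variables (K : numFieldType) (I : finType) (af : I -> I -> K) (c : I -> I -> int).
Local Notation Trel := (Relations (@tyangian_rel_const K I af c)).
Local Notation pi := (pres_pi Trel).
Local Notation fh := (fun i => hindex (fun r => fgen K (TH i r))).

Lemma pres_pi_hindex i k : pi (fh i k) = th af c i k.
Proof. by case: k => n; rewrite /= /th /=; case: ifP => _ //; exact: (raddf0 pi). Qed.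

Lemma tyangianP :
  twisted_generators af (fun i n => th af c i n%:Z) (fun i r => tb af c i r).
Proof.
split=> [i r j s|i j s|i r s|i n].
- rewrite -!pres_pi_hindex.
  exact: etrans (esym (pres_comm Trel _ _)) (pres_rel (rel := Trel) (trel_hh af c i r j s)).
- rewrite -!pres_pi_hindex.
  exact: pres_h1_b (pres_rel (rel := Trel) (trel_hb af c i 0 j s)).
- rewrite -!pres_pi_hindex.
  have := pres_b_b (pres_rel (rel := Trel) (trel_bb af c i r i s)).
  by rewrite eqxx mulr1.
by rewrite /th /=; case: odd.
Qed.

End TwistedRelations.

Lemma coef_in_h_of_b (K : numFieldType) (A : algType K) (P : A -> Prop) d (b : nat -> A) :
  subalgebra P -> (forall s, P (b s)) -> coef_in P (h_of_b d b).
Proof.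
move=> subP Pb; have bP : coef_in P (pshift (b : pser A)) by apply: coef_in_pshift.
apply: coef_inD => //; last by apply: coef_inZ => //; apply: coef_inM.
by apply: coef_inD => //; [exact: coef_in1 | apply: coef_in_comm => //; exact: coef_in_pconst].
Qed.

(** * Separation of degrees *)

Section WeightSeparation.
Variables (K : numFieldType) (g : lieAlgType K) (I : finType) (D : lie_datum g I).
Variables (T : algType K) (z : I -> T).
Implicit Types (s : seq (rlattice I * T)).

Definition weight_vector (k : rlattice I) (t : T) : Prop :=
  forall j, comm (z j) t = rform D k j *: t.

Lemma rform_separates (k l : rlattice I) : k != l -> exists j, rform D k j != rform D l j.
Proof.
rewrite -subr_eq0 => /(rform_pos D) kl; apply: contrapT => /forallNP same.
move: kl; rewrite big1 ?ltxx // => j _.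
by move/negP/negPn/eqP: (same j) => e; rewrite rformD rformN e subrr mulr0.
Qed.

(* Lagrange interpolation in the commuting operators ad z_j projects onto a weight. *)
Lemma weight_component0 s (m : rlattice I) : (forall p, p \in s -> weight_vector p.1 p.2) ->
  \sum_(p <- s) p.2 = 0 -> \sum_(p <- s | p.1 == m) p.2 = 0.
Proof.
move=> sW s0.
have /boolp.choice[jj jjP] (k : rlattice I) : exists j : option I, k != m ->
    if j is Some j' then rform D m j' != rform D k j' else false.
  have [->|km] := eqVneq k m; first by exists None.
  by have [|j jP] := @rform_separates m k; [rewrite eq_sym | exists (Some j)].
(* The Lagrange factor attached to k: as a function of l it is 1 at m and, if k differs from m, 0 at
   k. It is realized by a multiple of ad z_j minus a scalar, with j separating k from m. *)
pose chi k l : K := if jj k is Some j then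
  (rform D l j - rform D k j) / (rform D m j - rform D k j) else 1.
have interp (ks : seq (rlattice I)) :
    \sum_(p <- s) (\prod_(k <- ks) chi k p.1) *: p.2 = 0.
  elim: ks => [|k ks IH].
    by rewrite -[RHS]s0; apply: eq_bigr => p _; rewrite big_nil scale1r.
  rewrite (eq_bigr (fun p => chi k p.1 *: ((\prod_(l <- ks) chi l p.1) *: p.2))); last first.
    by move=> p _; rewrite big_cons scalerA.
  rewrite /chi; case: (jj k) => [j|]; last first.
    by rewrite -[RHS]IH; apply: eq_bigr => p _; rewrite scale1r.
  set q := (_ - _)^-1; have adIH := congr1 (comm (z j)) IH.
  rewrite comm0r comm_sumr in adIH.
  rewrite (_ : \sum_(p <- s) _ = q *: (\sum_(p <- s) comm (z j) ((\prod_(l <- ks) chi l p.1) *: p.2)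
     - rform D k j *: \sum_(p <- s) (\prod_(l <- ks) chi l p.1) *: p.2)); last first.
    rewrite scaler_sumr -sumrB scaler_sumr big_seq [RHS]big_seq; apply: eq_bigr => p ps.
    rewrite commZr sW // !scalerA -scalerBl scalerA; congr (_ *: _); ring.
  by rewrite adIH IH scaler0 subr0 scaler0.
pose ks := [seq k <- [seq p.1 | p <- s] | k != m].
rewrite -[RHS](interp ks) big_mkcond big_seq [RHS]big_seq; apply: eq_bigr => p ps.
case: eqVneq => [->|pm].
  rewrite big_seq big1 ?scale1r // => k; rewrite mem_filter => /andP[km _].
  rewrite /chi; have := jjP k km; case: (jj k) => // j mk.
  by rewrite divff // subr_eq0.
have pks : p.1 \in ks by rewrite mem_filter pm map_f.
rewrite (big_rem _ pks) /= {1}/chi; have := jjP p.1 pm; case: (jj p.1) => // j _.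
by rewrite subrr !mul0r scale0r.
Qed.

Lemma weight_list (S : rlattice I -> Prop) (Q : rlattice I -> T -> Prop) v :
  (forall k c t, Q k t -> Q k (c *: t)) ->
  lspan (fun t => exists2 k, S k & Q k t) v ->
  exists2 s, (forall p, p \in s -> S p.1 /\ Q p.1 p.2) & v = \sum_(p <- s) p.2.
Proof.
move=> QZ; move: v; apply: lspan_ind => [|v w [s sP ->] [t tP ->]|c v [k Sk Qk]].
- by exists [::]; rewrite ?big_nil.
- by exists (s ++ t); rewrite ?big_cat // => p; rewrite mem_cat => /orP[/sP|/tP].
by exists [:: (k, c *: v)]; rewrite ?big_seq1 // => p /[!inE]/eqP -> /=; split=> //; apply: QZ.
Qed.

(** The difference of the two expansions of v is zero, hence so is each of its weight components. At
    a weight outside S only the first expansion contributes, so these terms can be deleted from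
    it. *)
Lemma weight_restrict (S : rlattice I -> Prop) (Q R : rlattice I -> T -> Prop) v :
  (forall k c t, Q k t -> Q k (c *: t)) -> (forall k c t, R k t -> R k (c *: t)) ->
  (forall k t, Q k t -> weight_vector k t) -> (forall k t, R k t -> weight_vector k t) ->
  lspan (fun t => exists2 k, True & Q k t) v -> lspan (fun t => exists2 k, S k & R k t) v ->
  lspan (fun t => exists2 k, S k & Q k t) v.
Proof.
move=> QZ RZ QW RW /(weight_list QZ)[s1 s1P v1] /(weight_list RZ)[s2 s2P v2].
pose s := s1 ++ [seq (p.1, - p.2) | p <- s2].
have sW p : p \in s -> weight_vector p.1 p.2.
  rewrite mem_cat => /orP[/s1P[_ /QW]//|/mapP[q /s2P[_ /RW qW] ->]] j /=.
  by rewrite commNr qW scalerN.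
have s0 : \sum_(p <- s) p.2 = 0.
  by rewrite big_cat big_map /= sumrN -v1 -v2 subrr.
have comp0 m : ~ S m -> \sum_(p <- s1 | p.1 == m) p.2 = 0.
  move=> Sm; have := weight_component0 m sW s0; rewrite big_cat big_map /=.
  rewrite [X in _ + X]big_seq_cond [X in _ + X]big1 ?addr0 // => p /andP[/s2P[Sp _] /eqP pm].
  by case: Sm; rewrite -pm.
rewrite v1 (bigID (fun p => `[< S p.1 >])) /=.
have -> : \sum_(p <- s1 | ~~ `[< S p.1 >]) p.2 = 0.
  pose U := undup [seq p.1 | p <- s1].
  transitivity (\sum_(m <- U | ~~ `[< S m >]) \sum_(p <- s1 | p.1 == m) p.2).
    rewrite (exchange_big_dep xpredT) //= big_mkcond big_seq [RHS]big_seq.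
    apply: eq_bigr => p ps; rewrite big_mkcondr /= big_mkcond.
    have pU : p.1 \in U by rewrite mem_undup map_f.
    rewrite (bigD1_seq p.1) ?undup_uniq //= eqxx big1 ?addr0 // => m mp.
    by rewrite eq_sym (negPf mp) if_same.
  by apply: big1 => m /asboolP; apply: comp0.
rewrite addr0 big_seq_cond; apply: lspan_sum => p /andP[/s1P[_ pQ] /asboolP pS].
by apply: lspan_gen; exists p.1.
Qed.

End WeightSeparation.

Lemma collect_h_terms (K : numFieldType) (V : lmodType K) (u v w p q r s t : V) :
  2 *: (u + v + w - t) - (p + q + 2 *: w) + (r + s + 2 *: t) =
  2 *: u - p + r + (2 *: v - q) + s.
Proof.
rewrite scalerBr !scalerDr !opprD.
rewrite [LHS](AC (4*3*3) ((1*5*8*(2*6)*9)*(3*7)*(4*10))) /= subrr addNr.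
by rewrite !addr0.
Qed.

(** * Congruences for the currents *)

Section SubalgebraMaps.
Variables (K : fieldType) (A B : algType K) (f : {lrmorphism A -> B}).

Lemma image_subalgebra : subalgebra (fun t => exists a, t = f a).
Proof.
split=> [|_ _ [a ->] [c ->]|e _ [a ->]|_ _ [a ->] [c ->]].
- by exists 1; rewrite rmorph1.
- by exists (a + c); rewrite rmorphD.
- by exists (e *: a); rewrite linearZ.
- by exists (a * c); rewrite rmorphM.
Qed.

Lemma preimage_subalgebra (P : B -> Prop) : subalgebra P -> subalgebra (fun a => P (f a)).
Proof.
move=> subP; split=> [|a c Pa Pc|e a Pa|a c Pa Pc].
- by rewrite rmorph1; apply: subalgebra1.
- by rewrite rmorphD; apply: subalgebraD.
- by rewrite linearZ; apply: subalgebraZ.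
- by rewrite rmorphM; apply: subalgebraM.
Qed.

End SubalgebraMaps.

Section DrinfeldEstimates.
Variables (K : numFieldType) (g : lieAlgType K) (I : finType) (D : lie_datum g I).
Variables (Y T iY : algType K).
Local Notation af := (sform D).
Local Notation roots := (posroots D).
Variables (x : bool -> I -> nat -> Y) (xi : I -> nat -> Y) (h b : I -> nat -> iY).
Hypothesis Yrel : yangian_generators af x xi.
Hypothesis iYrel : twisted_generators af h b.

Variable G : rlattice I -> Y -> Prop.
Hypotheses (G0 : forall k, G k 0) (GD : forall k y z, G k y -> G k z -> G k (y + z)).
Hypothesis GZ : forall k a y, G k y -> G k (a *: y).
Hypothesis GM : forall k l y z, G k y -> G l z -> G (k + l) (y * z).
Hypothesis G1 : G 0 1.
Hypotheses (G_xp : forall j s, G (rdelta j) (x true j s)).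
Hypotheses (G_xm : forall j s, G (- rdelta j) (x false j s)).
Hypotheses (G_xi : forall j s, G 0 (xi j s)).
Hypothesis G_weight : forall k y j, G k y -> comm (xi j 0%N) y = rform D k j *: y.

Variable iota : {linear g -> Y}.
Hypothesis iota_lieb : forall y z, iota (lieb y z) = comm (iota y) (iota z).
Hypothesis iota_x : forall e j, iota (chev D e j) = x e j 0%N.
Hypothesis iota_chevxi : forall j, iota (chevxi D j) = xi j 0%N.

Variables tl tr : {lrmorphism Y -> T}.
Hypothesis tl_tr : forall y z, GRing.comm (tl y) (tr z).

Variable Delta : {lrmorphism Y -> T}.
Hypothesis Delta_iota : forall z, Delta (iota z) = tl (iota z) + tr (iota z).
Hypothesis Delta_xi : forall j, Delta (xi j 1%N) = tl (xi j 1%N) + tr (xi j 1%N) +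
  tl (xi j 0%N) * tr (xi j 0%N) -
  \sum_(a <- roots) rform D a j *: (tl (iota (rvec D false a)) * tr (iota (rvec D true a))).

Variable phi : {lrmorphism iY -> Y}.
Hypothesis phi_b : forall j, phi (b j 0%N) = x true j 0%N - x false j 0%N.
Hypothesis phi_h : forall j, phi (h j 1%N) = 2 *: xi j 1%N - xi j 0%N * xi j 0%N +
  \sum_(a <- roots) rform D a j *: (iota (rvec D true a) * iota (rvec D true a)).

Variables (i : I) (cw : I -> K).
Hypothesis cwP : forall l : I, \sum_j cw j * af j l = (i == l)%:R.

Local Notation d := (af i i / 2).
Local Notation X a := (iota (rvec D true a)).
Local Notation B a := (iota (rvec D true a - rvec D false a)).
Local Notation Xi := (Xi_cw xi cw).
Local Notation Qp := (@Qplus I).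

Definition hl : iY := \sum_j cw j *: h j 1%N.

Lemma hl_b s : comm hl (b i s) = 2 *: b i s.+1.
Proof.
rewrite comm_suml (eq_bigr (fun j => (2 * (cw j * af j i)) *: b i s.+1)) => [|j _].
  by rewrite -scaler_suml -mulr_sumr cwP eqxx mulr1.
by rewrite commZl (tg_h1_b iYrel) scalerA mulrCA.
Qed.
Lemma hl_h n : comm hl (h i n) = 0.
Proof.
by rewrite comm_suml big1 // => j _; rewrite commZl (tg_h_h iYrel) scaler0.
Qed.

Lemma b_rec s : b i s.+1 = 2^-1 *: comm hl (b i s).
Proof. by rewrite hl_b scalerA mulVf ?pnatr_eq0 // scale1r. Qed.

Lemma cw_root (a : rlattice I) : \sum_j cw j * rform D a j = (a i)%:~R.
Proof.
rewrite (eq_bigr (fun j => \sum_l (a l)%:~R * (cw j * af j l))) => [|j _]; last first.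
  by rewrite mulr_sumr; apply: eq_bigr => l _; rewrite mulrCA (sformC D l).
rewrite exchange_big (bigD1 i) //= -mulr_sumr cwP eqxx mulr1 big1 ?addr0 // => l li.
by rewrite -mulr_sumr cwP eq_sym (negPf li) mulr0.
Qed.

Lemma cw_sum (V : lmodType K) (v : rlattice I -> V) :
  \sum_j cw j *: (\sum_(a <- roots) rform D a j *: v a) = \sum_(a <- roots) (a i)%:~R *: v a.
Proof.
under eq_bigr do rewrite scaler_sumr; rewrite exchange_big; apply: eq_bigr => a _ /=.
by rewrite -cw_root scaler_suml; apply: eq_bigr => j _; rewrite scalerA.
Qed.

Lemma cw_Xi : \sum_j cw j *: (2 *: xi j 1%N - xi j 0%N * xi j 0%N) = 2 *: Xi.
Proof.
rewrite /Xi_cw scaler_sumr; apply: eq_bigr => j _.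
rewrite scalerA mulrC -scalerA; congr (_ *: _).
by rewrite scalerBr scalerA mulfV ?pnatr_eq0 // scale1r.
Qed.

Lemma linear_hl (V : lmodType K) (f : {linear iY -> V}) : f hl = \sum_j cw j *: f (h j 1%N).
Proof. by rewrite linear_sum; apply: eq_bigr => j _; rewrite linearZ. Qed.

Lemma phi_hl : phi hl = 2 *: Xi + \sum_(a <- roots) (a i)%:~R *: (X a * X a).
Proof.
rewrite linear_hl /= -cw_Xi -cw_sum -big_split; apply: eq_bigr => j _.
by rewrite phi_h scalerDr.
Qed.

Lemma tl_tr_square y z : (tl y + tr z) * (tl y + tr z) =
  tl (y * y) + tr z * tr z + 2 *: (tl y * tr z).
Proof.
rewrite rmorphM scaler_nat mulr2n mulrDl !mulrDr -(tl_tr y z).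
by rewrite [LHS](AC (2*2) (1*4*(2*3))).
Qed.

(** The cross term of the square of xi_j cancels 2 xi_j (x) xi_j from the coproduct of 2 xi_{j,1}.
    The cross term 2 x_al^+ (x) x_al^+ of the squared root vector combines with -2 x_al^- (x) x_al^+
    into 2 B_al (x) X_al. *)
Lemma Delta_h j : Delta (phi (h j 1%N)) = tl (phi (h j 1%N)) +
  (2 *: tr (xi j 1%N) - tr (xi j 0%N) * tr (xi j 0%N)) +
  \sum_(a <- roots) rform D a j *: (tr (X a) * tr (X a) + 2 *: (tl (B a) * tr (X a))).
Proof.
have root_part a : rform D a j *: (Delta (X a) * Delta (X a)) =
    rform D a j *: tl (X a * X a) + rform D a j *: (tr (X a) * tr (X a) +
    2 *: (tl (B a) * tr (X a))) +
    2 *: (rform D a j *: (tl (iota (rvec D false a)) * tr (X a))).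
  rewrite Delta_iota tl_tr_square -addrA scalerDr -[RHS]addrA; congr (_ + _).
  rewrite scalerA mulrC -scalerA -scalerDr -addrA; congr (_ *: (_ + _)).
  by rewrite -scalerDr -mulrDl raddfB /= linearB /= subrK.
have xi_part : Delta (xi j 0%N) * Delta (xi j 0%N) =
    tl (xi j 0%N * xi j 0%N) + tr (xi j 0%N) * tr (xi j 0%N) + 2 *: (tl (xi j 0%N) * tr (xi j 0%N)).
  by rewrite -iota_chevxi Delta_iota iota_chevxi tl_tr_square rmorphM.
have map_phi (f : {lrmorphism Y -> T}) : f (phi (h j 1%N)) = 2 *: f (xi j 1%N) -
    f (xi j 0%N) * f (xi j 0%N) + \sum_(a <- roots) rform D a j *: (f (X a) * f (X a)).
  rewrite phi_h linearD /= linearB /= linearZ /= rmorphM linear_sum; congr (_ + _).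
  by apply: eq_bigr => a _; rewrite linearZ /= rmorphM.
rewrite !map_phi (eq_bigr _ (fun a _ => root_part a)) !big_split /= -scaler_sumr Delta_xi xi_part.
set S1 := \sum_(a <- roots) _ *: tl (X _ * X _); set S2 := \sum_(a <- roots) _ *: (_ + 2 *: _).
have -> : \sum_(a <- roots) rform D a j *: (tl (X a) * tl (X a)) = S1.
  by apply: eq_bigr => a _; rewrite rmorphM.
rewrite rmorphM; move: (\sum_(a <- roots) _ *: (tl (iota (rvec D false a)) * _)) => S3.
exact: collect_h_terms.
Qed.

Lemma Delta_hl : Delta (phi hl) = tl (phi hl) + 2 *: tr Xi +
  \sum_(a <- roots) (a i)%:~R *: (tr (X a) * tr (X a) + 2 *: (tl (B a) * tr (X a))).
Proof.
pose Dphi : {lrmorphism iY -> T} := Delta \o phi.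
pose tlphi : {lrmorphism iY -> T} := tl \o phi.
have -> : Delta (phi hl) = \sum_j cw j *: Delta (phi (h j 1%N)) by exact: (linear_hl Dphi).
have -> : tl (phi hl) = \sum_j cw j *: tl (phi (h j 1%N)) by exact: (linear_hl tlphi).
have -> : 2 *: tr Xi = \sum_j cw j *: (2 *: tr (xi j 1%N) - tr (xi j 0%N) * tr (xi j 0%N)).
  rewrite -linearZ /= -cw_Xi linear_sum; apply: eq_bigr => j _.
  by rewrite linearZ /= linearB /= linearZ /= rmorphM.
rewrite -cw_sum -!big_split; apply: eq_bigr => j _ /=.
by rewrite Delta_h !scalerDr.
Qed.

Lemma root_Qplus a : a \in roots -> Qp a.
Proof.
move=> /posrootsP[[a0 _] a_ge0]; apply: Qplus_neq0 => //.
by apply: contra_neq a0 => ->; apply: weight0.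
Qed.
Lemma root_vector a : a \in roots -> gsp D a (rvec D true a) /\ gsp D (- a) (rvec D false a).
Proof. by move=> /rvec_root[p n]; split=> //; rewrite /gsp weightN. Qed.
Lemma simple_root_in j : rdelta j \in roots.
Proof.
apply/posrootsP; split; last by move=> l; rewrite ffunE.
by rewrite weight_delta; have [_ sr _] := srootP D.
Qed.
Lemma X_simple j : X (rdelta j) = x true j 0%N.
Proof. by rewrite rvec_simple iota_x. Qed.
Lemma X_double_root j : rdelta j + rdelta j \in roots -> X (rdelta j + rdelta j) = 0.
Proof. by move=> /root_vector[/double_root_space -> _]; apply: linear0. Qed.
Lemma X_homog a : a \in roots -> G a (X a).
Proof. by move=> aR; apply: iota_homog (root_Qplus aR) (root_vector aR).1. Qed.
(** The inner bracket lies in the image of the root space of a - alpha_i, which no longer contains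
    alpha_i, so [iota_away] applies. *)
Lemma X_y_y a s : a \in roots -> a i = 1 -> a != rdelta i ->
  comm (comm (X a) (x false i 0%N)) (x false i s) = 0.
Proof.
move=> aR ai ne; have [aX _] := root_vector aR; rewrite -iota_x -iota_lieb.
have zX := gsp_lieb aX (gsp_xm i).
have zQ : Qplus (a - rdelta i).
  apply: Qplus_neq0; last by rewrite subr_eq0.
  move=> j; rewrite !ffunE; case: eqP => [<-|_]; first by rewrite ai.
  by rewrite subr0; apply: (root_Qplus aR).1.
have zi : (a - rdelta i) i = 0 by rewrite !ffunE eqxx ai subrr.
by have [-> _] := iota_away Yrel cwP iota_lieb iota_x zQ zX zi.
Qed.
Lemma Xi_X_y a s : a \in roots -> a i = 1 -> comm Xi (comm (X a) (x false i s)) = 0.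
Proof.
by move=> aR; apply: (iota_once Yrel cwP iota_lieb iota_x s (root_Qplus aR) (root_vector aR).1).
Qed.

Let str := yangian_index_string Yrel cwP.

Definition scalar_elt (y : Y) : Prop := exists c : K, y = c *: 1.
Lemma scalar_elt_subalgebra : subalgebra scalar_elt.
Proof.
split=> [|_ _ [a ->] [c ->]|e _ [a ->]|_ _ [a ->] [c ->]].
- by exists 1; rewrite scale1r.
- by exists (a + c); rewrite scalerDl.
- by exists (e * a); rewrite scalerA.
- by exists (a * c); rewrite -scalerAl mul1r scalerA.
Qed.

Lemma scalar_elt_comm a (z : Y) : scalar_elt a -> GRing.comm a z.
Proof. by move=> [c ->]; apply/commr_sym/commr_scale/commr1. Qed.

Lemma scalar_elt0 : scalar_elt 0. Proof. by exists 0; rewrite scale0r. Qed.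

Local Notation zb := (fun _ : nat => 0 : Y).
Local Notation zB := (fun _ : rlattice I => 0 : Y).

Lemma pshift_zero : pshift (zb : pser Y) = 0.
Proof. exact: (pshift0 Y). Qed.
Lemma h_of_b_zero (e : K) : h_of_b e zb = 1.
Proof.
by rewrite /h_of_b pshift_zero comm0r addr0 [(0 : pser Y) * 0]mul0r scaler0 addr0.
Qed.
(** The case of scalars in the first place: with H, b and all B_al equal to 0, [Vpart] vanishes and
    [Cpart] reduces to E. *)
Lemma Bapprox_zero : Bapprox i d (x true i) (x false i) (xi i) 0 zb roots zB (fun a => X a) =
  pshift (x_neg (x false i)) + half_acomm (x true i) (xi i).
Proof.
have beta0 a : beta 0 zB a = 0.
  rewrite /beta -[RHS](pshift0 Y); congr pshift; apply: funext => s.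
  by elim: s => //= s ->; rewrite comm0r scaler0.
rewrite /Bapprox /Vpart /Cpart h_of_b_zero [1 * _]mul1r pshift_zero [(0 : pser Y) * 0]mul0r.
rewrite [0 * comm _ _]mul0r scaler0 addr0 add0r big1 ?addr0 // => a _.
by rewrite beta0 [LHS]mul0r.
Qed.
Lemma Htotal_zero : Htotal i Xi 0 roots zB (fun a => X a) = phi hl.
Proof.
rewrite /Htotal phi_hl add0r; congr (_ + _); apply: eq_bigr => a _.
by rewrite mul0r scaler0 addr0.
Qed.

Lemma Xi_deg : G 0 Xi.
Proof.
rewrite /Xi_cw; elim/big_ind: _ => [|y z|j _]; [exact: G0 | exact: GD | apply/GZ/GD => //].
by rewrite -scaleN1r; do 2 apply: GZ; rewrite -[0]addr0; apply: GM.
Qed.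

Lemma phi_b_rec s : phi (b i s.+1) = 2^-1 *: comm (phi hl) (phi (b i s)).
Proof. by rewrite b_rec linearZ /= rmorph_commutator. Qed.

Local Notation bY := (fun s => phi (b i s)).

Lemma phi_b_estimate : sgspan G (shift_set Qp (rdelta i))
  (pshift (bY : pser Y) - (pshift (x_neg (x false i)) + half_acomm (x true i) (xi i))).
Proof.
rewrite -Bapprox_zero.
apply: (current_approx GM str scalar_elt_subalgebra (second := fun _ => True)) => //.
- by move=> a z /scalar_elt_comm.
- by move=> _ [c ->]; apply/GZ/G1.
- exact: Xi_deg.
- exact: scalar_elt0.
- by move=> _; apply: scalar_elt0.
- by move=> _ _; apply: scalar_elt0.
- exact: X_homog.
- by move=> s; rewrite comm0l scaler0.
- exact: root_Qplus.
- exact: posroots_uniq.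
- exact: simple_root_in.
- exact: X_simple.
- exact: X_double_root.
- by move=> a s; apply: Xi_X_y.
- by move=> n; rewrite comm0l.
- by rewrite phi_b add0r.
- by move=> s; rewrite Htotal_zero; apply: phi_b_rec.
Qed.

Lemma phi_h_estimate :
  sgspan G Qp (smap phi (h_series h i) - xi_plus (xi i) * xi_minus (xi i)).
Proof.
rewrite (h_series_of_b iYrel) smap_h_of_b -[xi_plus (xi i) * _]mul1r -(h_of_b_zero d).
apply: (current_h GM str scalar_elt_subalgebra (second := fun _ => True) _ _ _ _ _ _ _ _ _ _ _
  (H := 0) (roots := roots) (B := zB) (X := fun a => X a)) => //.
- by move=> a z /scalar_elt_comm.
- by move=> _ [c ->]; apply/GZ/G1.
- exact: Xi_deg.
- exact: scalar_elt0.
- by move=> _; apply: scalar_elt0.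
- by move=> _ _; apply: scalar_elt0.
- exact: X_homog.
- by move=> s; rewrite comm0l scaler0.
- exact: root_Qplus.
- exact: posroots_uniq.
- exact: simple_root_in.
- exact: X_simple.
- exact: X_double_root.
- by move=> a s; apply: X_y_y.
- by move=> a s; apply: Xi_X_y.
- by move=> n; rewrite comm0l.
- by rewrite /smap phi_b add0r.
- by move=> s; rewrite Htotal_zero; apply: phi_b_rec.
Qed.

(** Only the second factor is graded and the first is arbitrary in Y. Membership of the first factor
    in the twisted Yangian is recovered by [coideal_restrict]. *)
Definition GT (k : rlattice I) : T -> Prop :=
  lspan (fun t => exists a y, G k y /\ t = tl a * tr y).

Lemma tl_tr_mul a y a' y' : tl a * tr y * (tl a' * tr y') = tl (a * a') * tr (y * y').
Proof. by rewrite !rmorphM !mulrA; congr (_ * _); rewrite -!mulrA; congr (_ * _); rewrite tl_tr. Qed.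

Lemma GT_mul k l t u : GT k t -> GT l u -> GT (k + l) (t * u).
Proof.
apply: lspanM => {}t {}u [a [y [yk ->]]] [a' [y' [yl ->]]]; exists (a * a'), (y * y').
by split; [exact: GM | exact: tl_tr_mul].
Qed.
Lemma GT_tl a : GT 0 (tl a).
Proof. by apply: lspan_gen; exists a, 1; rewrite rmorph1 mulr1. Qed.
Lemma GT_tr k y : G k y -> GT k (tr y).
Proof. by move=> yk; apply: lspan_gen; exists 1, y; rewrite rmorph1 mul1r. Qed.

Lemma weight_vector_tl_tr k a y : G k y ->
  weight_vector D (fun j => tr (xi j 0%N)) k (tl a * tr y).
Proof.
move=> yk j; rewrite commMr -rmorph_commutator (G_weight j yk) /= linearZ /= -scalerAr.
by rewrite (comm_eq0 (commr_sym (tl_tr _ _))) mul0r add0r.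
Qed.
Lemma weight_vector_GT k t : GT k t -> weight_vector D (fun j => tr (xi j 0%N)) k t.
Proof.
move=> tk j; move: t tk; apply: lspan_ind => [|t u tj uj|c _ [a [y [yk ->]]]].
- by rewrite comm0r scaler0.
- by rewrite commDr tj uj scalerDr.
by rewrite commZr (weight_vector_tl_tr a yk) !scalerA mulrC.
Qed.

Local Notation bT := (fun s => Delta (phi (b i s))).
Local Notation bL := (fun s => tl (phi (b i s))).
Local Notation eta := (xi_minus (xi i)).

Lemma Delta_b_rec s : Delta (phi (b i s.+1)) = 2^-1 *: comm (Delta (phi hl)) (Delta (phi (b i s))).
Proof. by rewrite phi_b_rec linearZ /= rmorph_commutator. Qed.
Lemma Delta_b0 : Delta (phi (b i 0%N)) = tl (phi (b i 0%N)) + tr (x true i 0%N) - tr (x false i 0%N).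
Proof.
rewrite phi_b !raddfB /= -!iota_x !Delta_iota.
by rewrite opprD addrACA addrA.
Qed.
Lemma tl_hl_h n : comm (tl (phi hl)) (h_of_b d bL n) = 0.
Proof.
pose tlphi : {lrmorphism iY -> T} := tl \o phi.
rewrite -(smap_h_of_b tlphi d (b i)) -(h_series_of_b iYrel) /smap.
rewrite -[tl (phi hl)]/(tlphi hl) -rmorph_commutator.
rewrite (_ : comm hl _ = 0) ?rmorph0 //.
by case: n => [|n]; [exact: comm1r | exact: hl_h].
Qed.
Lemma B_simple : B (rdelta i) = phi (b i 0%N).
Proof. by rewrite !rvec_simple linearB /= !iota_x phi_b. Qed.

Let strT := yangian_string_map tr str.

Lemma Delta_b_estimate : sgspan GT Qp (pshift (bT : pser T) -
  (pshift (bL : pser T) * xi_minus (tr \o xi i) + pshift (x_neg (tr \o x false i)))).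
Proof.
apply: (current_leading GT_mul strT (image_subalgebra tl) (image_subalgebra tr) _ _ _ _ _ _ _ _ _ _
  (H := tl (phi hl)) (roots := roots) (B := fun a => tl (B a)) (X := fun a => tr (X a))) => //.
- by move=> _ _ [a ->] [z ->].
- by move=> _ [a ->]; apply: GT_tl.
- by move=> s; exists (x true i s).
- by move=> s; exists (x false i s).
- by move=> s; exists (xi i s).
- by exists Xi.
- by move=> s; apply/GT_tr/G_xp.
- by move=> s; apply/GT_tr/G_xm.
- by move=> s; apply/GT_tr/G_xi.
- exact/GT_tr/Xi_deg.
- by exists (phi hl).
- by move=> s; exists (phi (b i s)).
- by move=> a _; exists (B a).
- by move=> a _; exists (X a).
- by move=> a aR; apply/GT_tr/X_homog.
- by move=> s; rewrite -!rmorph_commutator hl_b /= !linearZ.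
- exact: root_Qplus.
- exact: posroots_uniq.
- exact: simple_root_in.
- by rewrite B_simple.
- by rewrite X_simple.
- by move=> /X_double_root ->; apply: rmorph0.
- by move=> a s aR ai; rewrite /= -!rmorph_commutator Xi_X_y ?rmorph0.
- exact: tl_hl_h.
- exact: Delta_b0.
- by move=> s; rewrite /Htotal -Delta_hl Delta_b_rec.
Qed.

Lemma Delta_h_estimate : sgspan GT Qp (h_of_b d bT -
  h_of_b d bL * (xi_plus (tr \o xi i) * xi_minus (tr \o xi i))).
Proof.
apply: (current_h GT_mul strT (image_subalgebra tl) (image_subalgebra tr) _ _ _ _ _ _ _ _ _ _
  (H := tl (phi hl)) (roots := roots) (B := fun a => tl (B a)) (X := fun a => tr (X a))) => //.
- by move=> _ _ [a ->] [z ->].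
- by move=> _ [a ->]; apply: GT_tl.
- by move=> s; exists (x true i s).
- by move=> s; exists (x false i s).
- by move=> s; exists (xi i s).
- by exists Xi.
- by move=> s; apply/GT_tr/G_xp.
- by move=> s; apply/GT_tr/G_xm.
- by move=> s; apply/GT_tr/G_xi.
- exact/GT_tr/Xi_deg.
- by exists (phi hl).
- by move=> s; exists (phi (b i s)).
- by move=> a _; exists (B a).
- by move=> a _; exists (X a).
- by move=> a aR; apply/GT_tr/X_homog.
- by move=> s; rewrite -!rmorph_commutator hl_b /= !linearZ.
- exact: root_Qplus.
- exact: posroots_uniq.
- exact: simple_root_in.
- by rewrite B_simple.
- by rewrite X_simple.
- by move=> /X_double_root ->; apply: rmorph0.
- by move=> a s aR ai ane; rewrite /= -!rmorph_commutator X_y_y ?rmorph0.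
- by move=> a s aR ai; rewrite /= -!rmorph_commutator Xi_X_y ?rmorph0.
- exact: tl_hl_h.
- exact: Delta_b0.
- by move=> s; rewrite /Htotal -Delta_hl Delta_b_rec.
Qed.

(** The Chevalley involution sends x_a^+ to -x_a^-, so this is a symmetrized root vector. The image
    of [phi] contains all x_j^+ - x_j^- and is closed under brackets with them, as
    [omega_symmetrized] demands. *)
Lemma B_coideal a : a \in roots -> exists a', B a = phi a'.
Proof.
move=> aR; have <- : rvec D true a + omega D (rvec D true a) = rvec D true a - rvec D false a.
  by rewrite rvec_omega.
apply: (omega_symmetrized (P := fun y => exists a', iota y = phi a') _ _ _ _ _
  (root_Qplus aR) (root_vector aR).1).
- by exists 0; rewrite linear0 rmorph0.
- by move=> y z [u yu] [v zv]; exists (u + v); rewrite linearD rmorphD yu zv.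
- by move=> c y [u yu]; exists (c *: u); rewrite !linearZ /= yu.
- by move=> j; exists (b j 0%N); rewrite linearB /= !iota_x phi_b.
move=> j y [u yu]; exists (comm (b j 0%N) u).
by rewrite iota_lieb linearB /= !iota_x yu rmorph_commutator /= phi_b.
Qed.

Definition coideal_part (k : rlattice I) (t : T) : Prop :=
  exists a y, G k y /\ t = tl (phi a) * tr y.
Local Notation Cspan S := (lspan (fun t => exists2 k, S k & coideal_part k t)).
Local Notation Call := (Cspan (fun _ => True)).

Lemma coideal_subalgebra : subalgebra Call.
Proof.
split=> [|t u|c t|].
- apply: lspan_gen; exists 0 => //; exists 1, 1; split; first exact: G1.
  by rewrite !rmorph1 mulr1.
- exact: lspanD.
- exact: lspanZ.
move=> t u; apply: lspanM => {}t {}u [k _ [a [y [yk ->]]]] [l _ [a' [y' [yl ->]]]].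
exists (k + l) => //; exists (a * a'), (y * y'); split; first exact: GM.
by rewrite tl_tr_mul -rmorphM.
Qed.
Let Csub := coideal_subalgebra.

Lemma coideal_tl a : Call (tl (phi a)).
Proof.
apply: lspan_gen; exists 0 => //; exists a, 1; split; first exact: G1.
by rewrite rmorph1 mulr1.
Qed.
Lemma coideal_tr k y : G k y -> Call (tr y).
Proof. by move=> yk; apply: lspan_gen; exists k => //; exists 1, y; rewrite !rmorph1 mul1r. Qed.

Lemma coideal_tr_hl : Call (tr (phi hl)).
Proof.
have Rsub := preimage_subalgebra tr Csub.
rewrite phi_hl; apply: (subalgebraD Rsub).
  exact: (subalgebraZ Rsub) (coideal_tr Xi_deg).
rewrite big_seq; apply: (subalgebra_sum Rsub) => a aR; apply: (subalgebraZ Rsub).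
have Ca := coideal_tr (X_homog aR); exact: (subalgebraM Rsub Ca Ca).
Qed.
Lemma coideal_tr_b s : Call (tr (phi (b i s))).
Proof.
have Rsub := preimage_subalgebra tr Csub.
elim: s => [|s IH].
  rewrite phi_b; apply: (subalgebraB Rsub); [exact: coideal_tr (G_xp _ _) | exact: coideal_tr (G_xm _ _)].
rewrite phi_b_rec; apply: (subalgebraZ Rsub).
exact: (subalgebra_comm Rsub coideal_tr_hl IH).
Qed.
(** In [Delta_hl] the first factors of the mixed terms are the B_a, which lie in the twisted
    Yangian. Through the recursion for b_{i,s} the same then holds for the coproduct of every
    b_{i,s}. *)
Lemma coideal_Delta_hl : Call (Delta (phi hl)).
Proof.
rewrite Delta_hl; apply: (subalgebraD Csub).
  apply: (subalgebraD Csub); first exact: coideal_tl.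
  exact: (subalgebraZ Csub _ (coideal_tr Xi_deg)).
rewrite big_seq; apply: (subalgebra_sum Csub) => a aR; apply: (subalgebraZ Csub).
have Ca := coideal_tr (X_homog aR); have [a' Ba] := B_coideal aR.
apply: (subalgebraD Csub); first exact: (subalgebraM Csub Ca Ca).
apply: (subalgebraZ Csub); apply: (subalgebraM Csub) Ca.
by rewrite Ba; apply: coideal_tl.
Qed.
Lemma coideal_Delta_b s : Call (Delta (phi (b i s))).
Proof.
elim: s => [|s IH]; last first.
  rewrite Delta_b_rec; apply: (subalgebraZ Csub).
  exact: (subalgebra_comm Csub coideal_Delta_hl IH).
rewrite Delta_b0; apply: (subalgebraB Csub); last exact: coideal_tr (G_xm _ _).
by apply: (subalgebraD Csub); [exact: coideal_tl | exact: coideal_tr (G_xp _ _)].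
Qed.
Lemma coideal_tr_xi s : Call (tr (xi i s)). Proof. exact: coideal_tr (G_xi _ _). Qed.

Lemma coideal_restrict S t : Call t -> lspan (fun u => exists2 k, S k & GT k u) t -> Cspan S t.
Proof.
apply: (weight_restrict (D := D) (z := fun j => tr (xi j 0%N))) => [k c u [a [y [yk ->]]]|k c u|k u|k u].
- by exists a, (c *: y); rewrite linearZ /= scalerAr; split=> //; apply: GZ.
- exact: lspanZ.
- by move=> [a [y [yk ->]]]; apply: weight_vector_tl_tr.
- exact: weight_vector_GT.
Qed.

Lemma xi_plus_map : xi_plus (tr \o xi i) = smap tr (xi_plus (xi i)).
Proof. by apply: funext => -[|n] //=; rewrite /smap /= rmorph1. Qed.
Lemma xi_minus_map : xi_minus (tr \o xi i) = smap tr eta.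
Proof.
apply: funext => n; rewrite [LHS]/(series_neg _ _) xi_plus_map.
by rewrite /smap /xi_minus /series_neg linearZ.
Qed.

Lemma coideal_Delta_h n :
  Cspan Qp ((smap (Delta \o phi) (h_series h i) -
    smap (tl \o phi) (h_series h i) * smap tr (xi_plus (xi i) * eta)) n).
Proof.
rewrite (h_series_of_b iYrel) !smap_h_of_b smapM -xi_plus_map -xi_minus_map.
apply: coideal_restrict; last exact: Delta_h_estimate.
have hC f : (forall s, Call (f s)) -> coef_in Call (h_of_b d f) by exact: coef_in_h_of_b.
have xiC : coef_in Call (xi_plus (tr \o xi i)).
  by case=> [|r]; [exact: subalgebra1 Csub | exact: coideal_tr_xi].
apply: (coef_inB Csub); first exact/hC/coideal_Delta_b.
apply: (coef_inM Csub); first by apply: hC => s; apply: coideal_tl.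
apply: (coef_inM Csub) => // r; exact: (subalgebraZ Csub _ (xiC r)).
Qed.

Lemma half_acomm_Qp : sgspan G Qp (half_acomm (x true i) (xi i)).
Proof.
apply: sgspanZ; apply: (sgspan_acomm GM (S := eq (rdelta i)) (T := eq 0)).
- by move=> _ _ <- <-; rewrite addr0; apply: Qplus_delta.
- by apply: sgspan_pshift => r; apply: gspan_gen (G_xp i r).
case=> [|r]; apply: lspanZ; first exact: gspan_gen G1.
exact: gspan_gen (G_xi i r).
Qed.

Lemma tr_span S f : sgspan G S f -> sgspan GT S (smap tr f).
Proof.
move=> fS n; move: (fS n); rewrite /smap.
apply: (lspan_ind (Q := fun y => gspan GT S (tr y))) => [|y z|c y [k Sk yk]].
- by rewrite rmorph0; apply: lspan0.
- by rewrite rmorphD; apply: lspanD.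
by rewrite linearZ; apply: lspanZ; apply: gspan_gen Sk (GT_tr yk).
Qed.

(** [Delta_b_estimate] has x_i^-(-u) in the second factor where the claim has b_i(u). By
    [phi_b_estimate] these differ by E, of degree alpha_i, up to alpha_i + Q_+; both lie in Q_+. *)
Lemma coideal_Delta_b_series n :
  Cspan Qp ((smap (Delta \o phi) (pshift (b i : pser iY)) -
    (smap (tl \o phi) (pshift (b i : pser iY)) * smap tr eta +
     smap (tr \o phi) (pshift (b i : pser iY)))) n).
Proof.
rewrite !smap_pshift -xi_minus_map.
set bD := smap _ _; set bl := smap _ _; set br := smap _ _.
apply: coideal_restrict.
  have xiC : coef_in Call (xi_minus (tr \o xi i)).
    case=> [|r]; apply: (subalgebraZ Csub); [exact: subalgebra1 Csub | exact: coideal_tr_xi].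
  apply: (coef_inB Csub); first exact: coef_in_pshift coideal_Delta_b.
  apply: (coef_inD Csub); last exact: coef_in_pshift coideal_tr_b.
  by apply: (coef_inM Csub) => //; apply: coef_in_pshift => // s; apply: coideal_tl.
have est := Delta_b_estimate; have est2 := tr_span phi_b_estimate.
set E := half_acomm _ _ in est2; set F := pshift (x_neg _) in est2.
have FE : smap tr F = pshift (x_neg (tr \o x false i)).
  by rewrite smap_pshift; congr pshift; apply: funext => s; rewrite /smap linearZ.
have -> : pshift bD - (pshift bl * xi_minus (tr \o xi i) + pshift br) =
    (pshift bD - (pshift bl * xi_minus (tr \o xi i) + smap tr F)) -
    (pshift br - (smap tr F + smap tr E)) - smap tr E.
  rewrite !opprD !opprK; rewrite [RHS](AC ((1*2)*(1*2)*1) (1*(2*4)*(3*5)*(6*7))) /=.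
  by rewrite addNr subrr !addr0.
have est2' : sgspan GT Qp (pshift br - (smap tr F + smap tr E)).
  have -> : pshift br = smap tr (pshift (bY : pser Y)) by rewrite smap_pshift.
  rewrite -smapD -smapB; apply: sgspan_sub est2.
  by move=> k kN; rewrite -(subrK (rdelta i) k); apply: Qplus_addr kN _; apply: (Qplus_delta i).1.
apply: sgspanB; last exact: tr_span half_acomm_Qp.
by apply: sgspanB est2'; rewrite FE.
Qed.

End DrinfeldEstimates.

(** * Application to the presented algebras *)

Section WeightGrading.
Variables (K : numFieldType) (g : lieAlgType K) (I : finType) (D : lie_datum g I).
Variables (Y : algType K) (gen : ygen I -> Y).
Hypothesis Yrel : yangian_generators (sform D) (fun e i r => gen (YX e i r)) (fun i r => gen (YXi i r)).

Lemma rform0 j : rform D 0 j = 0.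
Proof. by rewrite /rform big1 // => l _; rewrite ffunE mul0r. Qed.

Lemma word_weight j (w : seq (ygen I)) :
  comm (gen (YXi j 0)) (\prod_(t <- w) gen t) =
  rform D (\sum_(t <- w) ydeg t) j *: \prod_(t <- w) gen t.
Proof.
elim: w => [|t w IH]; first by rewrite !big_nil comm1r rform0 scale0r.
rewrite !big_cons commMr IH rformD scalerDl -scalerAr; congr (_ + _).
rewrite [RHS]scalerAl; congr (_ * _); case: t => [e k r|k r] /=.
  rewrite (yg_xi0_x Yrel) (sformC D j); case: e; by rewrite ?rformN rform_delta ?mulN1r ?mul1r.
by rewrite (yg_xi_xi Yrel) rform0 scale0r.
Qed.

Lemma span_weight k y j :
  lspan (fun z => exists w, \sum_(t <- w) ydeg t = k /\ z = \prod_(t <- w) gen t) y ->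
  comm (gen (YXi j 0)) y = rform D k j *: y.
Proof.
move: y; apply: lspan_ind => [|y z yj zj|c _ [w [<- ->]]].
- by rewrite comm0r scaler0.
- by rewrite commDr yj zj scalerDr.
by rewrite commZr word_weight !scalerA mulrC.
Qed.

End WeightGrading.

Lemma h_serE (K : numFieldType) (I : finType) (af : I -> I -> K) c i :
  h_ser af c i = h_series (fun j n => th af c j n%:Z) i.
Proof.
apply: funext => -[|n] //; apply: (congr1 (th af c i)).
by rewrite intS addrAC subrr add0r.
Qed.

Lemma half_acomm_minus (K : numFieldType) (A : algType K) (x y xi : nat -> A) :
  pshift (x_neg y) + half_acomm x xi = fun n =>
    2^-1 *: (series_mul (pshift (x : pser A)) (series_neg (xi_plus xi)) n +
             series_mul (series_neg (xi_plus xi)) (pshift (x : pser A)) n) +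
    series_neg (pshift (y : pser A)) n.
Proof.
apply: funext => n; rewrite pserDE addrC; congr (_ + _).
by case: n => [|n] //; rewrite /series_neg scaler0.
Qed.

Section TwistedYangian.
Variables (K : numFieldType) (g : lieAlgType K) (I : finType) (D : lie_datum g I).
Local Notation af := (sform D).
Local Notation c := (cmx D).
Local Notation Y := (yangian_of D).
Local Notation iY := (tyangian_of D).
Local Notation G := (@yhomog K I af c).

Lemma yhomog_weight k (y : Y) j : G k y -> comm (yxi af c j 0) y = rform D k j *: y.
Proof.
exact: (@span_weight K g I D Y (fun t => pres_gen _ t) (yangianP af c)).
Qed.

Lemma tensl_tensr (a y : Y) : tensl a * tensr y = tens a y.
Proof. by refine (etrans (tensM _ _ _ _) _); refine (congr2 _ _ _); [exact: mulr1 | exact: mul1r]. Qed.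
Lemma tensl_tensr_comm (a y : Y) : GRing.comm (tensl a) (tensr y).
Proof.
refine (etrans (tensl_tensr a y) (esym _)).
by refine (etrans (tensM _ _ _ _) _); refine (congr2 _ _ _); [exact: mul1r | exact: mulr1].
Qed.
Lemma series_tensE (f f' : nat -> Y) :
  series_tens f f' = smap (@tensl _ _ af c) f * smap (@tensr _ _ af c) f'.
Proof.
apply: funext => n; refine (esym (etrans (pserME _ _ _) _)).
by apply: eq_bigr => k _; apply: tensl_tensr.
Qed.

Variable iota : {linear g -> Y}.
Hypothesis iotaP : classical_inclusion iota.
Variable Delta : {lrmorphism Y -> tensor Y Y}.
Hypothesis DeltaP : yangian_coproduct iota Delta.
Variable phi : {lrmorphism iY -> Y}.
Hypothesis phiP : twisted_embedding iota phi.

Lemma coproduct_xi1 j : Delta (yxi af c j 1%N) =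
  tensl (yxi af c j 1%N) + tensr (yxi af c j 1%N) + tensl (yxi af c j 0%N) * tensr (yxi af c j 0%N) -
  \sum_(a <- posroots D) rform D a j *: (tensl (iota (rvec D false a)) * tensr (iota (rvec D true a))).
Proof.
refine (etrans (Delta_xi1 DeltaP j) _); refine (congr2 (fun u v => u - v) _ _).
  refine (congr2 (fun u v => u + v) (erefl _) _); refine (etrans _ (esym (tensl_tensr _ _))).
  exact: (congr2 (fun u v : Y => tens u v) (iota_xi iotaP j) (iota_xi iotaP j)).
by apply: eq_bigr => a _; refine (congr1 (fun u => _ *: u) (esym (tensl_tensr _ _))).
Qed.

Lemma embedding_b0 j : phi (tb af c j 0%N) = yx af c true j 0%N - yx af c false j 0%N.
Proof.
refine (etrans (phi_b0 phiP j) _).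
exact: (congr2 (fun u v : Y => u - v) (iota_chev iotaP true j) (iota_chev iotaP false j)).
Qed.

Lemma embedding_h1 j : phi (th af c j 1%N%:Z) = 2 *: yxi af c j 1%N - yxi af c j 0%N * yxi af c j 0%N +
  \sum_(a <- posroots D) rform D a j *: (iota (rvec D true a) * iota (rvec D true a)).
Proof.
refine (etrans (phi_h1 phiP j) _); refine (congr2 (fun u v : Y => u + v) _ (erefl _)).
by refine (congr1 (fun u : Y => _ - u) _); exact: (congr1 (fun u : Y => u * u) (iota_xi iotaP j)).
Qed.

Lemma coproduct_lie z : Delta (iota z) = tensl (iota z) + tensr (iota z).
Proof. exact: Delta_lie DeltaP z. Qed.

Variables (i : I) (cw : I -> K).
Hypothesis cwP : forall l : I, \sum_j cw j * af j l = (i == l)%:R.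

Let G0 k : G k 0. Proof. exact: lspan0. Qed.
Let GD k y z : G k y -> G k z -> G k (y + z). Proof. exact: lspanD. Qed.
Let GZ k a y : G k y -> G k (a *: y). Proof. exact: lspanZ. Qed.
Let GM k l y z : G k y -> G l z -> G (k + l) (y * z). Proof. exact: yhomogM. Qed.
Let Gxp j s : G (rdelta j) (yx af c true j s). Proof. exact: (yhomog_gen af c (YX true j s)). Qed.
Let Gxm j s : G (- rdelta j) (yx af c false j s). Proof. exact: (yhomog_gen af c (YX false j s)). Qed.
Let Gxi j s : G 0 (yxi af c j s). Proof. exact: (yhomog_gen af c (YXi j s)). Qed.

Let h_est := phi_h_estimate (yangianP af c) (tyangianP af c) G0 GD GZ GM (yhomog1 af c) Gxp Gxm Gxi
  (iota_lie iotaP) (iota_chev iotaP) embedding_b0 embedding_h1 cwP.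
Let b_est := phi_b_estimate (yangianP af c) (tyangianP af c) G0 GD GZ GM (yhomog1 af c) Gxp Gxm Gxi
  (iota_lie iotaP) (iota_chev iotaP) embedding_b0 embedding_h1 cwP.
Let hD_est := coideal_Delta_h (yangianP af c) (tyangianP af c) G0 GD GZ GM (yhomog1 af c) Gxp Gxm Gxi
  yhomog_weight (iota_lie iotaP) (iota_chev iotaP) (iota_xi iotaP) tensl_tensr_comm
  coproduct_lie coproduct_xi1 embedding_b0 embedding_h1 cwP.
Let bD_est := coideal_Delta_b_series (yangianP af c) (tyangianP af c) G0 GD GZ GM (yhomog1 af c) Gxp Gxm Gxi
  yhomog_weight (iota_lie iotaP) (iota_chev iotaP) (iota_xi iotaP) tensl_tensr_comm
  coproduct_lie coproduct_xi1 embedding_b0 embedding_h1 cwP.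

Local Notation xi_s := (xi_ser af c i).
Local Notation Qp := (@Qplus I).

Lemma twisted_h : series_congr (yspan Qp) (phi \o h_ser af c i) (series_mul xi_s (series_neg xi_s)).
Proof.
apply: (eq_ind _ (fun f : nat -> iY => series_congr _ (phi \o f) _) _ _ (esym (h_serE af c i))).
exact: h_est.
Qed.

Lemma twisted_b : series_congr (yspan (shift_set Qp (rdelta i))) (phi \o b_ser af c i)
  (fun n => 2^-1 *: (series_mul (x_ser af c true i) (series_neg xi_s) n
                           + series_mul (series_neg xi_s) (x_ser af c true i) n)
                  + series_neg (x_ser af c false i) n).
Proof.
have e : phi \o b_ser af c i = pshift (fun s => phi (tb af c i s)).
  exact: (smap_pshift phi (tb af c i)).
apply: (eq_ind _ (fun f => series_congr _ f _) _ _ (esym e)).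
apply: (eq_ind _ (fun f => series_congr _ _ f) _ _ (half_acomm_minus _ _ _)).
exact: b_est.
Qed.

Lemma coideal_spanE S (t : tensor Y Y) :
  lspan (fun u => exists2 k, S k & coideal_part G (@tensl _ _ af c) (@tensr _ _ af c) phi k u) t ->
  coideal_span phi S t.
Proof.
apply: lspan_sub => u [k Sk [a [y [yk ->]]]]; apply: lspan_gen; exists a, y.
by split; [exact: gspan_gen Sk yk | exact: tensl_tensr].
Qed.

Lemma coproduct_h : series_congr (coideal_span phi Qp) (Delta \o (phi \o h_ser af c i))
  (series_tens (phi \o h_ser af c i) (series_mul xi_s (series_neg xi_s))).
Proof.
apply: (eq_ind _ (fun f : nat -> iY => series_congr _ (Delta \o (phi \o f)) (series_tens (phi \o f) _))
  _ _ (esym (h_serE af c i))).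
apply: (eq_ind _ (fun f => series_congr _ _ f) _ _ (esym (series_tensE _ _))) => n.
exact: coideal_spanE (hD_est n).
Qed.

Lemma coproduct_b : series_congr (coideal_span phi Qp) (Delta \o (phi \o b_ser af c i))
  (fun n => series_tens (phi \o b_ser af c i) (series_neg xi_s) n + tens 1 ((phi \o b_ser af c i) n)).
Proof.
apply: (eq_ind _ (fun f => series_congr _ _ (fun n => f n + _)) _ _ (esym (series_tensE _ _))) => n.
exact: coideal_spanE (bD_est n).
Qed.

End TwistedYangian.

Theorem theorem3 (R : realType) (g : lieAlgType R[i]) (I : finType)
    (D : lie_datum g I) (g_simple : simple_lie g) (g_notG2 : ~ typeG2 (cmx D))
    (iota : {linear g -> yangian_of D})
    (iotaP : classical_inclusion iota)
    (Delta : {lrmorphism yangian_of D -> tensor (yangian_of D) (yangian_of D)})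
    (DeltaP : yangian_coproduct iota Delta)
    (phi : {lrmorphism tyangian_of D -> yangian_of D})
    (phiP : twisted_embedding iota phi)
    (i : I) :
  let xi := xi_ser (sform D) (cmx D) i in
  let xplus := x_ser (sform D) (cmx D) true i in
  let xminus := x_ser (sform D) (cmx D) false i in
  let h := phi \o h_ser (sform D) (cmx D) i in
  let b := phi \o b_ser (sform D) (cmx D) i in
  let Qp := @Qplus I in
  [/\ series_congr (yspan Qp) h (series_mul xi (series_neg xi)),
      series_congr (yspan (shift_set Qp (rdelta i))) b
        (fun n => 2^-1 *: (series_mul xplus (series_neg xi) n
                           + series_mul (series_neg xi) xplus n)
                  + series_neg xminus n),
      series_congr (coideal_span phi Qp) (Delta \o h)
        (series_tens h (series_mul xi (series_neg xi))) &
      series_congr (coideal_span phi Qp) (Delta \o b)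
        (fun n => series_tens b (series_neg xi) n + tens 1 (b n))].
Proof.
move=> xi xplus xminus h b Qp; have [cw cwP] := coweight_exists D i.
split; [exact: (twisted_h iotaP phiP cwP) | exact: (twisted_b iotaP phiP cwP) |
  exact: (coproduct_h iotaP DeltaP phiP cwP) | exact: (coproduct_b iotaP DeltaP phiP cwP)].
Qed.
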